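(* Let $g:\mathcal X\to\mathbb R$ be bounded and Borel measurable with $\mu(g)=0$, and put $M=c_P\|g^+\|_\infty$, where $g^+=\max\{g,0\}$ and $\|\cdot\|_\infty$ is the $L^\infty(\mu)$-norm. Then $g$ satisfies the transportation-information inequality with constant $M$; equivalently, $g$ satisfies Bernstein's inequality with constant $M$.
   Context: Setting. $\mathcal X$ is a Polish space with Borel $\sigma$-field $\mathcal B$, $\mathcal M_1(\mathcal X)$ is the set of probability measures on it, and $\mu\in\mathcal M_1(\mathcal X)$. $(X_t)_{t\ge0}$ is an $\mathcal X$-valued càdlàg Markov process defined on $(\Omega,\mathcal F,(\mathbb P_x)_{x\in\mathcal X})$ with $\mathbb P_x(X_0=x)=1$, whose transition semigroup $(P_t)$ is symmetric and strongly continuous on $L^2(\mu)$. For $\beta\in\mathcal M_1(\mathcal X)$, $\mathbb P_\beta=\int\beta(dx)\mathbb P_x$. Write $\mu(f)=\int f\,d\mu$, $\mathrm{Var}_\mu(f)=\mu(f^2)-\mu(f)^2$, $\langle f,g\rangle_\mu=\int fg\,d\mu$; $\|\cdot\|_p$ is the norm of $L^p(\mu)$. $\mathcal L$ is the generator, self-adjoint and non-positive on $L^2(\mu)$; the Dirichlet form is $\mathcal E(f,g)=\langle\sqrt{-\mathcal L}f,\sqrt{-\mathcal L}g\rangle_\mu$ with domain $\mathbb D(\mathcal E)=\mathbb D_2(\sqrt{-\mathcal L})$. Standing assumption: the Poincaré inequality $\mathrm{Var}_\mu(f)\le c_P\,\mathcal E(f,f)$ for all $f\in\mathbb D(\mathcal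 E)$, with finite best constant $c_P\ge0$. Fisher–Donsker–Varadhan information: $I(\nu|\mu)=\mathcal E(\sqrt f,\sqrt f)$ if $\nu=f\mu$ with $\sqrt f\in\mathbb D(\mathcal E)$, and $I(\nu|\mu)=+\infty$ otherwise. Asymptotic variance: $\sigma^2=\sigma^2(g)=\lim_{t\to\infty}\frac1t\mathrm{Var}_{\mathbb P_\mu}\big(\int_0^tg(X_s)ds\big)=2\int_0^\infty\langle P_tg,g\rangle_\mu dt$. Transportation-information inequality with constant $M$: for all $\nu\in\mathcal M_1(\mathcal X)$ with $\nu(|g|)<\infty$, $\nu(g)\le\sqrt{2\sigma^2I(\nu|\mu)}+M\,I(\nu|\mu)$ (right side $+\infty$ if $I(\nu|\mu)=+\infty$). Bernstein's inequality with constant $M$: for every probability $\beta\ll\mu$ and all $t,r>0$, $$\mathbb P_\beta\Big(\tfrac1t\int_0^tg(X_s)ds>r\Big)\le\Big\|\tfrac{d\beta}{d\mu}\Big\|_2\exp\Big(-\frac{2tr^2}{\sigma^2\big(\sqrt{1+2Mr/\sigma^2}+1\big)^2}\Big)\le\Big\|\tfrac{d\beta}{d\mu}\Big\|_2\exp\Big(-\frac{tr^2}{2(\sigma^2+Mr)}\Big),$$ where $\sigma^2(\sqrt{1+2Mr/\sigma^2}+1)^2$ is read as $(\sqrt{\sigma^2+2Mr}+\sigma)^2$ when $\sigma=0$. *)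

(* Defs.v *)
From HB Require Import structures.
From mathcomp Require Import all_boot all_order all_algebra.
From mathcomp Require Import all_classical all_reals all_analysis.

Set Implicit Arguments.
Unset Strict Implicit.
Unset Printing Implicit Defensive.

Import Order.TTheory GRing.Theory Num.Theory.
Import numFieldNormedType.Exports.

Local Open Scope classical_set_scope.
Local Open Scope charge_scope.
Local Open Scope ring_scope.

Notation borel X := (g_sigma_algebraType (@open X)).

(* The law \int beta(dx) P_x. *)
Section mixture.
Context d d' (T : measurableType d) (Omega : measurableType d') (R : realType).
Variables (P : R.-pker T ~> Omega) (beta : probability T R).
Local Open Scope ereal_scope.

Definition mixture (A : set Omega) : \bar R := \int[beta]_x P x A.

Let mixture0 : mixture set0 = 0.
Proof. by rewrite /mixture; under eq_integral do rewrite measure0; rewrite integral0. Qed.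

Let mixture_ge0 A : 0 <= mixture A.
Proof. by apply: integral_ge0 => x _; exact: measure_ge0. Qed.

Let mixture_sigma_additive : semi_sigma_additive mixture.
Proof.
move=> U mU tU mUU; rewrite [X in _ --> X](_ : _ =
  \int[beta]_x (\sum_(n <oo) P x (U n))); last first.
  apply: eq_integral => x _.
  by apply/esym/cvg_lim => //; exact/measure_semi_sigma_additive.
apply/cvg_closeP; split.
  by apply: is_cvg_nneseries => n _ _; exact: integral_ge0.
rewrite closeE// integral_nneseries// => n.
exact: measurable_kernel.
Qed.

HB.instance Definition _ := isMeasure.Build _ _ _ mixture
  mixture0 mixture_ge0 mixture_sigma_additive.

Let mixture_setT : mixture setT = 1.
Proof.
rewrite /mixture; under eq_integral do rewrite prob_kernel.
by rewrite integral_cst// mul1e; exact: probability_setT.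
Qed.

HB.instance Definition _ := Measure_isProbability.Build _ _ _ mixture
  mixture_setT.

End mixture.

Section L2.
Context d (T : measurableType d) (R : realType) (mu : probability T R).

Definition inner (f g : T -> R) : R := \int[mu]_x (f x * g x).

(* A partially defined operator on L^2(mu); elements of L^2(mu) are represented
   by functions, [op f] being relevant only for [f] in [dom]. *)
Record L2_operator := L2Operator {
  dom : set (T -> R) ;
  op : (T -> R) -> (T -> R) }.

Definition densely_defined (A : L2_operator) :=
  forall f, f \in Lfun mu 2%:E -> forall e : R, 0 < e ->
    exists2 u, dom A u & ('N[mu]_2%:E[EFin \o (f \- u)%R] < e%:E)%E.

(* The last clause is A = A^*. With density, it makes [dom A] and [op A]
   compatible with a.e. equality and linear. *)
Definition self_adjoint (A : L2_operator) :=
  [/\ forall f, dom A f -> f \in Lfun mu 2%:E /\ op A f \in Lfun mu 2%:E,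
      densely_defined A &
      forall f h, f \in Lfun mu 2%:E -> h \in Lfun mu 2%:E ->
        (forall u, dom A u -> inner (op A u) f = inner u h) <->
        (dom A f /\ op A f = h %[ae mu])].

Definition nonnegative (A : L2_operator) :=
  forall f, dom A f -> 0 <= inner (op A f) f.

(* [S] is the square root of -[A]: the non-negative self-adjoint operator
   whose square (with its natural domain) is -[A]. *)
Definition is_sqrt_opp (A S : L2_operator) :=
  [/\ self_adjoint S, nonnegative S,
      forall f, dom A f <-> (dom S f /\ dom S (op S f)) &
      forall f, dom A f -> op S (op S f) = \- op A f %[ae mu]].

End L2.

Section process.
Context (R : realType) (X : ptopologicalType).
Context d (Omega : measurableType d).
Variables (P : R.-pker (borel X) ~> Omega) (Z : R -> Omega -> X).

Definition cadlag (z : R -> X) :=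
  (forall t, 0 <= t -> z s @[s --> t^'+] --> z t) /\
  (forall t, 0 < t -> exists l : X, z s @[s --> t^'-] --> l).

Definition past (s : R) : set (set Omega) :=
  <<s \bigcup_(u in [set u | 0 <= u <= s])
        preimage_set_system setT (Z u : Omega -> borel X) measurable >>.

(* The last clause is P_x(Z_{s+t} \in B | past s) = P_{Z_s}(Z_t \in B). *)
Definition cadlag_markov_process :=
  [/\ forall t, 0 <= t -> measurable_fun setT (Z t : Omega -> borel X),
      forall w, cadlag (Z ^~ w),
      forall x, P x [set w | Z 0 w = x] = 1%E &
      forall x s t A (B : set (borel X)), 0 <= s -> 0 <= t ->
        past s A -> measurable B ->
        P x (A `&` Z (s + t) @^-1` B) =
        (\int[P x]_(w in A) P (Z s w) (Z t @^-1` B))%E].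

Definition semigroup (t : R) (f : borel X -> R) : borel X -> R :=
  fun x => \int[P x]_w f (Z t w).

Definition time_integral (g : borel X -> R) (t : R) (w : Omega) : R :=
  \int[lebesgue_measure]_(s in `[0, t]) g (Z s w).

Section reference_measure.
Variable mu : probability (borel X) R.

Definition symmetric_semigroup :=
  forall t, 0 <= t ->
    (forall f, f \in Lfun mu 2%:E -> semigroup t f \in Lfun mu 2%:E) /\
    (forall f g, f \in Lfun mu 2%:E -> g \in Lfun mu 2%:E ->
       inner mu (semigroup t f) g = inner mu f (semigroup t g)).

Definition strongly_continuous_semigroup :=
  forall f, f \in Lfun mu 2%:E ->
    ('N[mu]_2%:E[EFin \o (semigroup t f \- f)%R] @[t --> 0^'+] --> 0)%E.

Definition is_generator_value (f h : borel X -> R) :=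
  [/\ f \in Lfun mu 2%:E, h \in Lfun mu 2%:E &
      ('N[mu]_2%:E[EFin \o (fun x => t^-1 * (semigroup t f x - f x) - h x)%R]
         @[t --> 0^'+] --> 0)%E].

Definition generator : L2_operator (borel X) R :=
  L2Operator [set f | exists h, is_generator_value f h]
             (fun f => xget (cst 0) [set h | is_generator_value f h]).

Definition asymptotic_variance (g : borel X -> R) : R :=
  lim ((t^-1 * fine ('V_(mixture P mu) [time_integral g t])) @[t --> +oo]).

End reference_measure.

End process.

Section functional_inequalities.
Context d (T : measurableType d) (R : realType) (mu : probability T R).
(* [S] stands for the square root of minus the generator. *)
Variable S : L2_operator T R.

Definition dirichlet (f g : T -> R) : R := inner mu (op S f) (op S g).

Definition poincare (c : R) :=
  forall f, dom S f -> ('V_mu [f] <= (c * dirichlet f f)%R%:E)%E.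

Definition best_poincare_constant (c : R) :=
  [/\ 0 <= c, poincare c & forall c', 0 <= c' -> poincare c' -> c <= c'].

Definition density (nu : probability T R) : T -> R :=
  fun x => fine (('d (charge_of_finite_measure nu) '/d mu) x).

Definition sqrt_density (nu : probability T R) : T -> R :=
  fun x => Num.sqrt (density nu x).

Definition information (nu : probability T R) : \bar R :=
  if `[< nu `<< mu /\ dom S (sqrt_density nu) >]
  then (dirichlet (sqrt_density nu) (sqrt_density nu))%:E else +oo%E.

(* The right-hand side is +oo when I is, even if s2 = 0 or M = 0
   (in the library 0 * +oo = 0). *)
Definition transport_information_rhs (s2 M : R) (I : \bar R) : \bar R :=
  if I is i%:E then (Num.sqrt (2 * s2 * i) + M * i)%:E else +oo%E.

Definition transport_information (g : T -> R) (s2 M : R) :=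
  forall nu : probability T R, (\int[nu]_x `|g x|%:E < +oo)%E ->
    (\int[nu]_x (g x)%:E <= transport_information_rhs s2 M (information nu))%E.

End functional_inequalities.

Section bernstein.
Context (R : realType) (X : ptopologicalType) d (Omega : measurableType d).
Variables (P : R.-pker (borel X) ~> Omega) (Z : R -> Omega -> X).
Variable mu : probability (borel X) R.

Definition bernstein_denominator (s2 M r : R) : R :=
  if s2 == 0 then (Num.sqrt (s2 + 2 * M * r) + Num.sqrt s2) ^+ 2
  else s2 * (Num.sqrt (1 + 2 * M * r / s2) + 1) ^+ 2.

(* The exponents are computed in \bar R, where a / 0 = +oo for 0 < a, so that
   the exponentials vanish when s2 = M = 0. The norm of d beta / d mu may be
   +oo. *)
Definition bernstein (g : borel X -> R) (s2 M : R) :=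
  forall beta : probability (borel X) R, beta `<< mu ->
  forall t r : R, 0 < t -> 0 < r ->
  let norm := ('N[mu]_2%:E['d (charge_of_finite_measure beta) '/d mu])%E in
  let bound1 := (norm * expeR (- ((2 * t * r ^+ 2)%:E
                                  / (bernstein_denominator s2 M r)%:E)))%E in
  let bound2 := (norm * expeR (- ((t * r ^+ 2)%:E
                                  / (2 * (s2 + M * r))%:E)))%E in
  (mixture P beta [set w | (r < t^-1 * time_integral Z g t w)%R] <= bound1)%E /\
  (bound1 <= bound2)%E.

End bernstein.

(* Main.v *)
(* For delta > 0 put E_delta(h) = <h - P_delta h, h> / delta; it is at most
   E(h, h). Everything is done for the discrete energies E_delta.

   For centered f, comparing f with P_t f through the potential int_0^t P_s f ds,
   the Poincare inequality gives int_0^t <P_s f, f> ds <= c_P |f|^2. Telescoping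
   the sum of the P_(k delta) f and using the Cauchy-Schwarz inequality for the
   form <(1 - P_delta) u, v>, one gets
     <g, h>^2 <= E_delta(h) (sigma^2 / 2 + delta |g|^2) and
     |h0|^2 <= (c_P + delta) E_delta(h), h0 = h - mu(h).
   Since mu(g h^2) = 2 mu(h) <g, h0> + mu(g h0^2) and the last term is at most
   |g^+|_oo |h0|^2, this is a transportation-information inequality with E_delta
   in place of E, with an error which vanishes as delta tends to 0.

   For Bernstein's inequality, Jensen's inequality bounds exp(lambda int_0^t g(X_s) ds)
   by the average over theta in [0, delta] of
   exp(lambda delta sum_(k < n) g(X_(theta + k delta))), t = n delta. By the Markov
   property its expectation is an iterate of the operator exp(lambda delta g) P_delta,
   whose L^2 norm is controlled by the discrete inequality. It remains to let delta
   tend to 0, to use Chernoff's bound and to optimize over lambda; the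
   Feynman-Kac semigroup in continuous time is never needed. *)

Require Import Defs.
From HB Require Import structures.
From mathcomp Require Import all_boot all_order all_algebra.
From mathcomp Require Import all_classical all_reals all_analysis.
From mathcomp Require Import finmap measurable_realfun ess_sup_inf.
From mathcomp Require Import ring lra.

Import Order.TTheory GRing.Theory Num.Theory.
Import numFieldNormedType.Exports.

Set Implicit Arguments.
Unset Strict Implicit.
Unset Printing Implicit Defensive.

Local Open Scope classical_set_scope.
Local Open Scope ring_scope.

(** * Symmetric contraction semigroups as quadratic forms *)

(** No spectral theorem is used: P_t enters through the scalars <P_t f, h>, and what spectral
    calculus would give comes from P_t = (P_(t/2))^2 and Cauchy-Schwarz inequalities. The square
    root of minus the generator is known only through its self-adjointness and its square, so
    elements of its domain have to be produced. The potentials v = int_0^t P_s f ds serve: -L v = f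
    - P_t f, hence E(v, k) = <f - P_t f, k>. This identity gives E_delta <= E, and it lets the
    Poincare inequality be applied to v when f is outside the domain. The energies E_delta are
    finite on all of L^2, as required for the functions exp(lambda delta g / 2) f of the Feynman-Kac
    estimate. Another obstacle is that P_t acts on functions, as an expectation with a default value
    when it diverges; linearity and the semigroup law hold only almost everywhere, but become
    identities when tested against h in L^2. The variance sigma^2 enters through 2 int_0^t <P_s g,
    g> ds <= sigma^2 for all t. *)

Section psd_forms.
Context (R : realType) (V : lmodType R).
Implicit Types (b : V -> V -> R) (f g h : V).

Definition psd_form b :=
  [/\ forall a f g h, b (a *: f + g) h = a * b f h + b g h,
      forall f h, b f h = b h f & forall f, 0 <= b f f].

Variable b : V -> V -> R.
Hypothesis psdb : psd_form b.

Lemma psd_linl a f g h : b (a *: f + g) h = a * b f h + b g h.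
Proof. by have [+ _ _] := psdb; apply. Qed.

Lemma psd_sym f h : b f h = b h f.
Proof. by have [_ + _] := psdb; apply. Qed.

Lemma psd_ge0 f : 0 <= b f f.
Proof. by have [_ _] := psdb; apply. Qed.

Lemma psd_linr a f g h : b h (a *: f + g) = a * b h f + b h g.
Proof. by rewrite psd_sym psd_linl 2!(psd_sym h). Qed.

Lemma psdDl f g h : b (f + g) h = b f h + b g h.
Proof. by rewrite -[f]scale1r psd_linl mul1r scale1r. Qed.

Lemma psd0l h : b 0 h = 0.
Proof. by have := psdDl 0 0 h; rewrite addr0 => /eqP; rewrite addrC -subr_eq subrr => /eqP. Qed.

Lemma psdZl a f h : b (a *: f) h = a * b f h.
Proof. by rewrite -[a *: f]addr0 psd_linl psd0l addr0. Qed.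

Lemma psdZr a f h : b h (a *: f) = a * b h f.
Proof. by rewrite psd_sym psdZl psd_sym. Qed.

Lemma psdBl f g h : b (f - g) h = b f h - b g h.
Proof. by rewrite psdDl -scaleN1r psdZl mulN1r. Qed.

Lemma psdBr f g h : b h (f - g) = b h f - b h g.
Proof. by rewrite psd_sym psdBl 2!(psd_sym h). Qed.

Lemma psd_suml n (F : 'I_n -> V) h : b (\sum_(i < n) F i) h = \sum_(i < n) b (F i) h.
Proof.
elim/big_ind2 : _ => [|x1 x2 y1 y2 <- <-|//]; first exact: psd0l.
by rewrite psdDl.
Qed.

Lemma psd_CauchySchwarz f h : b f h ^+ 2 <= b f f * b h h.
Proof.
have E s t : 0 <= s ^+ 2 * b f f - 2 * s * t * b f h + t ^+ 2 * b h h.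
  have := psd_ge0 (s *: f - t *: h).
  rewrite psdBl !psdBr !psdZl !psdZr (psd_sym h f); congr (_ <= _); ring.
have f0 := psd_ge0 f; have h0 := psd_ge0 h.
have [hh0|hh0] := ltrP 0 (b h h).
  by have := E (b h h) (b f h); nra.
have [ff0|ff0] := ltrP 0 (b f f).
  by have := E (b f h) (b f f); nra.
by have := E 1 (b f h); nra.
Qed.

End psd_forms.

(** If u 0 > w, the ratios u n / w would grow at least like (u 0 / w)^(2^n). The linear lower bound
    w (1 + n q), with q = u 0 / w - 1, already contradicts boundedness. *)
Lemma le_of_sqr_chain (R : realType) (u : nat -> R) (w C : R) :
  0 <= w -> (forall n, 0 <= u n <= C) ->
  (forall n, u n ^+ 2 <= w * u n.+1) -> u 0 <= w.
Proof.
move=> w0 ub us; rewrite leNgt; apply/negP => wu.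
have [w00|w1] := eqVneq w 0.
  by have := us 0; rewrite w00 mul0r; rewrite w00 in wu; nra.
have {w0 w1}w0 : 0 < w by rewrite lt_def w1.
pose q := u 0 / w - 1.
have q0 : 0 < q by rewrite subr_gt0 ltr_pdivlMr// mul1r.
have H n : w * (1 + n%:R * q) <= u n.
  elim: n => [|n IH].
    by rewrite mul0r addr0 mulr1 ltW.
  have := us n; have [un0 _] := andP (ub n); have [un1 _] := andP (ub n.+1).
  (* At n = 0 the induction hypothesis only says w <= u 0; the exact value u 0 = w (1 + q) is needed
     to start. *)
  case: n IH {un1} un0 => [|n] IH un0 H2.
    rewrite -(ler_pM2l w0); apply: le_trans H2.
    have -> : u 0 = w * (1 + q) by rewrite /q addrC subrK mulrC divfK ?gt_eqF.
    by rewrite mul1r; nra.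
  rewrite -(ler_pM2l w0); apply: le_trans H2.
  have nq : 0 <= n.+1%:R * q by rewrite mulr_ge0// ltW.
  have nq' : q <= n.+1%:R * q by apply: ler_peMl; [exact: ltW|rewrite ler1n].
  apply: (@le_trans _ _ ((w * (1 + n.+1%:R * q)) ^+ 2)); last first.
    by rewrite ler_sqr ?nnegrE// mulr_ge0 ?addr_ge0// ltW.
  rewrite -(natr1 n.+1) exprMn expr2 -mulrA ler_pM2l// ler_pM2l// mulrDl mul1r.
  by move: nq nq'; move: (n.+1%:R * q) => y; nra.
have [n Hn] : exists n : nat, C < w * (1 + n%:R * q).
  have wq : 0 < w * q by rewrite mulr_gt0.
  exists (Num.truncn (`|C| / (w * q))).+1.
  have := truncnS_gt (`|C| / (w * q)).
  rewrite ltr_pdivrMr// => H1; have := ler_norm C; nra.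
by have [_] := andP (ub n); rewrite leNgt (lt_le_trans Hn).
Qed.

Section semigroup_forms.
Context (R : realType) (V : lmodType R).
Variables (B : R -> V -> V -> R) (T : R -> V -> V).

(* [B t f h] stands for <P_t f, h>; [T] itself need not be linear, since the
   operators P_t act on functions and are linear only almost everywhere. *)
Definition semigroup_form :=
  [/\ forall t a f g h, 0 <= t -> B t (a *: f + g) h = a * B t f h + B t g h,
      forall t f h, 0 <= t -> B t f h = B t h f,
      forall f, 0 <= B 0 f f,
      forall s t f h, 0 <= s -> 0 <= t -> B s (T t f) h = B (s + t) f h &
      forall t f, 0 <= t -> B t f f <= B 0 f f].

Hypothesis sgB : semigroup_form.
Implicit Types (f g h : V).

Lemma semigroup_formT s t f h : 0 <= s -> 0 <= t -> B s (T t f) h = B (s + t) f h.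
Proof. by have [_ _ _ + _] := sgB; apply. Qed.

Lemma semigroup_formTr s t f h : 0 <= s -> 0 <= t -> B s f (T t h) = B (s + t) f h.
Proof.
have [_ Bsym _ _ _] := sgB.
by move=> s0 t0; rewrite Bsym// semigroup_formT// Bsym// addr_ge0.
Qed.

(** P_t is the square of the symmetric operator P_(t/2); this is the source of the positivity of
    <P_t f, f>. *)
Lemma semigroup_form_half t f h : 0 <= t -> B t f h = B 0 (T (t / 2) f) (T (t / 2) h).
Proof.
move=> t0; have t20 : 0 <= t / 2 by rewrite divr_ge0.
by rewrite semigroup_formT// semigroup_formTr ?addr_ge0// add0r -splitr.
Qed.

Lemma psd_semigroup_form t : 0 <= t -> psd_form (B t).
Proof.
move=> t0; have [Blin Bsym B0 _ _] := sgB; split.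
- by move=> *; exact: Blin.
- by move=> *; exact: Bsym.
- by move=> f; rewrite semigroup_form_half.
Qed.

(** The form of 1 - P_t, positive by contractivity. At t = delta it is delta E_delta, and its
    Cauchy-Schwarz inequality drives the discrete estimates. *)
Lemma psd_semigroup_form_gap t : 0 <= t -> psd_form (fun f h => B 0 f h - B t f h).
Proof.
move=> t0; have [Blin Bsym _ _ Bc] := sgB; split.
- by move=> *; rewrite !Blin//; ring.
- by move=> f h; rewrite !(Bsym _ f)//.
- by move=> f; rewrite subr_ge0 Bc.
Qed.

Lemma semigroup_form_ge0 t f : 0 <= t -> 0 <= B t f f.
Proof. by move=> t0; exact: (psd_ge0 (psd_semigroup_form t0)). Qed.

(** Since 1 - P_t commutes with P_(s/2), a gap starting at time s is a gap starting at time 0 for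
    P_(s/2) f. *)
Lemma semigroup_form_gap_shift s t f : 0 <= s -> 0 <= t ->
  B s f f - B (s + t) f f = B 0 (T (s / 2) f) (T (s / 2) f) - B t (T (s / 2) f) (T (s / 2) f).
Proof.
move=> s0 t0; have s20 : 0 <= s / 2 by rewrite divr_ge0.
rewrite -semigroup_form_half//; congr (_ - _).
rewrite semigroup_formT// semigroup_formTr ?addr_ge0//.
by congr (B _ f f); rewrite -addrA -splitr addrC.
Qed.

Lemma semigroup_form_nonincreasing s t f : 0 <= s -> s <= t -> B t f f <= B s f f.
Proof.
move=> s0 st; have ts0 : 0 <= t - s by rewrite subr_ge0.
rewrite -subr_ge0 -[in B t](subrKC s t) semigroup_form_gap_shift//.
exact: (psd_ge0 (psd_semigroup_form_gap ts0)).
Qed.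

(* Convexity of [t |-> B t f f]. The Cauchy-Schwarz inequality for the form
   [B 0 - B t] gives [w s ^ 2 <= w 0 * w (2 s)] for [w s = B s f f - B (s + t) f f];
   iterating, [w 0 < w s] would make [w] unbounded. *)
Lemma semigroup_form_gap_le s t f : 0 <= s -> 0 <= t ->
  B s f f - B (s + t) f f <= B 0 f f - B t f f.
Proof.
move=> s0 t0.
have psdQ := psd_semigroup_form_gap t0.
pose u n := B (2 ^+ n * s) f f - B (2 ^+ n * s + t) f f.
have ns0 n : 0 <= 2 ^+ n * s by rewrite mulr_ge0// exprn_ge0.
suff : u 0 <= B 0 f f - B t f f by rewrite /u expr0 mul1r.
apply: (@le_of_sqr_chain _ u _ (B 0 f f)); first exact: (psd_ge0 psdQ).
  move=> n; rewrite /u semigroup_form_gap_shift//.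
  rewrite (psd_ge0 psdQ)/= lerBlDr -semigroup_form_half//.
  rewrite (@le_trans _ _ (B 0 f f))//; first exact: semigroup_form_nonincreasing.
  by rewrite lerDl; exact: semigroup_form_ge0.
move=> n.
have := psd_CauchySchwarz psdQ (T (2 ^+ n * s) f) f.
rewrite !semigroup_formT//= !semigroup_formTr ?addr_ge0// !add0r [leRHS]mulrC.
have E : 2 ^+ n.+1 * s = 2 ^+ n * s + 2 ^+ n * s by rewrite exprS; ring.
by rewrite /u E -!addrA !(addrC t) -addrA.
Qed.

Section discrete.
Variables (delta : R) (delta_gt0 : 0 < delta).

Let delta_ge0 : 0 <= delta := ltW delta_gt0.

Let kdelta_ge0 k : 0 <= k%:R * delta.
Proof. exact: mulr_ge0. Qed.

Definition discrete_potential f n := \sum_(k < n) T (k%:R * delta) f.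

Lemma gap_discrete_potential f h n :
  B 0 (discrete_potential f n) h - B delta (discrete_potential f n) h =
  B 0 f h - B (n%:R * delta) f h.
Proof.
rewrite /discrete_potential (psd_suml (psd_semigroup_form (lexx 0))).
rewrite (psd_suml (psd_semigroup_form delta_ge0)).
rewrite -sumrB.
transitivity (\sum_(k < n) (B (k%:R * delta) f h - B (k.+1%:R * delta) f h)).
  apply: eq_bigr => k _; rewrite !semigroup_formT// add0r; congr (_ - B _ _ _).
  by rewrite -natr1 mulrDl mul1r addrC.
rewrite -(big_mkord xpredT (fun k => B (k%:R * delta) f h - B (k.+1%:R * delta) f h)).
under eq_bigr do rewrite -opprB.
by rewrite sumrN telescope_sumr// opprB mul0r.
Qed.

(* With [Q = 1 - P_delta] and [u] a partial sum of the potential of [f], the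
   inner product of [f] and [h] is [<Q u, h>] up to a term which tends to [0]. *)
Lemma discrete_green f h (Psi : R) :
  (forall n, delta * \sum_(k < n) B (k.+1%:R * delta) f f <= Psi) ->
  B 0 f h ^+ 2 <= delta^-1 * (B 0 h h - B delta h h) * (Psi + delta * B 0 f f).
Proof.
move=> HPsi.
have Psi0 : 0 <= Psi by have := HPsi 0; rewrite big_ord0 mulr0.
pose S := delta^-1 * (Psi + delta * B 0 f f).
pose Q := B 0 h h - B delta h h.
have psdQ := psd_semigroup_form_gap delta_ge0.
have Q0 : 0 <= Q by exact: (psd_ge0 psdQ).
have B00 := psd_ge0 (psd_semigroup_form (lexx 0)).
have S0 : 0 <= S by rewrite mulr_ge0 ?invr_ge0// addr_ge0// mulr_ge0.
have -> : delta^-1 * (B 0 h h - B delta h h) * (Psi + delta * B 0 f f) = Q * S.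
  by rewrite /Q /S; ring.
have main n : (B 0 f h - B (n%:R * delta) f h) ^+ 2 <= S * Q.
  rewrite -gap_discrete_potential.
  apply: (le_trans (psd_CauchySchwarz psdQ _ _)).
  rewrite ler_wpM2r// gap_discrete_potential.
  have psdn : psd_form (fun f h => B 0 f h - B (n%:R * delta) f h).
    exact: psd_semigroup_form_gap.
  have := psd_sym psdn f (discrete_potential f n); rewrite /= => ->.
  rewrite /discrete_potential (psd_suml (psd_semigroup_form (lexx 0))).
  rewrite (psd_suml (psd_semigroup_form (kdelta_ge0 n))) -sumrB.
  apply: (@le_trans _ _ (\sum_(k < n) B (k%:R * delta) f f)).
    apply: ler_sum => k _; rewrite !semigroup_formT// add0r lerBlDr lerDl.
    by rewrite semigroup_form_ge0 ?addr_ge0.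
  rewrite /S -(ler_pM2l delta_gt0) mulrA mulfV ?gt_eqF// mul1r.
  (* The hypothesis on [Psi] covers the terms k >= 1; the term k = 0 produces [delta * B 0 f f]. *)
  case: n {psdn} => [|n]; first by rewrite big_ord0 mulr0 addr_ge0// mulr_ge0.
  by rewrite big_ord_recl/= mul0r mulrDr addrC lerD2r; exact: HPsi.
(* The terms B (k delta) f f are nonincreasing with bounded sums, so the n-th one is O(1/n). By the
   Cauchy-Schwarz inequality for [B (n delta)], the remainder <P_(n delta) f, h> then tends to 0. *)
have decay n : (0 < n)%N -> n%:R * delta * B (n%:R * delta) f f <= Psi.
  move=> n0; apply: le_trans (HPsi n).
  rewrite [leLHS]mulrAC [leLHS]mulrC ler_wpM2l// (mulr_natl (B _ f f)).
  have E (b : R) : b *+ n = \sum_(k < n) b by rewrite sumr_const card_ord.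
  rewrite [leLHS]E; apply: ler_sum => k _.
  apply: semigroup_form_nonincreasing; first exact: kdelta_ge0.
  by rewrite ler_wpM2r// ler_nat.
have small n : (0 < n)%N -> n%:R * delta * B (n%:R * delta) f h ^+ 2 <= Psi * B 0 h h.
  move=> n0; have nd := kdelta_ge0 n.
  have := psd_CauchySchwarz (psd_semigroup_form nd) f h.
  have [_ _ _ _ /(_ (n%:R * delta) h nd)] := sgB.
  have := decay _ n0.
  have := semigroup_form_ge0 f nd; have := semigroup_form_ge0 h nd.
  move: (B _ f f) (B _ h h) (B _ f h) => x y z x0 y0 H1 H2 H3.
  apply: (@le_trans _ _ (n%:R * delta * (x * y))); first exact: ler_wpM2l.
  by rewrite mulrA ler_pM// mulr_ge0.
rewrite mulrC leNgt; apply/negP => lt.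
have SQ0 : 0 <= S * Q by exact: mulr_ge0.
(* |<f,h>| - |<P_(n delta) f, h>| <= sqrt (S Q) for all n *)
pose e := `|B 0 f h| - Num.sqrt (S * Q).
have e0 : 0 < e.
  by rewrite subr_gt0 -sqrtr_sqr ltr_sqrt// (le_lt_trans SQ0 lt).
have He n : (0 < n)%N -> n%:R * delta * e ^+ 2 <= Psi * B 0 h h.
  move=> n0; apply: le_trans (small _ n0); rewrite ler_wpM2l//.
  have : `|B 0 f h - B (n%:R * delta) f h| <= Num.sqrt (S * Q).
    by rewrite -sqrtr_sqr ler_wsqrtr.
  move=> H1; have H2 : e <= `|B (n%:R * delta) f h|.
    rewrite /e lerBlDr (le_trans _ (lerD (lexx _) H1))//.
    rewrite (le_trans _ (ler_normD _ _))//.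
    by rewrite addrC subrK.
  rewrite -[leRHS]real_normK ?num_real//.
  by rewrite ler_sqr ?nnegrE// ltW.
have de : 0 < delta * e ^+ 2 by rewrite mulr_gt0// exprn_gt0.
have := He (Num.truncn (`|Psi * B 0 h h| / (delta * e ^+ 2))).+1 isT.
have := truncnS_gt (`|Psi * B 0 h h| / (delta * e ^+ 2)).
rewrite ltr_pdivrMr// -mulrA => H1 H2.
by have := lt_le_trans H1 H2; rewrite ltNge ler_norm.
Qed.

(** This is [discrete_green] at f = h with Psi = c |h|^2, divided by |h|^2. *)
Lemma discrete_poincare h (c : R) : 0 <= c ->
  (forall n, delta * \sum_(k < n) B (k.+1%:R * delta) h h <= c * B 0 h h) ->
  B 0 h h <= (c + delta) * (delta^-1 * (B 0 h h - B delta h h)).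
Proof.
move=> c0 /discrete_green => /(_ h).
have := psd_ge0 (psd_semigroup_form_gap delta_ge0) h => /= Q0.
have := semigroup_form_ge0 h (lexx 0).
rewrite le_eqVlt => /predU1P[h0 _|h0].
  by rewrite -[leLHS]h0 mulr_ge0 ?addr_ge0// mulr_ge0 ?invr_ge0.
move: (delta^-1 * _) => E H; rewrite -(ler_pM2l h0) -expr2 (le_trans H)//.
by rewrite le_eqVlt; apply/orP; left; apply/eqP; ring.
Qed.

Section twisted.
Variables (A : V -> V) (kappa : R).
Hypothesis A_sym : forall f h, B 0 (A f) h = B 0 f (A h).
Hypothesis A_le : forall f, B delta (A f) (A f) <= kappa * B 0 f f.

(** Iterates of A P_delta A. For A the multiplication by exp(lambda delta g / 2), this is the
    symmetrized form of exp(lambda delta g) P_delta, whose norm can be read off its quadratic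
    form. *)
Fixpoint twisted_iter f n :=
  if n is n'.+1 then A (T delta (A (twisted_iter f n'))) else f.

(** A positive symmetric operator whose quadratic form is at most kappa has norm at most kappa. With
    y = A P_delta A g, the Cauchy-Schwarz inequality for [B delta] gives |y|^4 = <P_delta A g, A
    y>^2 <= (kappa |g|^2) (kappa |y|^2). *)
Lemma twisted_iter_le f n : 0 <= kappa ->
  B 0 (twisted_iter f n) (twisted_iter f n) <= (kappa ^+ n) ^+ 2 * B 0 f f.
Proof.
move=> k0; have B00 := psd_ge0 (psd_semigroup_form (lexx 0)).
elim: n => [|n IH]; first by rewrite expr0 expr1n mul1r.
have H g : B 0 (A (T delta (A g))) (A (T delta (A g))) <= kappa ^+ 2 * B 0 g g.
  set y := A (T delta (A g)).
  have yE : B 0 y y = B delta (A g) (A y) by rewrite {1}/y A_sym semigroup_formT// add0r.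
  have := psd_CauchySchwarz (psd_semigroup_form delta_ge0) (A g) (A y).
  rewrite -yE; have := A_le g; have := A_le y.
  have := semigroup_form_ge0 (A g) delta_ge0; have := semigroup_form_ge0 (A y) delta_ge0.
  have := B00 y; have := B00 g.
  move: (B 0 y y) (B 0 g g) (B delta _ _) (B delta _ _) => x z p q z0 + p0 q0 H1 H2 H3.
  rewrite le_eqVlt => /predU1P[<-|x0]; first by rewrite mulr_ge0// exprn_ge0.
  rewrite -(ler_pM2l x0) -expr2 (le_trans H3)// mulrCA.
  apply: (@le_trans _ _ ((kappa * z) * (kappa * x))); first exact: ler_pM.
  by rewrite expr2; lra.
by apply: (le_trans (H _)); rewrite [kappa ^+ n.+1]exprS exprMn -[leRHS]mulrA ler_wpM2l// exprn_ge0.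
Qed.

End twisted.

End discrete.

End semigroup_forms.

(** * Integration *)

Section nonnegative_functionals.
Context d (T : measurableType d) (R : realType).
Local Open Scope ereal_scope.
Implicit Types (I J : (T -> \bar R) -> \bar R) (f g : T -> \bar R).

Definition nonneg_measurable f := measurable_fun [set: T] f /\ forall x, 0 <= f x.

(* The properties of f |-> \int f dm that determine it from its values on
   indicator functions. *)
Definition integral_like I :=
  [/\ forall f, nonneg_measurable f -> 0 <= I f,
      forall f g, nonneg_measurable f -> nonneg_measurable g -> I (f \+ g) = I f + I g,
      forall (r : R) f, (0 <= r)%R -> nonneg_measurable f ->
        I (fun x => r%:E * f x) = r%:E * I f,
      forall f g, nonneg_measurable f -> nonneg_measurable g ->
        (forall x, f x <= g x) -> I f <= I g &
      forall (f_ : nat -> T -> \bar R) f, (forall n, nonneg_measurable (f_ n)) ->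
        nonneg_measurable f ->
        (forall x, nondecreasing_seq (f_ ^~ x)) ->
        (forall x, f_ n x @[n --> \oo] --> f x) -> I (f_ n) @[n --> \oo] --> I f].

Import HBNNSimple.

(** The usual passage from indicators to simple functions to monotone limits, done once. It serves
    for the Markov property, the invariance of mu and integration against a mixture. *)
Lemma integral_like_ext I J : integral_like I -> integral_like J ->
  (forall A, measurable A -> I (EFin \o \1_A) = J (EFin \o \1_A)) ->
  forall f, nonneg_measurable f -> I f = J f.
Proof.
move=> fI fJ IJ f [mf f0].
have simple (h : {nnsfun T >-> R}) : I (EFin \o h) = J (EFin \o h).
  have -> : EFin \o h = fun x => \sum_(r <- fset_set (range h)) (r * \1_(h @^-1` [set r]) x)%:E.
    by apply/funext => x /=; rewrite fimfunE fsbig_finite//= sumEFin.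
  have H (r : R) : nonneg_measurable (fun x => (r * \1_(h @^-1` [set r]) x)%:E).
    split; first exact/measurable_EFinP/measurable_funM.
    by move=> x; rewrite EFinM nnfun_muleindic_ge0.
  have H0 (K : (T -> \bar R) -> \bar R) : integral_like K -> K (cst 0) = 0.
    move=> [_ _ KZ _ _].
    have nn0 : nonneg_measurable (cst 0 : T -> \bar R) by split.
    have := KZ 0%R _ (lexx _) nn0; rewrite mul0e => H1; rewrite -[RHS]H1; congr K.
    by apply/funext => x /=; rewrite mul0e.
  have HJ r : I (fun x => (r * \1_(h @^-1` [set r]) x)%:E) = J (fun x => (r * \1_(h @^-1` [set r]) x)%:E).
    have [r0|r0] := leP 0%R r.
      have mh : measurable (h @^-1` [set r]) by [].
      have nni : nonneg_measurable (EFin \o \1_(h @^-1` [set r]) : T -> \bar R).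
        by split; [exact/measurable_EFinP|move=> x; rewrite lee_fin].
      have [_ _ IZ _ _] := fI; have [_ _ JZ _ _] := fJ.
      have := IZ _ _ r0 nni; have := JZ _ _ r0 nni.
      under eq_fun do rewrite /= -EFinM.
      by move=> -> ->; rewrite IJ.
    have -> : (fun x => (r * \1_(h @^-1` [set r]) x)%:E) = cst 0.
      by apply/funext => x; rewrite preimage_nnfun0// indic0 mulr0.
    by rewrite !H0.
  elim: (enum_fset (fset_set (range h))) => [|r s IHs].
    by under eq_fun do rewrite big_nil; rewrite !H0.
  under eq_fun do rewrite big_cons.
  have nns : nonneg_measurable (fun x => \sum_(r <- s) (r * \1_(h @^-1` [set r]) x)%:E).
    split; first by apply: emeasurable_sum => r0; have [] := H r0.
    by move=> x; apply: sume_ge0 => r0 _; have [_ +] := H r0; apply.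
  have [_ ID _ _ _] := fI; have [_ JD _ _ _] := fJ.
  have := ID _ _ (H r) nns; have := JD _ _ (H r) nns.
  by move=> /= -> ->; rewrite HJ IHs.
pose f_ := nnsfun_approx measurableT mf.
have nnf_ n : nonneg_measurable (EFin \o f_ n).
  by split; [exact/measurable_EFinP|move=> x; rewrite lee_fin].
have ndf x : nondecreasing_seq ((fun n => EFin \o f_ n) ^~ x).
  by move=> m n mn; rewrite lee_fin; exact/lefP/nd_nnsfun_approx.
have cvf x : (EFin \o f_ n) x @[n --> \oo] --> f x by exact: cvg_nnsfun_approx.
have [_ _ _ _ /(_ _ _ nnf_ (conj mf f0) ndf cvf) cI] := fI.
have [_ _ _ _ /(_ _ _ nnf_ (conj mf f0) ndf cvf) cJ] := fJ.
have E : (fun n => I (EFin \o f_ n)) = (fun n => J (EFin \o f_ n)).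
  by apply/funext => n; exact: simple.
by rewrite E in cI; exact: (cvg_unique _ cI cJ).
Qed.

Lemma integral_like_eval x : integral_like (fun f => f x).
Proof.
split => [f []//|//|//|f g _ _ //|f_ f _ _ _]; exact.
Qed.

(** Closure under averaging. The weight [Y] lets a function of one time of the process be held fixed
    while the other factor varies, as in [markov_fun]. *)
Lemma integral_like_integral d' (S : measurableType d') (m : {measure set S -> \bar R})
    (D : set S) (Y : S -> R) (K : S -> (T -> \bar R) -> \bar R) :
  measurable D -> measurable_fun [set: S] Y -> (forall w, 0 <= Y w)%R ->
  (forall w, integral_like (K w)) ->
  (forall f, nonneg_measurable f -> measurable_fun [set: S] (K ^~ f)) ->
  integral_like (fun f => \int[m]_(w in D) ((Y w)%:E * K w f)).
Proof.
move=> mD mY Y0 Kil mK.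
have mYK f : nonneg_measurable f -> measurable_fun D (fun w => (Y w)%:E * K w f).
  move=> nf; apply: measurable_funTS; apply: emeasurable_funM; last exact: mK.
  exact/measurable_EFinP.
have K0 f w : nonneg_measurable f -> 0 <= K w f by move=> nf; have [+ _ _ _ _] := Kil w; apply.
have YK0 f w : nonneg_measurable f -> 0 <= (Y w)%:E * K w f.
  by move=> nf; apply: mule_ge0; [rewrite lee_fin|exact: K0].
split.
- by move=> f nf; apply: integral_ge0 => w _; exact: YK0.
- move=> f g nf ng; rewrite -ge0_integralD//; try exact: mYK; try by move=> w _; exact: YK0.
  by apply: eq_integral => w _; have [_ -> //] := Kil w; rewrite ge0_muleDr ?K0.
- move=> r f r0 nf; rewrite -ge0_integralZl//; [|exact: mYK|by move=> w _; exact: YK0].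
  by apply: eq_integral => w _; have [_ _ -> // _ _] := Kil w; rewrite muleCA.
- move=> f g nf ng fg; apply: ge0_le_integral => //; try exact: mYK; try by move=> w _; exact: YK0.
  by move=> w _; rewrite lee_wpmul2l ?lee_fin//; have [_ _ _ + _] := Kil w; apply.
- move=> f_ f nf_ nf ndf cf.
  have E : (fun w => limn (fun n => (Y w)%:E * K w (f_ n))) = fun w => (Y w)%:E * K w f.
    apply/funext => w; apply/cvg_lim => //.
    have [_ _ _ _ /(_ _ _ nf_ nf ndf cf)] := Kil w.
    exact: cvgeZl.
  have := @cvg_monotone_convergence _ _ _ m D mD (fun n w => (Y w)%:E * K w (f_ n)).
  rewrite E; apply.
  + by move=> n; exact: mYK.
  + by move=> n w _; exact: YK0.
  + by move=> w _ m' n mn; rewrite lee_wpmul2l ?lee_fin//; have [_ _ _ + _] := Kil w; apply => // x; exact: ndf.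
Qed.

End nonnegative_functionals.

(** * Translation and reflection of Lebesgue integrals *)

Section translation.
Context (R : realType).
Local Open Scope ereal_scope.
Local Notation leb := (@lebesgue_measure R).

Let shift (c : R) : measurableTypeR R -> measurableTypeR R := fun x => (x + c)%R.

Let measurable_shift c : measurable_fun [set: measurableTypeR R] (shift c).
Proof. by apply: measurable_funD => //; exact: measurable_cst. Qed.

Lemma lebesgue_measure_shift c (A : set R) : measurable A ->
  pushforward leb (fun x : R => (x + c)%R : measurableTypeR R) A = leb A.
Proof.
move=> mA; have mc := measurable_shift c.
pose m' := isMeasurableFun.Build _ _ (measurableTypeR R) (measurableTypeR R) _ mc.
pose phi : {mfun measurableTypeR R >-> measurableTypeR R} := HB.pack (shift c) m'.
apply/esym; apply: (@lebesgue_measure_unique R (pushforward leb phi)) => // X [[a b] _ <-].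
transitivity (leb `](a - c)%R, (b - c)%R]).
  rewrite !lebesgue_measure_itv/= !lte_fin ltrD2r; case: ifPn => // _.
  by rewrite -!EFinB; congr EFin; ring.
congr (leb _); apply/seteqP; split => x /=; rewrite !in_itv/= /shift => /andP[? ?]; apply/andP; split; lra.
Qed.

Lemma ge0_integral_shift (a b c : R) (f : R -> \bar R) :
  measurable_fun [set: R] f -> (forall x, 0 <= f x) ->
  \int[leb]_(x in `[a, b]) f (x + c)%R = \int[leb]_(x in `[(a + c)%R, (b + c)%R]) f x.
Proof.
move=> mf f0.
transitivity (\int[pushforward leb (shift c)]_(x in `[(a + c)%R, (b + c)%R]) f x).
  rewrite ge0_integral_pushforward//.
  - by congr integral; apply/seteqP; split => x /=; rewrite !in_itv/= /shift !lerD2r.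
  - exact: measurable_funTS.
apply: eq_measure_integral => A mA _; exact: lebesgue_measure_shift.
Qed.

Lemma ge0_integral_reflect (a b c : R) (f : R -> \bar R) :
  measurable_fun [set: R] f -> (forall x, 0 <= f x) ->
  \int[leb]_(x in `[a, b]) f (c - x)%R = \int[leb]_(x in `[(c - b)%R, (c - a)%R]) f x.
Proof.
move=> mf f0.
have mc : measurable_fun [set: R] (fun x : R => c - x)%R.
  by apply: measurable_funB => //; exact: measurable_cst.
have E A : measurable A -> pushforward leb ((fun x => c - x)%R : measurableTypeR R -> measurableTypeR R) A = leb A.
  move=> mA; rewrite -[RHS](lebesgue_measure_shift c)//.
  have mA' : measurable ((fun x => x + c)%R @^-1` A).
    by rewrite -[X in measurable X]setTI; exact: measurable_shift.
  rewrite /pushforward -[RHS](lebesgue_measureN mA') /pushforward.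
  by congr (leb _); apply/seteqP; split=> x /=; rewrite addrC.
transitivity (\int[pushforward leb ((fun x => c - x)%R : measurableTypeR R -> measurableTypeR R)]_(x in `[(c - b)%R, (c - a)%R]) f x).
  rewrite ge0_integral_pushforward//.
  - by congr integral; apply/seteqP; split => x /=; rewrite !in_itv/= => /andP[? ?]; apply/andP; split; lra.
  - exact: measurable_funTS.
by apply: eq_measure_integral => A mA _; exact: E.
Qed.

End translation.

Section Rtranslation.
Context (R : realType).
Local Notation leb := (@lebesgue_measure R).
Implicit Types (f : R -> R) (a b c : R).

Let Rintegral_posneg (D : set R) f : \int[leb]_(x in D) f x =
  fine (\int[leb]_(x in D) ((EFin \o f)^\+ x) - \int[leb]_(x in D) ((EFin \o f)^\- x))%E.
Proof. by rewrite /Rintegral integralE. Qed.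

Lemma Rintegral_shift a b c f : measurable_fun [set: R] f ->
  \int[leb]_(x in `[a, b]) f (x + c) = \int[leb]_(x in `[(a + c), (b + c)]) f x.
Proof.
move=> /measurable_EFinP mf; rewrite !Rintegral_posneg.
congr (fine (_ - _))%E.
- by rewrite -(ge0_integral_shift a b c (measurable_funepos mf))//; apply: eq_integral => x _; rewrite ?funeposE ?funenegE.
- by rewrite -(ge0_integral_shift a b c (measurable_funeneg mf))//; apply: eq_integral => x _; rewrite ?funeposE ?funenegE.
Qed.

Lemma Rintegral_reflect a b c f : measurable_fun [set: R] f ->
  \int[leb]_(x in `[a, b]) f (c - x) = \int[leb]_(x in `[(c - b), (c - a)]) f x.
Proof.
move=> /measurable_EFinP mf; rewrite !Rintegral_posneg.
congr (fine (_ - _))%E.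
- by rewrite -(ge0_integral_reflect a b c (measurable_funepos mf))//; apply: eq_integral => x _; rewrite ?funeposE ?funenegE.
- by rewrite -(ge0_integral_reflect a b c (measurable_funeneg mf))//; apply: eq_integral => x _; rewrite ?funeposE ?funenegE.
Qed.

End Rtranslation.

Lemma lebesgue_measure_segment (R : realType) (a c : R) : a <= c ->
  (@lebesgue_measure R) `[a, c] = (c - a)%:E.
Proof.
rewrite lebesgue_measure_itv/= lte_fin le_eqVlt => /predU1P[->|->//].
by rewrite ltxx subrr.
Qed.

Lemma integral_cst_probability d (T : measurableType d) (R : realType)
  (mu : probability T R) (c : \bar R) : (\int[mu]_x c = c)%E.
Proof.
rewrite integral_cst// [X in (_ * X)%E](_ : _ = 1%E) ?mule1//.
exact: probability_setT.
Qed.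

(** * Square integrable functions and their inner product *)

Section square_integrable.
Context d (T : measurableType d) (R : realType) (mu : probability T R).
Implicit Types (f g h a : T -> R).

Lemma Lfun2_measurable f : f \in Lfun mu 2%:E -> measurable_fun [set: T] f.
Proof. by move=> fL; exact: (set_mem (sub_Lfun_mfun fL)). Qed.

Lemma Lnorm2_sqr f : ('N[mu]_2%:E[EFin \o f] `^ 2 = \int[mu]_x (f x ^+ 2)%:E)%E.
Proof.
rewrite poweR_Lnorm//; apply: eq_integral => x _ /=.
by rewrite powR_mulrn// real_normK ?num_real.
Qed.

Lemma Lfun2P f : measurable_fun [set: T] f ->
  (\int[mu]_x (f x ^+ 2)%:E < +oo)%E -> f \in Lfun mu 2%:E.
Proof.
move=> mf foo; apply/andP; split; apply/mem_set => /=; first exact: mf.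
by apply: (@lty_poweRy _ _ 2); rewrite ?Lnorm2_sqr.
Qed.

Lemma Lfun2_mul_integrable f g : f \in Lfun mu 2%:E -> g \in Lfun mu 2%:E ->
  mu.-integrable [set: T] (fun x => (f x * g x)%:E).
Proof. by move=> fL gL; apply/(Lfun1_integrable mu (f \* g)); exact: Lfun2_mul_Lfun1. Qed.

Lemma Lfun2_integrable f : f \in Lfun mu 2%:E -> mu.-integrable [set: T] (EFin \o f).
Proof.
move=> fL; have := Lfun2_mul_integrable fL (Lfun_cst mu 1 2).
by under eq_fun do rewrite /= mulr1.
Qed.

Lemma bounded_Lfun2 a (C : R) : measurable_fun [set: T] a -> (forall x, `|a x| <= C) ->
  a \in Lfun mu 2%:E.
Proof.
move=> ma aC; apply: Lfun2P => //.
apply: (@le_lt_trans _ _ (\int[mu]_x (C ^+ 2)%:E)%E).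
  apply: ge0_le_integral => //.
  - by move=> x _; rewrite lee_fin sqr_ge0.
  - by apply/measurable_EFinP; exact: measurable_funX.
  - by move=> x _; rewrite lee_fin -[leLHS]real_normK ?num_real// ler_sqr ?nnegrE// (le_trans _ (aC x)).
by rewrite integral_cst_probability ltry.
Qed.

Lemma mul_bounded_Lfun2 a f (C : R) : measurable_fun [set: T] a -> (forall x, `|a x| <= C) ->
  f \in Lfun mu 2%:E -> (fun x => a x * f x) \in Lfun mu 2%:E.
Proof.
move=> ma aC fL; have mf := Lfun2_measurable fL.
apply: Lfun2P; first exact: measurable_funM.
apply: (@le_lt_trans _ _ (\int[mu]_x ((C ^+ 2)%:E * (f x ^+ 2)%:E))%E).
  apply: ge0_le_integral => //.
  - by move=> x _; rewrite lee_fin sqr_ge0.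
  - by apply/measurable_EFinP/measurable_funX/measurable_funM.
  - by apply: measurable_funeM; apply/measurable_EFinP/measurable_funX.
  - move=> x _; rewrite -EFinM lee_fin exprMn ler_wpM2r ?sqr_ge0//.
    by rewrite -[leLHS]real_normK ?num_real// ler_sqr ?nnegrE// (le_trans _ (aC x)).
rewrite ge0_integralZl//; last 3 first.
- by apply/measurable_EFinP/measurable_funX.
- by move=> x _; rewrite lee_fin sqr_ge0.
- by rewrite lee_fin sqr_ge0.
have := Lfun2_integrable_sqr fL => /integrableP[_].
move=> foo; apply: lte_mul_pinfty; rewrite ?lee_fin ?sqr_ge0//; move: foo.
by under eq_integral do rewrite gee0_abs ?lee_fin ?sqr_ge0//.
Qed.

Lemma inner_sqrE f : f \in Lfun mu 2%:E -> (\int[mu]_x (f x ^+ 2)%:E)%E = (inner mu f f)%:E.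
Proof.
move=> fL; rewrite /inner /Rintegral fineK.
  by apply: eq_integral => x _; rewrite expr2.
by apply: integrable_fin_num => //; exact: Lfun2_mul_integrable.
Qed.

Lemma inner_ge0 f : 0 <= inner mu f f.
Proof. by apply: Rintegral_ge0 => x _; rewrite -expr2 sqr_ge0. Qed.

Lemma Lnorm2E f : f \in Lfun mu 2%:E ->
  'N[mu]_2%:E[EFin \o f]%E = (Num.sqrt (inner mu f f))%:E.
Proof.
move=> fL.
have -> : 'N[mu]_2%:E[EFin \o f]%E = (('N[mu]_2%:E[EFin \o f] `^ 2) `^ 2^-1)%E.
  by rewrite -poweRrM mulfV// poweRe1// Lnorm_ge0.
by rewrite Lnorm2_sqr inner_sqrE// poweR_EFin powR12_sqrt// inner_ge0.
Qed.

Lemma inner_ae f g h : measurable_fun [set: T] f -> measurable_fun [set: T] g ->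
  measurable_fun [set: T] h -> {ae mu, forall x, f x = g x} ->
  inner mu f h = inner mu g h.
Proof.
move=> mf mg mh fg; congr fine; apply: ae_eq_integral => //.
- by apply/measurable_EFinP/measurable_funM.
- by apply/measurable_EFinP/measurable_funM.
- by apply: filterS fg => x /= + _ => ->.
Qed.

Lemma inner_sym f h : inner mu f h = inner mu h f.
Proof. by apply: eq_Rintegral => x _; rewrite mulrC. Qed.

Lemma inner_linl f g h : f \in Lfun mu 2%:E -> g \in Lfun mu 2%:E ->
  h \in Lfun mu 2%:E -> forall c : R,
  inner mu (fun x => c * f x + g x) h = c * inner mu f h + inner mu g h.
Proof.
move=> fL gL hL c.
have fh := Lfun2_mul_integrable fL hL.
rewrite /inner -RintegralZl// -RintegralD//.
- by apply: eq_Rintegral => x _; ring.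
- have := integrableZl measurableT c fh.
  by under eq_fun do rewrite -EFinM.
- exact: Lfun2_mul_integrable.
Qed.

End square_integrable.

(** Elements are functions, not classes modulo null sets, so [inner] is only positive semidefinite
    on this space; hence the generality of [psd_form]. *)
Notation L2 mu := (LfunType mu (lee1n 2)).

Section L2_space.
Context d (T : measurableType d) (R : realType) (mu : probability T R).
Implicit Types (f g h : L2 mu).

Lemma L2_mem f : (f : T -> R) \in Lfun mu 2%:E.
Proof. exact: LfunP. Qed.

Definition toL2 (f : T -> R) (fL : f \in Lfun mu 2%:E) : L2 mu := Lfun_Sub (lee1n 2) fL.

Lemma psd_inner : psd_form (fun f g => inner mu f g).
Proof.
split.
- move=> c f g h; rewrite -inner_linl ?L2_mem//.
- by move=> f h; exact: inner_sym.
- by move=> f; exact: inner_ge0.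
Qed.

Definition one_L2 : L2 mu := toL2 (Lfun_cst mu 1 2).

Lemma variance_L2 f : ('V_mu[f] = (inner mu f f - inner mu f one_L2 ^+ 2)%:E)%E.
Proof.
rewrite varianceE ?L2_mem// EFinB; congr (_ - _)%E.
  by rewrite unlock -inner_sqrE ?L2_mem.
rewrite unlock EFin_expe; congr (_ ^+ 2)%E.
rewrite /inner /Rintegral fineK; first by apply: eq_integral => x _; rewrite mulr1.
by apply: integrable_fin_num => //; apply: Lfun2_mul_integrable; exact: L2_mem.
Qed.

End L2_space.

(** * The Markov property *)

(** An open U is the union of the open sets U_k of points well inside U, at scale 1/(k+1); the limit
    lies in U if and only if, for some k, the sequence is eventually in U_k. *)
Lemma measurable_fun_cvg_borel (R : realType) (X : completePseudoMetricType R)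
    d (T : measurableType d) (f_ : nat -> T -> borel X) (f : T -> borel X) :
  (forall n, measurable_fun [set: T] (f_ n)) ->
  (forall x, (f_ n x : X) @[n --> \oo] --> (f x : X)) ->
  measurable_fun [set: T] f.
Proof.
move=> mf_ cf; apply: (@measurability _ _ T (borel X) setT f (@open X)) => // _ [U oU <-].
pose Uk k : set X := interior [set y : X | ball y (k.+1%:R^-1 : R) `<=` U].
have -> : [set: T] `&` f @^-1` U =
    \bigcup_k \bigcup_N \bigcap_(n in [set n | (N <= n)%N]) (f_ n @^-1` Uk k).
  rewrite setTI; apply/seteqP; split=> [x Ufx|x [k _ [N _ H]]].
  - have /nbhs_ballP[e /= e0 eU] : nbhs (f x : X) U by exact: open_nbhs_nbhs.
    pose k := Num.truncn (2 / e).
    have ke : k.+1%:R^-1 <= e / 2.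
      rewrite -[leRHS]invrK ler_pV2 ?inE ?unitfE ?gt_eqF ?divr_gt0 ?invr_gt0 ?ltr0n ?invr_gt0 ?divr_gt0//=.
      by rewrite invf_div ltW// truncnS_gt.
    have Unbhs : nbhs (f x : X) (Uk k).
      apply: nbhs_interior; apply/nbhs_ballP; exists (e / 2) => /=; first by rewrite divr_gt0.
      move=> y xy z yz; apply: eU; apply: (ball_split xy).
      exact: (le_ball ke).
    have [N _ NH] := cf x _ Unbhs.
    by exists k => //; exists N.
  - have [M _ MH] := cf x _ (nbhsx_ballx (f x : X) (k.+1%:R^-1 : R) ltac:(by [])).
    have := H (maxn N M) (leq_maxl _ _) => /= /interior_subset; apply.
    by apply: ball_sym; apply: MH; rewrite /= leq_maxr.
apply: bigcup_measurable => k _; apply: bigcup_measurable => N _.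
apply: bigcap_measurable => [|n _]; first by exists N => /=.
rewrite -[X in measurable X]setTI; apply: mf_ => //.
by apply: sub_sigma_algebra; exact: open_interior.
Qed.

(** By right-continuity the process is the pointwise limit of processes that read Z at the next
    point of a grid of mesh 1/(n+1), and these are jointly measurable since the grid is countable.
    Negative times are sent to 0. *)
Lemma measurable_cadlag (R : realType) (X : completePseudoMetricType R)
    d (Omega : measurableType d) (Z : R -> Omega -> X) :
  (forall t, 0 <= t -> measurable_fun [set: Omega] (Z t : Omega -> borel X)) ->
  (forall w, cadlag (Z ^~ w)) ->
  measurable_fun [set: measurableTypeR R * Omega]
    (fun p => Z (Num.max p.1 0) p.2 : borel X).
Proof.
move=> mZ cZ.
pose h n (p : measurableTypeR R * Omega) : R := n.+1%:R * Num.max (p.1 : R) 0.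
(* The successor makes the grid point strictly larger than the time, as the limit along t^'+
   demands. *)
pose f_ n (p : measurableTypeR R * Omega) : borel X := Z ((Num.truncn (h n p)).+1%:R / n.+1%:R) p.2.
have h0 n p : 0 <= h n p by rewrite mulr_ge0// le_max lexx orbT.
have mh n : measurable_fun [set: measurableTypeR R * Omega] (h n).
  by apply: measurable_funM => //; apply: measurable_maxr => //; exact: measurable_fst.
apply: (@measurable_fun_cvg_borel _ _ _ _ f_).
- move=> n _ B mB; rewrite setTI.
  have -> : f_ n @^-1` B = \bigcup_m ((h n @^-1` `[m%:R, m.+1%:R[) `&`
      (snd @^-1` (Z (m.+1%:R / n.+1%:R) @^-1` B))).
    apply/seteqP; split => [p Bp|p [m _ [/= hm Bm]]].
    + exists (Num.truncn (h n p)) => //; split => //=.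
      by rewrite in_itv/=; exact: truncn_itv.
    + rewrite /= /f_; suff -> : Num.truncn (h n p) = m by [].
      by apply/eqP; rewrite truncn_eq// -in_itv.
  apply: bigcup_measurable => m _; apply: measurableI.
    by rewrite -[X in measurable X]setTI; apply: mh => //; exact: measurable_itv.
  rewrite -[X in measurable X]setTI; apply: measurable_snd => //.
  rewrite -[X in measurable X]setTI; apply: mZ => //.
- move=> [s w]; have [rc _] := cZ w.
  have s0 : 0 <= Num.max s 0 by rewrite le_max lexx orbT.
  rewrite /= /f_ /h /=; move: (Num.max s 0) s0 => r r0.
  apply: (cvg_comp _ _ _ (rc r r0)).
  move=> U /= [e /= e0 eU].
  have [N N1] : exists N : nat, e^-1 < N.+1%:R.
    by exists (Num.truncn e^-1); exact: truncnS_gt.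
  exists N => // n /= Nn.
  have n0 : (0 : R) < n.+1%:R by [].
  have /andP[t1 t2] := truncn_itv (mulr_ge0 (ltW n0) r0).
  apply: eU; last by rewrite /= ltr_pdivlMr// mulrC.
  rewrite /= ltr_distlC; apply/andP; split.
    by rewrite ltrBlDr (@lt_le_trans _ _ (r + e))// ?ltrDl// lerD2r ler_pdivlMr// mulrC ltW.
  rewrite ltr_pdivrMr// -natr1 mulrDl.
  have : 1 < e * n.+1%:R.
    by rewrite mulrC -ltr_pdivrMr// div1r (lt_le_trans N1)// ler_nat.
  by move: t1; rewrite mulrC; lra.
Qed.

Lemma integral_like_integral1 d (T : measurableType d) (R : realType)
    d' (S : measurableType d') (m : {measure set S -> \bar R})
    (D : set S) (K : S -> (T -> \bar R) -> \bar R) :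
  measurable D -> (forall w, integral_like (K w)) ->
  (forall f, nonneg_measurable f -> measurable_fun [set: S] (K ^~ f)) ->
  integral_like (fun f => \int[m]_(w in D) K w f)%E.
Proof.
move=> mD Kil mK.
have := @integral_like_integral d T R d' S m D (cst 1) K mD (measurable_cst _) (fun=> ler01) Kil mK.
congr (integral_like _); apply/funext => f; apply: eq_integral => w _.
by rewrite mul1e.
Qed.

(** Expand the integral of (f - l)^2 >= 0, where l is the mean of f. When f^2 is not integrable the
    right-hand side is infinite, whatever default value the left-hand side takes. *)
Lemma sqr_Rintegral_le d (T : measurableType d) (R : realType)
    (m : {measure set T -> \bar R}) (D : set T) (c : R) (f : T -> R) :
  measurable D -> m D = c%:E -> measurable_fun D f ->
  (((\int[m]_(x in D) f x) ^+ 2)%:E <= c%:E * \int[m]_(x in D) (f x ^+ 2)%:E)%E.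
Proof.
move=> mD mDc mf.
have c0 : 0 <= c by rewrite -lee_fin -mDc.
have mf2 : measurable_fun D (fun x => (f x ^+ 2)%:E).
  by apply/measurable_EFinP/measurable_funX.
have i0 : (0 <= \int[m]_(x in D) (f x ^+ 2)%:E)%E.
  by apply: integral_ge0 => x _; rewrite lee_fin sqr_ge0.
move: c0; rewrite le_eqVlt => /predU1P[c0|c0].
  rewrite /Rintegral null_set_integral//=; last by rewrite mDc -c0.
    by rewrite expr0n/= mule_ge0// -c0.
  by apply/measurable_EFinP.
have [foo|] := eqVneq (\int[m]_(x in D) (f x ^+ 2)%:E)%E +oo%E.
  by rewrite foo gt0_muley ?lte_fin// leey.
rewrite -ltey => foo.
have if2 : m.-integrable D (fun x => (f x ^+ 2)%:E).
  apply/integrableP; split => //; rewrite (le_lt_trans _ foo)//.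
  by rewrite le_eqVlt; apply/orP; left; apply/eqP; apply: eq_integral => x _; rewrite gee0_abs// lee_fin sqr_ge0.
have ic (k : R) : m.-integrable D (EFin \o cst k).
  apply/integrableP; split; first exact/measurable_EFinP.
  by rewrite /= integral_cst// mDc ltry.
have if1 : m.-integrable D (EFin \o f).
  apply: (@le_integrable _ _ _ _ D mD _ (fun x => (1 + f x ^+ 2)%:E)).
  - exact/measurable_EFinP.
  - move=> x _ /=; rewrite lee_fin [leRHS]ger0_norm ?addr_ge0 ?sqr_ge0//.
    by have := sqr_ge0 (`|f x| - 1); rewrite sqrrB1 real_normK ?num_real//; have := normr_ge0 (f x); lra.
  - have := integrableD mD (ic 1) if2; apply: eq_integrable => // x _.
set F := \int[m]_(x in D) f x.
have -> : (\int[m]_(x in D) (f x ^+ 2)%:E = (\int[m]_(x in D) f x ^+ 2)%:E)%E.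
  by rewrite /Rintegral fineK//; exact: integrable_fin_num.
rewrite -EFinM lee_fin; set S2 := Rintegral _ _ _.
pose l := F / c.
have : 0 <= \int[m]_(x in D) ((f x ^+ 2 + (- (2 * l)) * f x) + l ^+ 2).
  apply: Rintegral_ge0 => x _.
  by have := sqr_ge0 (f x - l); rewrite sqrrB; lra.
have if3 : m.-integrable D (EFin \o (fun x => (- (2 * l)) * f x)).
  have := integrableZl mD (- (2 * l)) if1.
  by apply: eq_integrable.
have if4 : m.-integrable D (EFin \o (fun x => f x ^+ 2 + (- (2 * l)) * f x)).
  by apply: (eq_integrable mD _ _ _ (integrableD mD if2 if3)) => x _.
rewrite (RintegralD mD if4 (ic (l ^+ 2))).
rewrite RintegralD// RintegralZl// Rintegral_cst// mDc/= -/F -/S2 /l.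
rewrite (_ : S2 + - (2 * (F / c)) * F + (F / c) ^+ 2 * c = S2 - F ^+ 2 / c); last by field; rewrite gt_eqF.
by rewrite subr_ge0 ler_pdivrMr// mulrC.
Qed.

Section markov_process.
Context (R : realType) (X : completePseudoMetricType R).
Context d (Omega : measurableType d).
Variables (P : R.-pker (borel X) ~> Omega) (Z : R -> Omega -> X).
Hypothesis markovZ : cadlag_markov_process P Z.
Implicit Types (f h : borel X -> R) (x : borel X).

Lemma measurable_process t : 0 <= t -> measurable_fun [set: Omega] (Z t : Omega -> borel X).
Proof. by have [+ _ _ _] := markovZ; apply. Qed.

Lemma measurable_process_comp t f : 0 <= t -> measurable_fun [set: borel X] f ->
  measurable_fun [set: Omega] (fun w => f (Z t w)).
Proof. by move=> t0 mf; apply: (measurableT_comp mf); exact: measurable_process. Qed.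

Lemma emeasurable_process_comp t (f : borel X -> \bar R) : 0 <= t -> measurable_fun [set: borel X] f ->
  measurable_fun [set: Omega] (fun w => f (Z t w)).
Proof. by move=> t0 mf; apply: (measurableT_comp mf); exact: measurable_process. Qed.

Lemma measurable_expectation (F : Omega -> \bar R) : nonneg_measurable F ->
  measurable_fun [set: borel X] (fun x => \int[P x]_w F w)%E.
Proof.
move=> [mF F0]; apply: measurable_fun_integral_kernel => //.
by move=> U mU; exact: measurable_kernel.
Qed.

Lemma past_measurable s : 0 <= s -> past Z s `<=` measurable.
Proof.
move=> s0; apply: smallest_sub; first exact: sigma_algebra_measurable.
move=> _ [u /= /andP[u0 us] [B mB <-]].
by apply: measurable_process.
Qed.

Lemma integral_like_process (m : {measure set Omega -> \bar R}) t (D : set Omega) : 0 <= t -> measurable D ->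
  integral_like (fun f : borel X -> \bar R => \int[m]_(w in D) f (Z t w))%E.
Proof.
move=> t0 mD; apply: (@integral_like_integral1 _ (borel X) R _ Omega m D (fun w (f : borel X -> \bar R) => f (Z t w)) mD).
- by move=> w; exact: integral_like_eval.
- by move=> f [mf _]; exact: emeasurable_process_comp.
Qed.

Let indic_process t (B : set (borel X)) w : (\1_B (Z t w) : R) = \1_(Z t @^-1` B) w.
Proof. by rewrite !indicE; congr (_%:R); apply/idP/idP; rewrite !inE. Qed.

Let measurable_preimage t (B : set (borel X)) : 0 <= t -> measurable B ->
  measurable (Z t @^-1` B).
Proof. by move=> t0 mB; rewrite -[X in measurable X]setTI; exact: measurable_process. Qed.

Lemma markov_set x s t (A : set Omega) (f : borel X -> \bar R) : 0 <= s -> 0 <= t ->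
  past Z s A -> nonneg_measurable f ->
  (\int[P x]_(w in A) f (Z (s + t) w) =
   \int[P x]_(w in A) \int[P (Z s w)]_w' f (Z t w'))%E.
Proof.
move=> s0 t0 pA; have mA := past_measurable s0 pA.
have st0 : 0 <= s + t by rewrite addr_ge0.
move=> nf.
apply: (@integral_like_ext _ (borel X) R
  (fun f : borel X -> \bar R => \int[P x]_(w in A) f (Z (s + t) w))%E
  (fun f : borel X -> \bar R => \int[P x]_(w in A) \int[P (Z s w)]_w' f (Z t w'))%E) => //.
- exact: integral_like_process.
- apply: (@integral_like_integral1 _ (borel X) R _ Omega (P x) A (fun w (f : borel X -> \bar R) => \int[P (Z s w)]_w' f (Z t w'))%E mA).
    by move=> w; exact: integral_like_process.
  move=> h' [mh h0].
  apply: (@measurableT_comp _ _ _ _ _ _ (fun x => \int[P x]_w h' (Z t w))%E).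
    apply: measurable_expectation; split => //.
    exact: emeasurable_process_comp.
  exact: measurable_process.
move=> B mB; have [_ _ _ /(_ x s t A B s0 t0 pA mB) E] := markovZ.
transitivity (P x (A `&` Z (s + t) @^-1` B)).
  under eq_integral do rewrite /= indic_process.
  rewrite integral_indic//; first by rewrite setIC.
  exact: measurable_preimage.
rewrite E; apply: eq_integral => w _.
under eq_integral do rewrite /= indic_process.
rewrite integral_indic ?setIT//; exact: measurable_preimage.
Qed.

End markov_process.

Section markov_functions.
Context (R : realType) (X : completePseudoMetricType R).
Context d (Omega : measurableType d).
Variables (P : R.-pker (borel X) ~> Omega) (Z : R -> Omega -> X).
Hypothesis markovZ : cadlag_markov_process P Z.
Implicit Types (f h : borel X -> R) (x : borel X) (C : R).
Local Notation semigroup := (semigroup P Z).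

(** A class stable under P_t on which the expectation defining [semigroup] is finite everywhere, so
    that it agrees with the extended integral at every point. *)
Definition bounded_nonneg f := measurable_fun [set: borel X] f /\
  exists C, forall x, 0 <= f x <= C.

Let Px1 x : P x [set: Omega] = 1%E.
Proof. exact: prob_kernel. Qed.

Lemma semigroup_EFin t f x : 0 <= t -> bounded_nonneg f ->
  ((semigroup t f x)%:E = \int[P x]_w (f (Z t w))%:E)%E.
Proof.
move=> t0 [mf [C fC]]; rewrite /Defs.semigroup /Rintegral fineK// ge0_fin_numE.
  apply: (@le_lt_trans _ _ (\int[P x]_w C%:E)%E).
    apply: ge0_le_integral => //.
    - by move=> w _; rewrite lee_fin; have /andP[] := fC (Z t w).
    - exact/measurable_EFinP/(measurable_process_comp markovZ).
    - by move=> w _; rewrite lee_fin; have /andP[] := fC (Z t w).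
  by rewrite integral_cst// Px1 mule1 ltry.
by apply: integral_ge0 => w _; rewrite lee_fin; have /andP[] := fC (Z t w).
Qed.

Lemma semigroup_bounded_nonneg t f : 0 <= t -> bounded_nonneg f ->
  bounded_nonneg (semigroup t f).
Proof.
move=> t0 bf; have [mf [C fC]] := bf; split.
  apply/measurable_EFinP.
  rewrite [X in measurable_fun _ X](_ : _ = fun x => \int[P x]_w (f (Z t w))%:E)%E; last first.
    by apply/funext => x /=; exact: semigroup_EFin.
  apply: measurable_expectation; split.
    exact/measurable_EFinP/(measurable_process_comp markovZ).
  by move=> w; rewrite lee_fin; have /andP[] := fC (Z t w).
exists C => x; rewrite -!lee_fin semigroup_EFin//; apply/andP; split.
  by apply: integral_ge0 => w _; rewrite lee_fin; have /andP[] := fC (Z t w).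
apply: (@le_trans _ _ (\int[P x]_w C%:E)%E).
  apply: ge0_le_integral => //.
  - by move=> w _; rewrite lee_fin; have /andP[] := fC (Z t w).
  - exact/measurable_EFinP/(measurable_process_comp markovZ).
  - by move=> w _; rewrite lee_fin; have /andP[] := fC (Z t w).
by rewrite integral_cst// Px1 mule1.
Qed.

(** Omega with the sigma-field [past Z s], so that measurability with respect to the past is an
    instance of [measurable_fun]. *)
Definition past_type s : Type := g_sigma_algebraType
  (\bigcup_(u in [set u | 0 <= u <= s])
     preimage_set_system setT (Z u : Omega -> borel X) measurable).

HB.instance Definition _ s := Measurable.on (past_type s).

Lemma measurable_past d' (U : measurableType d') s (F : past_type s -> U) : 0 <= s ->
  measurable_fun [set: past_type s] F -> measurable_fun [set: Omega] (F : Omega -> U).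
Proof.
move=> s0 mF _ B mB; rewrite setTI; apply: (past_measurable markovZ s0).
by have := mF measurableT B mB; rewrite setTI.
Qed.

Lemma measurable_past_process s u f : 0 <= u <= s -> measurable_fun [set: borel X] f ->
  measurable_fun [set: past_type s] (fun w => f (Z u w)).
Proof.
move=> us mf; apply: (measurableT_comp mf) => _ B mB; rewrite setTI.
apply: sub_sigma_algebra; exists u => //.
by exists B => //; rewrite setTI.
Qed.

(** For fixed f both sides are integral-like functionals of Y on the sigma-field of the past, and
    [markov_set] identifies them on indicators. *)
Lemma markov_fun x s t (Y : past_type s -> R) f : 0 <= s -> 0 <= t ->
  measurable_fun [set: past_type s] Y -> (forall w, 0 <= Y w) -> bounded_nonneg f ->
  (\int[P x]_w (Y w * f (Z (s + t) w))%:E =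
   \int[P x]_w (Y w * semigroup t f (Z s w))%:E)%E.
Proof.
move=> s0 t0 mY Y0 bf; have [mf [C fC]] := bf.
have [mPf [C' PfC]] := semigroup_bounded_nonneg t0 bf.
have st0 : 0 <= s + t by rewrite addr_ge0.
have il (u : R) (k : borel X -> R) : 0 <= u -> measurable_fun [set: borel X] k -> (forall x, 0 <= k x) ->
    integral_like (fun F : past_type s -> \bar R => \int[P x]_w ((k (Z u w))%:E * F w))%E.
  move=> u0 mk k0.
  apply: (@integral_like_integral _ (past_type s) R _ Omega (P x) setT
    (fun w => k (Z u w)) (fun w (F : past_type s -> \bar R) => F w)) => //.
  - exact: (measurable_process_comp markovZ).
  - by move=> w; exact: integral_like_eval.
  - by move=> F [mF _]; exact: (measurable_past s0).
pose I (k : borel X -> R) u (F : past_type s -> \bar R) := (\int[P x]_w ((k (Z u w))%:E * F w))%E.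
suff : I f (s + t) (EFin \o Y) = I (semigroup t f) s (EFin \o Y).
  rewrite /I; under eq_integral do rewrite -EFinM mulrC.
  by move=> ->; under eq_integral do rewrite -EFinM mulrC.
apply: (@integral_like_ext _ (past_type s) R (I f (s + t)) (I (semigroup t f) s)).
- by apply: il => // z; have /andP[] := fC z.
- by apply: il => // z; have /andP[] := PfC z.
- move=> A mA; have pA : past Z s A by [].
  transitivity (\int[P x]_(w in A) (f (Z (s + t) w))%:E)%E.
    by rewrite integral_mkcond epatch_indic.
  rewrite (markov_set markovZ x s0 t0 pA (f := EFin \o f)); last first.
    by split; [exact/measurable_EFinP|move=> z; rewrite lee_fin; have /andP[] := fC z].
  under eq_integral do rewrite -semigroup_EFin//.
  by rewrite integral_mkcond epatch_indic.
- by split; [exact/measurable_EFinP|move=> z; rewrite lee_fin].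
Qed.

(** Conditioning on the past of the last but one time replaces h by f * P_delta h; the induction
    therefore runs with h arbitrary. *)
Lemma markov_prod x theta delta f h n : 0 <= theta -> 0 <= delta ->
  bounded_nonneg f -> bounded_nonneg h ->
  (\int[P x]_w ((\prod_(k < n) f (Z (theta + k%:R * delta) w)) * h (Z (theta + n%:R * delta) w))%:E =
   \int[P x]_w (iter n (fun k y => f y * semigroup delta k y) h (Z theta w))%:E)%E.
Proof.
move=> th0 d0 bf; elim: n h => [|n IH] h bh.
  by apply: eq_integral => w _; rewrite big_ord0 mul1r mul0r addr0.
have [mf [C fC]] := bf.
have nd k : 0 <= theta + k%:R * delta by rewrite addr_ge0// mulr_ge0.
have [mPh [C' PhC]] := semigroup_bounded_nonneg d0 bh.
rewrite iterSr -IH; last first.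
  split; first exact: measurable_funM.
  exists (C * C') => y; have /andP[f0 f1] := fC y; have /andP[h0 h1] := PhC y.
  by rewrite mulr_ge0//= ler_pM.
transitivity (\int[P x]_w ((\prod_(k < n.+1) f (Z (theta + k%:R * delta) w)) *
    semigroup delta h (Z (theta + n%:R * delta) w))%:E)%E; last first.
  by apply: eq_integral => w _; rewrite big_ord_recr/= mulrA.
have -> : theta + n.+1%:R * delta = theta + n%:R * delta + delta by rewrite -natr1; ring.
apply: (@markov_fun x (theta + n%:R * delta) delta
  (fun w => \prod_(k < n.+1) f (Z (theta + k%:R * delta) w)) h (nd n) d0) => //.
- apply: measurable_prod => k _; apply: measurable_past_process => //.
  by rewrite nd/= lerD2l ler_wpM2r// ler_nat -ltnS.
- by move=> w; apply: prodr_ge0 => k _; have /andP[] := fC (Z (theta + k%:R * delta) w).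
Qed.

End markov_functions.

(** * The semigroup on L^2 *)

Section symmetric_semigroups.
Context (R : realType) (X : completePseudoMetricType R).
Context d (Omega : measurableType d).
Variables (P : R.-pker (borel X) ~> Omega) (Z : R -> Omega -> X).
Variable mu : probability (borel X) R.
Hypothesis hausdorffX : hausdorff_space X.
Hypothesis markovZ : cadlag_markov_process P Z.
Hypothesis symP : symmetric_semigroup P Z mu.
Implicit Types (f h : borel X -> R) (x : borel X) (C : R).
Local Notation semigroup := (semigroup P Z).

Let Px1 x : P x [set: Omega] = 1%E.
Proof. exact: prob_kernel. Qed.

Lemma Lfun2_semigroup t f : 0 <= t -> f \in Lfun mu 2%:E -> semigroup t f \in Lfun mu 2%:E.
Proof. by move=> t0; have [+ _] := symP t0; apply. Qed.

Lemma inner_semigroup_sym t f h : 0 <= t -> f \in Lfun mu 2%:E -> h \in Lfun mu 2%:E ->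
  inner mu (semigroup t f) h = inner mu f (semigroup t h).
Proof. by move=> t0; have [_] := symP t0; apply. Qed.

Lemma semigroup_cst t c : semigroup t (cst c) = cst c.
Proof. by apply/funext => x; rewrite /Defs.semigroup Rintegral_cst// Px1/= mulr1. Qed.

(** Points are closed in a Hausdorff space, so {Z_0 = x} is an event, of full probability under
    P_x. *)
Lemma semigroup0 f : measurable_fun [set: borel X] f -> semigroup 0 f = f.
Proof.
move=> mf; apply/funext => x.
rewrite -[RHS]/(cst (f x) x) -(semigroup_cst 0 (f x)) /Defs.semigroup; congr fine.
have mx : measurable [set w | Z 0 w = x].
  suff : measurable (Z 0 @^-1` ([set x] : set (borel X))) by [].
  rewrite -[X in measurable X]setTI; apply: (measurable_process markovZ) => //.
  rewrite -[[set x]]setCK; apply: measurableC; apply: sub_sigma_algebra.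
  exact/closed_openC/accessible_closed_set1/hausdorff_accessible.
apply: ae_eq_integral => //.
- exact/measurable_EFinP/(measurable_process_comp markovZ).
- by apply/measurable_EFinP; exact: measurable_cst.
- have : (P x).-negligible (~` [set w | Z 0 w = x]).
    exists (~` [set w | Z 0 w = x]); split => //; first exact: measurableC.
    have PT : (P x [set: Omega] = 1)%E by exact: Px1.
    have P1 : (P x [set w | Z 0 w = x] = 1)%E by have [_ _ -> _] := markovZ.
    rewrite -setTD measureD//; last by rewrite [ltLHS]PT ltry.
    by rewrite setTI [X in (X - _)%E]PT [X in (_ - X)%E]P1 subee.
  apply: negligibleS => w /= H wx; apply: H => _; rewrite wx//.
Qed.

(** Invariance of mu, from symmetry tested against the constant 1: <P_t 1_B, 1> = <1_B, P_t 1> =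
    mu(B). *)
Lemma integral_semigroup t (f : borel X -> \bar R) : 0 <= t -> nonneg_measurable f ->
  (\int[mu]_x \int[P x]_w f (Z t w) = \int[mu]_x f x)%E.
Proof.
move=> t0; pose I (F : borel X -> \bar R) := (\int[mu]_x \int[P x]_w F (Z t w))%E.
apply: (@integral_like_ext _ (borel X) R I (fun F => \int[mu]_x F x)%E).
- apply: (@integral_like_integral1 _ (borel X) R _ (borel X) mu setT
    (fun x (F : borel X -> \bar R) => \int[P x]_w F (Z t w))%E measurableT).
    by move=> x; exact: (integral_like_process markovZ).
  move=> F [mF F0]; apply: measurable_expectation; split => //.
  exact: (emeasurable_process_comp markovZ).
- apply: (@integral_like_integral1 _ (borel X) R _ (borel X) mu setT
    (fun x (F : borel X -> \bar R) => F x) measurableT).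
    by move=> x; exact: integral_like_eval.
  by move=> F [].
- move=> B mB.
  have bB : bounded_nonneg (\1_B : borel X -> R).
    split; first exact: measurable_indic.
    by exists 1 => x; rewrite indicE; case: (x \in B); rewrite /= ?ler01 ?lexx.
  have BL : (\1_B : borel X -> R) \in Lfun mu 2%:E.
    by apply: (@bounded_Lfun2 _ _ _ mu _ 1) => [|x]; [exact: measurable_indic|
      rewrite indicE; case: (x \in B); rewrite ?normr1 ?normr0].
  rewrite /I; under eq_integral do rewrite /= -(semigroup_EFin markovZ)//.
  have E (k : borel X -> R) : k \in Lfun mu 2%:E -> (\int[mu]_x (k x)%:E = (inner mu k (cst 1))%:E)%E.
    move=> kL; rewrite /inner /Rintegral fineK.
      by apply: eq_integral => x _; rewrite mulr1.
    apply: integrable_fin_num => //; apply: (Lfun2_mul_integrable kL); exact: Lfun_cst.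
  rewrite E ?Lfun2_semigroup// [RHS]E//; congr EFin.
  by rewrite inner_semigroup_sym ?semigroup_cst//; exact: Lfun_cst.
Qed.

Lemma semigroup_sqr_le t f x : 0 <= t -> measurable_fun [set: borel X] f ->
  ((semigroup t f x ^+ 2)%:E <= \int[P x]_w (f (Z t w) ^+ 2)%:E)%E.
Proof.
move=> t0 mf; have mfZ := measurable_process_comp markovZ t0 mf.
by have := sqr_Rintegral_le measurableT (Px1 x) mfZ; rewrite mul1e.
Qed.

(** Jensen's inequality (P_t f)^2 <= P_t (f^2), integrated with the invariance of mu. *)
Lemma inner_semigroup_contraction t f : 0 <= t -> f \in Lfun mu 2%:E ->
  inner mu (semigroup t f) (semigroup t f) <= inner mu f f.
Proof.
move=> t0 fL; have mf := Lfun2_measurable fL.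
have nf : nonneg_measurable (fun x => (f x ^+ 2)%:E : \bar R).
  by split; [exact/measurable_EFinP/measurable_funX|move=> x; rewrite lee_fin sqr_ge0].
rewrite -lee_fin -!inner_sqrE//; last exact: Lfun2_semigroup.
rewrite -(integral_semigroup t0 nf); apply: ge0_le_integral => //.
- by move=> x _; rewrite lee_fin sqr_ge0.
- by apply/measurable_EFinP/measurable_funX/Lfun2_measurable/Lfun2_semigroup.
- apply: measurable_expectation; split; last by move=> x; rewrite lee_fin sqr_ge0.
  by apply: (emeasurable_process_comp markovZ t0 (f := fun x => (f x ^+ 2)%:E)); have [] := nf.
- by move=> x _; exact: semigroup_sqr_le.
Qed.

(* a.e. because P_x (f (Z (s + t))) may be infinite on a null set, where the
   Bochner-type expectation defining [semigroup] is a junk value *)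
Lemma semigroupD_ge0 s t f : 0 <= s -> 0 <= t -> f \in Lfun mu 2%:E -> (forall x, 0 <= f x) ->
  {ae mu, forall x, semigroup s (semigroup t f) x = semigroup (s + t) f x}.
Proof.
move=> s0 t0 fL f0; have mf := Lfun2_measurable fL.
have st0 : 0 <= s + t by rewrite addr_ge0.
have nf : nonneg_measurable (fun x => (f x)%:E : \bar R).
  by split; [exact/measurable_EFinP|move=> x; rewrite lee_fin].
pose F u x := (\int[P x]_w (f (Z u w))%:E)%E.
have nF u : 0 <= u -> nonneg_measurable (F u).
  move=> u0; split; last by move=> x; apply: integral_ge0 => w _; rewrite lee_fin.
  apply: measurable_expectation; split; last by move=> w; rewrite lee_fin.
  by apply: (emeasurable_process_comp markovZ u0 (f := EFin \o f)); exact/measurable_EFinP.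
have : mu.-integrable setT (F (s + t)).
  apply/integrableP; split; first by have [] := nF _ st0.
  under eq_integral do rewrite gee0_abs ?(proj2 (nF _ st0))//.
  rewrite (integral_semigroup st0 nf).
  have := Lfun2_integrable fL => /integrableP[_].
  by under eq_integral do rewrite gee0_abs ?lee_fin ?f0//.
move=> /integrable_ae => /(_ measurableT); apply: filterS => x /(_ I) Fx.
have FF : F (s + t) x = (\int[P x]_w F t (Z s w))%E.
  exact: (markov_set markovZ x s0 t0 (@measurableT _ (past_type Z s)) nf).
have iF : (P x).-integrable setT (fun w => F t (Z s w)).
  apply/integrableP; split; first by apply: (emeasurable_process_comp markovZ s0 (f := F t)); have [] := nF _ t0.
  under eq_integral do rewrite gee0_abs ?(proj2 (nF _ t0))//.
  by rewrite -FF -ge0_fin_numE// (proj2 (nF _ st0)).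
rewrite /Defs.semigroup /Rintegral; congr fine; rewrite -/(F (s + t) x) FF.
apply: ae_eq_integral => //.
- apply/measurable_EFinP; apply: (measurable_process_comp markovZ s0 (f := semigroup t f)).
  exact/Lfun2_measurable/Lfun2_semigroup.
- by apply: (emeasurable_process_comp markovZ s0 (f := F t)); have [] := nF _ t0.
- have := integrable_ae measurableT iF; apply: filterS => w /(_ I) Fw _.
  by rewrite /= fineK.
Qed.

Lemma Lfun2_pos f : f \in Lfun mu 2%:E -> f^\+ \in Lfun mu 2%:E.
Proof.
move=> fL; have mf := Lfun2_measurable fL.
apply: Lfun2P; first exact: measurable_funrpos.
have := Lfun2_integrable_sqr fL => /integrableP[_].
under eq_integral do rewrite gee0_abs ?lee_fin ?sqr_ge0//.
apply: le_lt_trans; apply: ge0_le_integral => //.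
- by move=> x _; rewrite lee_fin sqr_ge0.
- by apply/measurable_EFinP/measurable_funX/measurable_funrpos.
- by apply/measurable_EFinP/measurable_funX.
- move=> x _; rewrite lee_fin /funrpos /=.
  by case: (leP 0 (f x)) => //= _; rewrite expr0n sqr_ge0.
Qed.

Lemma Lfun2_neg f : f \in Lfun mu 2%:E -> f^\- \in Lfun mu 2%:E.
Proof.
move=> fL; rewrite -funrposN; apply: Lfun2_pos.
have := mul_bounded_Lfun2 (a := cst (-1)) (C := 1) (measurable_cst _) _ fL.
under eq_fun do rewrite mulN1r.
by apply=> x; rewrite normrN1.
Qed.

End symmetric_semigroups.

Lemma ler_dist_max0 (R : realType) (s t : R) : `|Num.max t 0 - Num.max s 0| <= `|t - s|.
Proof.
case: (leP t 0) => t0; case: (leP s 0) => s0 //.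
- by rewrite subrr normr0.
- by rewrite sub0r normrN gtr0_norm//; have := ler_norm (s - t); rewrite distrC; lra.
- by rewrite subr0 gtr0_norm//; have := ler_norm (t - s); lra.
Qed.

Section semigroup_form.
Context (R : realType) (X : completePseudoMetricType R).
Context d (Omega : measurableType d).
Variables (P : R.-pker (borel X) ~> Omega) (Z : R -> Omega -> X).
Variable mu : probability (borel X) R.
Hypothesis hausdorffX : hausdorff_space X.
Hypothesis markovZ : cadlag_markov_process P Z.
Hypothesis symP : symmetric_semigroup P Z mu.
Local Notation semigroup := (semigroup P Z).

Lemma inner_posneg (f k : borel X -> R) : f \in Lfun mu 2%:E -> k \in Lfun mu 2%:E ->
  inner mu f k = inner mu f^\+ k - inner mu f^\- k.
Proof.
move=> fL kL; have := inner_linl (Lfun2_neg fL) (Lfun2_pos fL) kL (-1).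
rewrite mulN1r addrC => <-; congr (inner mu _ k).
apply/funext => x; rewrite mulN1r addrC.
by have := congr1 (@^~ x) (funrposBneg f).
Qed.

(** The pointwise law is available for f >= 0. Symmetry moves both operators onto h, which makes
    each side linear in f, and f splits into its positive and negative parts. *)
Lemma inner_semigroupD s t (f h : borel X -> R) : 0 <= s -> 0 <= t ->
  f \in Lfun mu 2%:E -> h \in Lfun mu 2%:E ->
  inner mu (semigroup s (semigroup t f)) h = inner mu (semigroup (s + t) f) h.
Proof.
move=> s0 t0 fL hL; have st0 : 0 <= s + t by rewrite addr_ge0.
have L := Lfun2_semigroup symP.
have pos k : k \in Lfun mu 2%:E -> (forall x, 0 <= k x) ->
    inner mu (semigroup s (semigroup t k)) h = inner mu (semigroup (s + t) k) h.
  move=> kL k0; have tL := L t k t0 kL.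
  apply: inner_ae; [exact: (Lfun2_measurable (L s _ s0 tL))
    |exact: (Lfun2_measurable (L _ k st0 kL))|exact: (Lfun2_measurable hL)|].
  exact: (semigroupD_ge0 markovZ symP s0 t0 kL k0).
have S := inner_semigroup_sym symP.
have [pL nL] := (Lfun2_pos fL, Lfun2_neg fL).
have e1 k (kL : k \in Lfun mu 2%:E) :
    inner mu (semigroup s (semigroup t k)) h = inner mu k (semigroup t (semigroup s h)).
  by rewrite (S s _ h s0 (L t k t0 kL) hL) (S t k _ t0 kL (L s h s0 hL)).
have e2 k (kL : k \in Lfun mu 2%:E) := S (s + t) k h st0 kL hL.
rewrite (e1 f fL) (e2 f fL) (inner_posneg fL (L t _ t0 (L s h s0 hL))) (inner_posneg fL (L _ h st0 hL)).
have Ep := pos _ pL (funrpos_ge0 f); have En := pos _ nL (funrneg_ge0 f).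
exact: (f_equal2 (fun x y => x - y) (etrans (esym (e1 _ pL)) (etrans Ep (e2 _ pL)))
  (etrans (esym (e1 _ nL)) (etrans En (e2 _ nL)))).
Qed.

Let max0 (t : R) : 0 <= Num.max t 0. Proof. by rewrite le_max lexx orbT. Qed.

Let maxE (t : R) : 0 <= t -> Num.max t 0 = t. Proof. by move=> /max_idPl. Qed.

Definition semigroup_op t (f : L2 mu) : L2 mu :=
  toL2 (Lfun2_semigroup symP (max0 t) (L2_mem f)).

Lemma semigroup_opE t (f : L2 mu) : 0 <= t -> semigroup_op t f = semigroup t f :> (borel X -> R).
Proof. by move=> t0; rewrite /= maxE. Qed.

(* negative times are sent to 0 to make [t |-> <P_t f, h>] continuous on R *)
Definition semigroup_inner t (f h : L2 mu) : R := inner mu (semigroup (Num.max t 0) f) h.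

Lemma semigroup_innerE t f h : 0 <= t -> semigroup_inner t f h = inner mu (semigroup t f) h.
Proof. by move=> t0; rewrite /semigroup_inner maxE. Qed.

Lemma semigroup_inner0 f h : semigroup_inner 0 f h = inner mu f h.
Proof.
by rewrite /semigroup_inner maxxx semigroup0//; apply/Lfun2_measurable/L2_mem.
Qed.

(** Linearity in f is read off <f, P_t h>, where the semigroup no longer acts on f. The last clause
    combines contractivity with the Cauchy-Schwarz inequality. *)
Lemma semigroup_formP : semigroup_form semigroup_inner semigroup_op.
Proof.
have L := Lfun2_semigroup symP.
have S := inner_semigroup_sym symP.
split.
- move=> t c f g h t0; rewrite /semigroup_inner maxE// !S ?L2_mem//.
  have psdI := psd_inner mu.
  by rewrite -(psd_linl psdI c f g (toL2 (L t h t0 (L2_mem h)))).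
- by move=> t f h t0; rewrite /semigroup_inner maxE// S ?L2_mem// inner_sym.
- by move=> f; rewrite semigroup_inner0; exact: inner_ge0.
- move=> s t f h s0 t0; rewrite /semigroup_inner (semigroup_opE f t0).
  rewrite (maxE s0) (maxE (addr_ge0 s0 t0)).
  exact: (inner_semigroupD s0 t0 (L2_mem f) (L2_mem h)).
- move=> t f t0; rewrite semigroup_inner0 /semigroup_inner maxE//.
  have H := psd_CauchySchwarz (psd_inner mu) (semigroup_op t f) f.
  have C := inner_semigroup_contraction markovZ symP t0 (L2_mem f).
  rewrite /= maxE// in H.
  have := inner_ge0 mu f; move: H C.
  move: (inner mu (semigroup t f) f) (inner mu (semigroup t f) _) (inner mu f f) => a b c.
  move=> H1 H2 c0.
  rewrite leNgt; apply/negP => ca.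
  have : c ^+ 2 < a ^+ 2 by rewrite ltr_pXn2r// nnegrE ltW// (le_lt_trans c0).
  have : b * c <= c ^+ 2 by rewrite expr2 ler_wpM2r.
  by move=> /(le_trans H1) /le_lt_trans h /h; rewrite ltxx.
Qed.

(** The bound is uniform in s, so strong continuity at 0 propagates to every time. *)
Lemma semigroup_inner_continuous_bound s t (f h : L2 mu) : 0 <= s -> 0 <= t ->
  `|semigroup_inner (s + t) f h - semigroup_inner s f h| <=
  Num.sqrt (inner mu (semigroup_op t f - f : L2 mu) (semigroup_op t f - f : L2 mu)) *
  Num.sqrt (inner mu h h).
Proof.
move=> s0 t0; have sg := semigroup_formP; have psds := psd_semigroup_form sg s0.
have -> : semigroup_inner (s + t) f h - semigroup_inner s f h =
    semigroup_inner s (semigroup_op t f - f) h.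
  by rewrite (psdBl psds) (semigroup_formT sg f h s0 t0).
rewrite -sqrtrM ?inner_ge0// -sqrtr_sqr ler_wsqrtr//.
apply: (le_trans (psd_CauchySchwarz psds _ _)).
have [_ _ _ _ C] := sg; rewrite -!semigroup_inner0.
by apply: ler_pM; rewrite ?(psd_ge0 psds) ?C.
Qed.

Hypothesis contP : strongly_continuous_semigroup P Z mu.

Lemma semigroup_op_cvg (f : L2 mu) (e : R) : 0 < e -> exists2 eta : R, 0 < eta &
  forall t, 0 <= t -> t < eta ->
  Num.sqrt (inner mu (semigroup_op t f - f : L2 mu) (semigroup_op t f - f : L2 mu)) <= e.
Proof.
move=> e0; have /fine_cvgP[_ /cvgrPdist_lt /(_ e e0)] := contP (L2_mem f).
move=> [eta eta0 H]; exists eta => [//|t].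
(* The limit along [0^'+] says nothing at t = 0, where P_0 f = f is used instead. *)
rewrite le_eqVlt => /predU1P[<- _|t0 te].
  have -> : semigroup_op 0 f = f.
    apply/val_inj => /=; rewrite maxxx semigroup0//.
  by rewrite subrr (psd0l (psd_inner mu)) sqrtr0 ltW.
have H1 : `|0 - fine ('N[mu]_2%:E[EFin \o (semigroup t f \- f)%R])%E| < e.
  by apply: (H t _ t0); rewrite /ball_/= sub0r normrN ger0_norm ?ltW.
have E : (semigroup t f \- f)%R = (semigroup_op t f - f : L2 mu).
  by rewrite /semigroup_op/= maxE// ltW.
move: H1; rewrite E sub0r normrN (Lnorm2E (L2_mem _))/= ger0_norm ?sqrtr_ge0//; exact: ltW.
Qed.

Lemma continuous_semigroup_inner (f h : L2 mu) :
  continuous (fun t => semigroup_inner t f h).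
Proof.
move=> t; apply/cvgrPdist_le => e e0.
pose N := Num.sqrt (inner mu h h).
have N0 : 0 < N + 1 by rewrite ltr_wpDl// sqrtr_ge0.
have [eta eta0 H] := semigroup_op_cvg f (divr_gt0 e0 N0).
have main s u : 0 <= s -> s <= u -> u - s < eta ->
    `|semigroup_inner u f h - semigroup_inner s f h| <= e.
  move=> s0 su us; have us0 : 0 <= u - s by rewrite subr_ge0.
  rewrite -[u in semigroup_inner u](subrKC s u).
  apply: (le_trans (semigroup_inner_continuous_bound f h s0 us0)).
  apply: (@le_trans _ _ (e / (N + 1) * (N + 1))); last by rewrite divfK// gt_eqF.
  apply: ler_pM; rewrite ?sqrtr_ge0//; first exact: H.
  by rewrite lerDl.
have E s : semigroup_inner s f h = semigroup_inner (Num.max s 0) f h.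
  by rewrite /semigroup_inner (maxE (max0 s)).
exists eta => //= s ts; rewrite (E t) (E s).
have ts' : `|Num.max t 0 - Num.max s 0| < eta.
  exact: le_lt_trans (ler_dist_max0 s t) ts.
have [st|/ltW st] := leP (Num.max s 0) (Num.max t 0).
  by apply: main => //; rewrite -[ltLHS]ger0_norm ?subr_ge0.
by rewrite distrC; apply: main => //; rewrite -[ltLHS]ger0_norm ?subr_ge0// distrC.
Qed.

End semigroup_form.

(** * Potentials and the Dirichlet form *)

Section fubini_itv.
Context d (Y : measurableType d) (R : realType) (m : probability Y R).
Variables (a b : R).
Local Notation leb := (@lebesgue_measure R).
Local Notation I := (`[a, b]%classic : set (measurableTypeR R)).

Let patchE (F : measurableTypeR R * Y -> \bar R) s y :
  ((fun s => F (s, y)) \_ I) s = ((\1_I s)%:E * F (s, y))%E.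
Proof. by rewrite epatch_indic/= muleC. Qed.

Let measurable_patch (F : measurableTypeR R * Y -> \bar R) :
  measurable_fun [set: measurableTypeR R * Y] F ->
  measurable_fun [set: measurableTypeR R * Y] (fun p => ((\1_I p.1)%:E * F p)%E).
Proof.
move=> mF; apply: emeasurable_funM => //; apply/measurable_EFinP.
by apply: (measurableT_comp (f := \1_I : measurableTypeR R -> R)) => //; exact: measurable_indic.
Qed.

Lemma ge0_Fubini_itv (F : measurableTypeR R * Y -> \bar R) :
  measurable_fun [set: measurableTypeR R * Y] F -> (forall p, 0 <= F p)%E ->
  [/\ measurable_fun [set: Y] (fun y => \int[leb]_(s in `[a, b]) F (s, y))%E,
      measurable_fun [set: measurableTypeR R] (fun s => \int[m]_y F (s, y))%E &
      (\int[m]_y \int[leb]_(s in `[a, b]) F (s, y) =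
       \int[leb]_(s in `[a, b]) \int[m]_y F (s, y))%E].
Proof.
move=> mF F0.
have F10 p : (0 <= (\1_I p.1)%:E * F p)%E by apply: mule_ge0; rewrite ?lee_fin.
have H := @fubini_tonelli _ _ _ _ R (@lebesgue_measure R) m _ (measurable_patch mF) F10.
have E y : (\int[leb]_(s in `[a, b]) F (s, y) = \int[leb]_s ((\1_I s)%:E * F (s, y)))%E.
  by rewrite integral_mkcond; apply: eq_integral => s _; rewrite -patchE.
split.
- rewrite (funext E).
  exact: (measurable_fun_fubini_tonelli_G (m1 := leb) _ (measurable_patch mF) F10).
- exact: (measurable_fun_fubini_tonelli_F (m2 := m) _ mF F0).
- rewrite (eq_integral _ _ (fun y _ => E y)) -H.
  rewrite [RHS]integral_mkcond; apply: eq_integral => s _.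
  rewrite epatch_indic/= muleC ge0_integralZl ?lee_fin//.
  exact: (measurableT_comp mF).
Qed.

(** On a null set of y the slice may fail to be integrable and its integral takes a default value.
    The a.e. clause is what later allows a factor h y to be pulled out of the time integral. *)
Lemma Rintegral_Fubini_itv (F : measurableTypeR R * Y -> R) :
  measurable_fun [set: measurableTypeR R * Y] F ->
  (\int[leb]_(s in `[a, b]) \int[m]_y `|F (s, y)|%:E < +oo)%E ->
  [/\ {ae m, forall y, leb.-integrable `[a, b] (fun s => (F (s, y))%:E)},
      measurable_fun [set: Y] (fun y => \int[leb]_(s in `[a, b]) F (s, y)) &
      \int[m]_y (\int[leb]_(s in `[a, b]) F (s, y)) =
      \int[leb]_(s in `[a, b]) (\int[m]_y F (s, y))].
Proof.
move=> mF Foo.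
pose F1 (p : measurableTypeR R * Y) := ((\1_I p.1)%:E * (F p)%:E)%E.
have mF1 : measurable_fun [set: measurableTypeR R * Y] F1.
  by apply: (measurable_patch (F := EFin \o F)); exact/measurable_EFinP.
have intF1 : ((@lebesgue_measure R) \x m)%E.-integrable setT F1.
  apply/integrable12ltyP => //; apply: le_lt_trans Foo.
  rewrite [leRHS]integral_mkcond le_eqVlt; apply/orP; left; apply/eqP.
  apply: eq_integral => s _; rewrite epatch_indic/= muleC -ge0_integralZl//.
  - by apply: eq_integral => y _; rewrite /F1/= normrM ger0_norm.
  - apply/measurable_EFinP; apply: measurableT_comp => //.
    exact: (measurableT_comp mF).
have G y : (\int[leb]_s F1 (s, y) = \int[leb]_(s in `[a, b]) (F (s, y))%:E)%E.
  by rewrite [RHS]integral_mkcond; apply: eq_integral => s _; rewrite (patchE (EFin \o F)).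
have ae2 : {ae m, forall y, leb.-integrable `[a, b] (fun s => (F (s, y))%:E)}.
  have := ae_integrable2 intF1; apply: filterS => y iF; apply/integrable_mkcond => //.
  by apply: eq_integrable iF => // s _; rewrite (patchE (EFin \o F)).
have mG : measurable_fun setT (fun y => \int[leb]_s F1 (s, y))%E.
  exact: (measurable_fubini_G intF1).
have mG' : measurable_fun [set: Y] (fun y => \int[leb]_(s in `[a, b]) F (s, y)).
  rewrite [X in measurable_fun _ X](_ : _ = fine \o (fun y => \int[leb]_s F1 (s, y))%E).
    exact: measurableT_comp.
  by apply/funext => y; rewrite /= G.
have mH : measurable_fun setT (fun s => \int[m]_y F1 (s, y))%E.
  exact: (measurable_fubini_F intF1).
split => //; congr fine.
transitivity (\int[m]_y \int[leb]_s F1 (s, y))%E.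
  apply: ae_eq_integral => //; first exact/measurable_EFinP.
  apply: filterS ae2 => y iF _; rewrite G /Rintegral fineK//.
  exact: integrable_fin_num iF.
rewrite -(Fubini intF1) [RHS]integral_mkcond.
apply: ae_eq_integral => //.
  rewrite [X in measurable_fun _ X](_ : _ = EFin \o fine \o (fun s => \int[m]_y F1 (s, y))%E).
    by do 2 apply: measurableT_comp => //.
  apply/funext => s /=; rewrite epatch_indic/= indicE /F1/= indicE.
  case: (s \in I) => /=; rewrite ?mule1 ?mule0; last first.
    by under eq_integral do rewrite mul0e; rewrite integral0.
  by congr (_%:E); congr fine; apply: eq_integral => y _; rewrite mul1e.
have := ae_integrable1 intF1; apply: filterS => s iF _.
rewrite epatch_indic/= indicE; move: iF; rewrite /F1/= indicE.
case: (s \in I) => /=; rewrite ?mule1 ?mule0; last first.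
  by under eq_integral do rewrite mul0e; rewrite integral0.
move=> iF; rewrite /Rintegral fineK; first by apply: eq_integral => y _; rewrite mul1e.
have := integrable_fin_num _ iF; under eq_integral do rewrite mul1e; exact.
Qed.

End fubini_itv.

(** * Time integrals of the semigroup *)

Section potential.
Context (R : realType) (X : completePseudoMetricType R).
Context d (Omega : measurableType d).
Variables (P : R.-pker (borel X) ~> Omega) (Z : R -> Omega -> X).
Variable mu : probability (borel X) R.
Hypothesis markovZ : cadlag_markov_process P Z.
Local Notation semigroup := (semigroup P Z).
Local Notation leb := (@lebesgue_measure R).

Lemma measurable_process2 (f : borel X -> R) : measurable_fun [set: borel X] f ->
  measurable_fun [set: measurableTypeR R * Omega] (fun p => f (Z (Num.max p.1 0) p.2)).
Proof.
have [mZ cZ _ _] := markovZ => mf.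
by apply: (measurableT_comp mf); exact: measurable_cadlag.
Qed.

Lemma measurable_semigroup2 (f : borel X -> R) : measurable_fun [set: borel X] f ->
  measurable_fun [set: measurableTypeR R * borel X] (fun p => semigroup (Num.max p.1 0) f p.2).
Proof.
move=> mf.
have key (k : borel X -> \bar R) : measurable_fun [set: borel X] k -> (forall x, 0 <= k x)%E ->
    measurable_fun [set: measurableTypeR R * borel X]
      (fun p => \int[P p.2]_w k (Z (Num.max p.1 0%R) w))%E.
  move=> mk k0.
  apply: (@measurable_fun_integral_finite_kernel _ _ (measurableTypeR R * borel X)%type Omega R
    (fun q => k (Z (Num.max q.1.1 0) q.2)) (kernel.kernel_snd P)) => //.
  have [mZ cZ _ _] := markovZ.
  apply: (measurableT_comp mk).
  apply: (measurableT_comp (f := fun p : measurableTypeR R * Omega => Z (Num.max p.1 0) p.2 : borel X)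
    (g := fun q : (measurableTypeR R * borel X) * Omega => (q.1.1, q.2))); first exact: measurable_cadlag.
  apply/measurable_fun_pair => /=; last exact: measurable_snd.
  exact: (measurableT_comp (measurable_fst (T1 := measurableTypeR R) (T2 := borel X))
    (measurable_fst (T1 := (measurableTypeR R * borel X)%type) (T2 := Omega))).
have mEf : measurable_fun [set: borel X] (EFin \o f) by exact/measurable_EFinP.
rewrite [X in measurable_fun _ X](_ : _ = fine \o (fun p : measurableTypeR R * borel X =>
   \int[P p.2]_w (EFin \o f)^\+ (Z (Num.max p.1 0%R) w) - \int[P p.2]_w (EFin \o f)^\- (Z (Num.max p.1 0%R) w))%E).
  apply: measurableT_comp => //; apply: emeasurable_funB; apply: key => //.
  - exact: measurable_funepos.
  - exact: measurable_funeneg.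
apply/funext => p; rewrite /Defs.semigroup /Rintegral /= integralE; congr (fine (_ - _)%E).
  by apply: eq_integral => w _; rewrite !funeposE.
by apply: eq_integral => w _; rewrite !funenegE.
Qed.

Hypothesis symP : symmetric_semigroup P Z mu.
Local Notation B := (semigroup_inner P Z (mu := mu)).

Let max0 (t : R) : 0 <= Num.max t 0. Proof. by rewrite le_max lexx orbT. Qed.

Definition potential (t : R) (f : borel X -> R) : borel X -> R :=
  fun x => \int[leb]_(s in `[0, t]) semigroup (Num.max s 0) f x.

Let lebT (t : R) : 0 <= t -> leb `[0, t] = t%:E.
Proof. by move=> t0; rewrite lebesgue_measure_segment// subr0. Qed.

Let integral_cst_itv (t c : R) : 0 <= t -> (\int[leb]_(s in `[0%R, t]) c%:E = (c * t)%:E)%E.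
Proof. by move=> t0; rewrite integral_cst//= lebT. Qed.

(** From |u v| <= u^2 + v^2 and the contraction property, uniformly in time. *)
Lemma semigroup_mul_integrable2 (t : R) (f h : borel X -> R) : 0 <= t ->
  f \in Lfun mu 2%:E -> h \in Lfun mu 2%:E ->
  (\int[leb]_(s in `[0%R, t]) \int[mu]_x `|semigroup (Num.max s 0) f x * h x|%:E < +oo)%E.
Proof.
move=> t0 fL hL; have mf := Lfun2_measurable fL; have mh := Lfun2_measurable hL.
apply: (@le_lt_trans _ _ (\int[leb]_(s in `[0%R, t]) (inner mu f f + inner mu h h)%:E)%E); last first.
  by rewrite integral_cst_itv// ltry.
have mF : measurable_fun [set: measurableTypeR R * borel X]
    (fun p => `|semigroup (Num.max p.1 0) f p.2 * h p.2|%:E).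
  apply/measurable_EFinP; apply: measurableT_comp => //; apply: measurable_funM.
    exact: measurable_semigroup2.
  exact: (measurableT_comp mh).
apply: ge0_le_integral => //.
- by move=> s _; apply: integral_ge0 => x _; rewrite lee_fin.
- apply: measurable_funTS.
  by have [//|_ + _] := @ge0_Fubini_itv _ _ _ mu 0 t _ mF.
- move=> s _; have PL := Lfun2_semigroup symP (max0 s) fL.
  apply: (@le_trans _ _ (\int[mu]_x ((semigroup (Num.max s 0) f x ^+ 2)%:E + (h x ^+ 2)%:E))%E).
    apply: ge0_le_integral => //.
    + apply/measurable_EFinP; apply: measurableT_comp => //; apply: measurable_funM => //.
      exact: (Lfun2_measurable PL).
    + apply: emeasurable_funD; apply/measurable_EFinP/measurable_funX => //.
      exact: (Lfun2_measurable PL).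
    + move=> x _; rewrite -EFinD lee_fin normrM.
      rewrite -(real_normK (num_real (semigroup _ f x))) -(real_normK (num_real (h x))).
      have := normr_ge0 (semigroup (Num.max s 0) f x); have := normr_ge0 (h x).
      by move: `|_| `|_| => u v; nra.
  have mP2 : measurable_fun [set: borel X] (fun x => (semigroup (Num.max s 0) f x ^+ 2)%:E).
    by apply/measurable_EFinP/measurable_funX; exact: (Lfun2_measurable PL).
  have mh2 : measurable_fun [set: borel X] (fun x => (h x ^+ 2)%:E).
    exact/measurable_EFinP/measurable_funX.
  have p0 x : [set: borel X] x -> (0 <= (semigroup (Num.max s 0) f x ^+ 2)%:E)%E by rewrite lee_fin sqr_ge0.
  have h0 x : [set: borel X] x -> (0 <= (h x ^+ 2)%:E)%E by rewrite lee_fin sqr_ge0.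
  rewrite (ge0_integralD mu measurableT p0 mP2 h0 mh2).
  rewrite !inner_sqrE// EFinD leeD2r// lee_fin.
  exact: inner_semigroup_contraction.
Qed.

(** The Cauchy-Schwarz inequality in time bounds the square by t int_0^t (P_s f)^2 ds, to which
    Tonelli's theorem and contractivity apply. *)
Lemma potential_Lfun2 (t : R) (f : borel X -> R) : 0 <= t ->
  f \in Lfun mu 2%:E -> potential t f \in Lfun mu 2%:E.
Proof.
move=> t0 fL; have mf := Lfun2_measurable fL.
have mF := measurable_semigroup2 mf.
have F1 := semigroup_mul_integrable2 t0 fL (Lfun_cst mu 1 2).
have [|_ mv _] := @Rintegral_Fubini_itv _ _ _ mu 0 t _ mF.
  by move: F1; under eq_integral do (under eq_integral do rewrite mulr1).
apply: Lfun2P => //.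
have mF2 : measurable_fun [set: measurableTypeR R * borel X]
    (fun p => (semigroup (Num.max p.1 0) f p.2 ^+ 2)%:E).
  exact/measurable_EFinP/measurable_funX.
have [|mG mH E] := @ge0_Fubini_itv _ _ _ mu 0 t _ mF2.
  by move=> p; rewrite lee_fin sqr_ge0.
apply: (@le_lt_trans _ _ (\int[mu]_x (t%:E * \int[leb]_(s in `[0%R, t]) (semigroup (Num.max s 0) f x ^+ 2)%:E))%E).
  apply: ge0_le_integral => //.
  - by move=> x _; rewrite lee_fin sqr_ge0.
  - exact/measurable_EFinP/measurable_funX.
  - exact: measurable_funeM.
  - move=> x _; apply: sqr_Rintegral_le => //; first exact: lebT.
    apply: measurable_funTS; apply: (measurableT_comp (g := fun s : measurableTypeR R => (s, x)) mF).
    by apply/measurable_fun_pair => //=; exact: measurable_cst.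
rewrite ge0_integralZl//; last first.
  by move=> x _; apply: integral_ge0 => s _; rewrite lee_fin sqr_ge0.
rewrite E; apply: (@le_lt_trans _ _ (t%:E * \int[leb]_(s in `[0%R, t]) (inner mu f f)%:E)%E).
  rewrite lee_wpmul2l ?lee_fin//; apply: ge0_le_integral => //.
  - by move=> s _; apply: integral_ge0 => x _; rewrite lee_fin sqr_ge0.
  - exact: measurable_funTS.
  - move=> s _; rewrite (inner_sqrE (Lfun2_semigroup symP (max0 s) fL)) lee_fin.
    exact: inner_semigroup_contraction.
by rewrite integral_cst_itv// -EFinM ltry.
Qed.

Lemma inner_potential (t : R) (f h : L2 mu) : 0 <= t ->
  inner mu (potential t f) h = \int[leb]_(s in `[0, t]) B s f h.
Proof.
move=> t0; have [fL hL] := (L2_mem f, L2_mem h).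
have [mf mh] := (Lfun2_measurable fL, Lfun2_measurable hL).
have mF := measurable_semigroup2 mf.
have F1 := semigroup_mul_integrable2 t0 fL (Lfun_cst mu 1 2).
have [|ae1 mv _] := @Rintegral_Fubini_itv _ _ _ mu 0 t _ mF.
  by move: F1; under eq_integral do (under eq_integral do rewrite mulr1).
have mFh : measurable_fun [set: measurableTypeR R * borel X] (fun p => semigroup (Num.max p.1 0) f p.2 * h p.2).
  by apply: measurable_funM => //; exact: (measurableT_comp mh).
have [|_ mw E] := @Rintegral_Fubini_itv _ _ _ mu 0 t _ mFh.
  exact: semigroup_mul_integrable2.
rewrite /inner /semigroup_inner -E; congr fine; apply: ae_eq_integral => //.
- by apply/measurable_EFinP/measurable_funM.
- exact/measurable_EFinP.
- by apply: filterS ae1 => x ix _; rewrite /potential/= RintegralZr.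
Qed.

End potential.

(** * Integrals of continuous functions over segments *)

Section continuous_integrals.
Context (R : realType).
Local Notation leb := (@lebesgue_measure R).
Implicit Types (b : R -> R) (a c e : R).

Lemma continuous_integrable_itv b a c : continuous b -> leb.-integrable `[a, c] (EFin \o b).
Proof.
move=> cb; apply: continuous_compact_integrable; first exact: segment_compact.
by apply: continuous_subspaceT => x; exact: cb.
Qed.

Lemma Rintegral_itv_cst a c (k : R) : a <= c -> \int[leb]_(s in `[a, c]) k = k * (c - a).
Proof.
move=> ac; rewrite Rintegral_cst//; congr (k * _).
by rewrite [X in fine X](lebesgue_measure_segment ac).
Qed.

Lemma integrable_Rintegral_itv_cat b a c e : leb.-integrable `[a, e] (EFin \o b) -> a <= c -> c <= e ->
  \int[leb]_(s in `[a, e]) b s = \int[leb]_(s in `[a, c]) b s + \int[leb]_(s in `[c, e]) b s.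
Proof.
move=> ib ac ce; apply/eqP; rewrite addrC -subr_eq; apply/eqP.
rewrite (Rintegral_itvB ib) ?bnd_simp// Rintegral_itv_obnd_cbnd//.
by apply: integrableS ib => //; apply: subset_itvr; rewrite bnd_simp.
Qed.

Lemma Rintegral_itv_cat b a c e : continuous b -> a <= c -> c <= e ->
  \int[leb]_(s in `[a, e]) b s = \int[leb]_(s in `[a, c]) b s + \int[leb]_(s in `[c, e]) b s.
Proof. by move=> cb; apply: integrable_Rintegral_itv_cat; exact: continuous_integrable_itv. Qed.

Lemma le_Rintegral_continuous b b' a c : continuous b -> continuous b' ->
  (forall s, a <= s <= c -> b s <= b' s) ->
  \int[leb]_(s in `[a, c]) b s <= \int[leb]_(s in `[a, c]) b' s.
Proof.
by move=> cb cb' bb'; apply: le_Rintegral => //; exact: continuous_integrable_itv.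
Qed.

Lemma RintegralD_continuous b b' a c : continuous b -> continuous b' ->
  \int[leb]_(s in `[a, c]) (b s + b' s) =
  \int[leb]_(s in `[a, c]) b s + \int[leb]_(s in `[a, c]) b' s.
Proof. by move=> cb cb'; rewrite RintegralD//; exact: continuous_integrable_itv. Qed.

Lemma RintegralB_continuous b b' a c : continuous b -> continuous b' ->
  \int[leb]_(s in `[a, c]) (b s - b' s) =
  \int[leb]_(s in `[a, c]) b s - \int[leb]_(s in `[a, c]) b' s.
Proof. by move=> cb cb'; rewrite RintegralB//; exact: continuous_integrable_itv. Qed.

Lemma ler_norm_Rintegral_continuous b a c (k : R) : continuous b -> a <= c ->
  (forall s, a <= s <= c -> `|b s| <= k) ->
  `|\int[leb]_(s in `[a, c]) b s| <= k * (c - a).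
Proof.
move=> cb ac bk; have ib := continuous_integrable_itv a c cb.
have ck (l : R) : continuous (fun _ : R => l) by move=> x; exact: cvg_cst.
apply/ler_normlP; split.
  rewrite lerNl -mulNr -(Rintegral_itv_cst _ ac); apply: le_Rintegral_continuous => // s /bk.
  by rewrite ler_norml => /andP[].
rewrite -(Rintegral_itv_cst _ ac); apply: le_Rintegral_continuous => // s /bk.
by rewrite ler_norml => /andP[].
Qed.

Lemma continuous_increments b t :
  continuous b -> continuous (fun u => (b (t + u) - b t) - (b u - b 0)).
Proof.
move=> cb u; apply: cvgB; (apply: cvgB; last exact: cvg_cst); last exact: cb.
apply: (@continuous_comp _ _ _ (fun u : R => t + u) b); last exact: cb.
by apply: cvgD; [exact: cvg_cst|exact: cvg_id].
Qed.

(** Compares a difference quotient of s |-> int_0^t b(u + s) du with its limit b t - b 0. Written as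
    an average of increments of b over [0, s], the error is visibly small with s. *)
Lemma Rintegral_increments b t s : continuous b -> 0 <= t -> 0 < s ->
  s^-1 * (\int[leb]_(u in `[0, t]) b (u + s) - \int[leb]_(u in `[0, t]) b u) - (b t - b 0) =
  s^-1 * \int[leb]_(u in `[0, s]) ((b (t + u) - b t) - (b u - b 0)).
Proof.
move=> cb t0 s0; have s0' := ltW s0.
have cst_cont (c : R) : continuous (fun _ : R => c) by move=> x; exact: cvg_cst.
have cshift : continuous (fun u : R => b (t + u)).
  move=> u; apply: (@continuous_comp _ _ _ (fun u : R => t + u) b); last exact: cb.
  by apply: cvgD; [exact: cvg_cst|exact: cvg_id].
have sub_cont (b1 b2 : R -> R) : continuous b1 -> continuous b2 -> continuous (fun u => b1 u - b2 u).
  by move=> cb1 cb2 u; apply: cvgB; [exact: cb1|exact: cb2].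
rewrite (RintegralB_continuous 0 s (sub_cont _ _ cshift (cst_cont (b t))) (sub_cont _ _ cb (cst_cont (b 0)))).
rewrite (RintegralB_continuous 0 s cshift (cst_cont (b t))) (RintegralB_continuous 0 s cb (cst_cont (b 0))).
rewrite !Rintegral_itv_cst// subr0.
have mb : measurable_fun [set: R] b by apply: continuous_measurable_fun.
rewrite (Rintegral_shift 0 t s mb) add0r.
have -> : \int[leb]_(u in `[0, s]) b (t + u) = \int[leb]_(u in `[t, t + s]) b u.
  under eq_Rintegral do rewrite addrC.
  by rewrite (Rintegral_shift 0 s t mb) add0r addrC.
have := @Rintegral_itv_cat b 0 s (t + s) cb s0'; rewrite lerDr => /(_ t0).
have := @Rintegral_itv_cat b 0 t (t + s) cb t0; rewrite lerDl => /(_ s0').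
move=> -> E; have -> : \int[leb]_(u in `[s, t + s]) b u =
  \int[leb]_(u in `[0, t]) b u + \int[leb]_(u in `[t, t + s]) b u - \int[leb]_(u in `[0, s]) b u.
  by rewrite E; ring.
by field; rewrite gt_eqF.
Qed.

Lemma lower_Riemann_sum_le b (delta : R) n : continuous b -> 0 < delta ->
  (forall s t, 0 <= s -> s <= t -> b t <= b s) ->
  delta * \sum_(k < n) b (k.+1%:R * delta) <= \int[leb]_(s in `[0, n%:R * delta]) b s.
Proof.
move=> cb d0 nib; elim: n => [|n IH].
  by rewrite big_ord0 mulr0 mul0r set_itv1 Rintegral_set1.
have nd : 0 <= n%:R * delta by rewrite mulr_ge0// ltW.
have dn : n%:R * delta <= n.+1%:R * delta by apply: ler_wpM2r; [exact: ltW|rewrite ler_nat].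
rewrite big_ord_recr/= mulrDr (Rintegral_itv_cat cb nd dn) lerD//.
have -> : delta * b (n.+1%:R * delta) = b (n.+1%:R * delta) * (n.+1%:R * delta - n%:R * delta).
  by rewrite -natr1; ring.
rewrite -(Rintegral_itv_cst _ dn); apply: le_Rintegral_continuous => //.
  by move=> x; exact: cvg_cst.
by move=> s /andP[s0 s1]; apply: nib => //; exact: le_trans s0.
Qed.

End continuous_integrals.

(** * Potentials, the generator and its square root *)

Section dirichlet_form.
Context (R : realType) (X : completePseudoMetricType R).
Context d (Omega : measurableType d).
Variables (P : R.-pker (borel X) ~> Omega) (Z : R -> Omega -> X).
Variable mu : probability (borel X) R.
Hypothesis hausdorffX : hausdorff_space X.
Hypothesis markovZ : cadlag_markov_process P Z.
Hypothesis symP : symmetric_semigroup P Z mu.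
Hypothesis contP : strongly_continuous_semigroup P Z mu.
Local Notation semigroup := (semigroup P Z).
Local Notation leb := (@lebesgue_measure R).
Local Notation B := (semigroup_inner P Z (mu := mu)).
Local Notation T := (semigroup_op symP).
Implicit Types (f h k : L2 mu).

Let sgB : semigroup_form B T := semigroup_formP hausdorffX markovZ symP.
Let B0 f h : B 0 f h = inner mu f h := semigroup_inner0 hausdorffX markovZ f h.
Let cB f h : continuous (fun t => B t f h).
Proof. exact: continuous_semigroup_inner hausdorffX markovZ symP contP f h. Qed.

Let psdI : psd_form (fun f h : L2 mu => inner mu f h) := psd_inner mu.

Definition potential_op t (t0 : 0 <= t) f : L2 mu :=
  toL2 (potential_Lfun2 markovZ symP t0 (L2_mem f)).

Lemma inner_potential_op t (t0 : 0 <= t) f h :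
  inner mu (potential_op t0 f) h = \int[leb]_(s in `[0, t]) B s f h.
Proof. exact: inner_potential. Qed.

Lemma semigroup_inner_potential t (t0 : 0 <= t) s f h : 0 <= s ->
  B s (potential_op t0 f) h = \int[leb]_(u in `[0, t]) B (u + s) f h.
Proof.
move=> s0; have [_ Bsym _ _ _] := sgB.
transitivity (B 0 (potential_op t0 f) (T s h)).
  by rewrite (semigroup_formTr sgB _ h (lexx 0) s0) add0r.
rewrite B0 inner_potential_op; apply: eq_Rintegral => u /set_mem/=; rewrite in_itv/= => /andP[u0 _].
by rewrite (semigroup_formTr sgB f h u0 s0).
Qed.

(** The error made when the difference quotient at step s of the potential is replaced by its
    expected limit P_t f - f. *)
Definition difference_quotient t (t0 : 0 <= t) s f : L2 mu :=
  s^-1 *: (T s (potential_op t0 f) - potential_op t0 f) - (T t f - f).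

Lemma inner_difference_quotient t (t0 : 0 <= t) s f h : 0 < s ->
  inner mu (difference_quotient t0 s f) h =
  s^-1 * \int[leb]_(u in `[0, s]) ((B (t + u) f h - B t f h) - (B u f h - B 0 f h)).
Proof.
move=> s0; have s0' := ltW s0.
rewrite /difference_quotient (psdBl psdI) (psdZl psdI) !(psdBl psdI).
have BT u k : 0 <= u -> inner mu (T u k) h = B u k h.
  by move=> u0; rewrite -(B0 (T u k) h) (semigroup_formT sgB k h (lexx 0) u0) add0r.
rewrite !BT// (semigroup_inner_potential t0 f h s0') inner_potential_op -(B0 f h).
exact: (Rintegral_increments (@cB f h) t0 s0).
Qed.

(** Duality, tested at r itself. Norm estimates thus follow from the scalar functions t |-> <P_t f,
    h>, and vector-valued integrals are avoided. *)
Lemma inner_sqrt_le (r : L2 mu) (K : R) : 0 <= K ->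
  (forall h, `|inner mu r h| <= K * Num.sqrt (inner mu h h)) -> Num.sqrt (inner mu r r) <= K.
Proof.
move=> K0 /(_ r); rewrite ger0_norm ?inner_ge0//.
have := sqrtr_ge0 (inner mu r r); rewrite le_eqVlt => /predU1P[<-//|s0].
by rewrite -[X in X <= _]sqr_sqrtr ?inner_ge0// expr2 ler_pM2r.
Qed.

Lemma difference_quotient_small t (t0 : 0 <= t) f (e : R) : 0 < e -> exists2 eta : R, 0 < eta &
  forall s, 0 < s -> s < eta ->
  Num.sqrt (inner mu (difference_quotient t0 s f) (difference_quotient t0 s f)) <= e.
Proof.
move=> e0; have [eta eta0 H] := semigroup_op_cvg hausdorffX markovZ symP contP f (divr_gt0 e0 (ltr0n R 2)).
exists eta => [//|s s0 se]; apply: inner_sqrt_le; first exact: ltW.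
move=> h; rewrite inner_difference_quotient// normrM gtr0_norm ?invr_gt0//.
rewrite ler_pdivrMl//.
apply: (@le_trans _ _ (e * Num.sqrt (inner mu h h) * (s - 0))); last by rewrite subr0 mulrC.
apply: ler_norm_Rintegral_continuous; [|exact: ltW|].
  exact: (@continuous_increments R (fun u => B u f h) t (@cB f h)).
move=> u /andP[u0 us].
have H1 := semigroup_inner_continuous_bound hausdorffX markovZ symP f h t0 u0.
have := semigroup_inner_continuous_bound hausdorffX markovZ symP f h (lexx 0) u0.
rewrite add0r => H2.
apply: (le_trans (ler_normB _ _)).
rewrite [e]splitr mulrDl; apply: lerD.
  apply: (le_trans H1); rewrite ler_wpM2r ?sqrtr_ge0// H// (le_lt_trans us)//.
apply: (le_trans H2); rewrite ler_wpM2r ?sqrtr_ge0// H// (le_lt_trans us)//.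
Qed.

(** L int_0^t P_s f ds = P_t f - f: this is how every element of the domain used below is
    produced. *)
Lemma generator_potential t (t0 : 0 <= t) f :
  is_generator_value P Z mu (potential_op t0 f) (T t f - f : L2 mu).
Proof.
split; [exact: L2_mem|exact: L2_mem|].
have E s : 0 < s -> (fun x => s^-1 * (semigroup s (potential_op t0 f) x - potential_op t0 f x) - (T t f - f : L2 mu) x)
    = difference_quotient t0 s f.
  move=> s0; apply/funext => x; by rewrite /difference_quotient -(semigroup_opE symP (potential_op t0 f) (ltW s0)).
apply/fine_cvgP; split.
  near=> s; have s0 : 0 < s by near: s; exact: nbhs_right_gt.
  by rewrite (E _ s0) (Lnorm2E (L2_mem _)).
apply/cvgrPdist_le => e e0.
have [eta eta0 H] := difference_quotient_small t0 f e0.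
near=> s; have s0 : 0 < s by near: s; exact: nbhs_right_gt.
rewrite /= (E _ s0) (Lnorm2E (L2_mem _))/= sub0r normrN ger0_norm ?sqrtr_ge0//.
apply: H => //; near: s; exact: nbhs_right_lt.
Unshelve. all: by end_near. Qed.

Lemma generator_value_near (u v : borel X -> R) (uL : u \in Lfun mu 2%:E) (vL : v \in Lfun mu 2%:E) (e : R) :
  is_generator_value P Z mu u v -> 0 < e ->
  \forall s \near 0^'+,
    let D := s^-1 *: (T s (toL2 uL) - toL2 uL) - toL2 vL : L2 mu in
    Num.sqrt (inner mu D D) <= e.
Proof.
move=> [_ _ /fine_cvgP[_ /cvgrPdist_le /(_ e)]] + e0 => /(_ e0).
move=> H; near=> s; have s0 : 0 < s by near: s; exact: nbhs_right_gt.
pose D : L2 mu := s^-1 *: (T s (toL2 uL) - toL2 uL) - toL2 vL.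
suff : Num.sqrt (inner mu D D) <= e by [].
have : `|0 - fine ('N[mu]_2%:E[EFin \o (fun x => s^-1 * (semigroup s u x - u x) - v x)%R])%E| <= e.
  by near: s.
have -> : (fun x => s^-1 * (semigroup s u x - u x) - v x) = D.
  apply/funext => x; by rewrite /D -(semigroup_opE symP (toL2 uL) (ltW s0)).
by rewrite (Lnorm2E (L2_mem _))/= sub0r normrN ger0_norm ?sqrtr_ge0.
Unshelve. all: by end_near. Qed.

Lemma ler_norm_inner f h : `|inner mu f h| <= Num.sqrt (inner mu f f) * Num.sqrt (inner mu h h).
Proof.
rewrite -sqrtrM ?inner_ge0// -sqrtr_sqr ler_wsqrtr//.
exact: (psd_CauchySchwarz psdI).
Qed.

(* [generator] picks one of the a.e. equal values of the limit *)
Lemma inner_generator (u v : borel X -> R) k : is_generator_value P Z mu u v ->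
  inner mu (op (generator P Z mu) u) k = inner mu v k.
Proof.
move=> uv; have [uL vL _] := uv.
have uw : is_generator_value P Z mu u (op (generator P Z mu) u).
  by rewrite /=; case: xgetP => [w _ //|/(_ v)].
move: uw; set w := op _ u => uw; have [_ wL _] := uw.
apply/eqP; rewrite -subr_eq0 -normr_le0; apply/ler_addgt0Pr => e e0; rewrite add0r.
pose N := Num.sqrt (inner mu k k).
have N0 : 0 < N + 1 by rewrite ltr_wpDl// sqrtr_ge0.
have e1 : 0 < e / (N + 1) / 2 by rewrite !divr_gt0.
pose D s z : L2 mu := s^-1 *: (T s (toL2 uL) - toL2 uL) - z.
near (0 : R)^'+ => s.
have -> : inner mu w k - inner mu v k = inner mu (D s (toL2 vL)) k - inner mu (D s (toL2 wL)) k.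
  by rewrite /D !(psdBl psdI)/=; ring.
apply: (le_trans (ler_normB _ _)).
have Hv : Num.sqrt (inner mu (D s (toL2 vL)) (D s (toL2 vL))) <= e / (N + 1) / 2.
  by near: s; exact: (generator_value_near uL vL uv).
have Hw : Num.sqrt (inner mu (D s (toL2 wL)) (D s (toL2 wL))) <= e / (N + 1) / 2.
  by near: s; exact: (generator_value_near uL wL uw).
apply: (@le_trans _ _ (e / (N + 1) * N)).
  rewrite [e / (N + 1)]splitr mulrDl; apply: lerD.
    by apply: (le_trans (ler_norm_inner _ _)); rewrite ler_wpM2r ?sqrtr_ge0.
  by apply: (le_trans (ler_norm_inner _ _)); rewrite ler_wpM2r ?sqrtr_ge0.
by rewrite mulrAC ler_pdivrMr//; apply: ler_wpM2l; [exact: ltW|rewrite lerDl].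
Unshelve. all: by end_near. Qed.

Variable S : L2_operator (borel X) R.
Hypothesis sqrtS : is_sqrt_opp mu (generator P Z mu) S.

Lemma dom_sqrt_Lfun2 (f : borel X -> R) : dom S f ->
  f \in Lfun mu 2%:E /\ op S f \in Lfun mu 2%:E.
Proof. by have [[+ _ _] _ _ _] := sqrtS; apply. Qed.

Lemma inner_sqrt_sym (u k : borel X -> R) : dom S u -> dom S k ->
  inner mu (op S u) k = inner mu u (op S k).
Proof.
move=> Su Sk; have [[_ _ adjS] _ _ _] := sqrtS; have [kL SkL] := dom_sqrt_Lfun2 Sk.
by apply: ((adjS k (op S k) kL SkL).2 _ u Su); split=> //; exact: ae_eq_refl.
Qed.

(** The potential v lies in the domain of the generator, hence of S^2, so one S can be moved: <S v,
    S k> = <S S v, k> = -<L v, k>. *)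
Lemma dirichlet_potential t (t0 : 0 <= t) f k : dom S k ->
  dom S (potential_op t0 f) /\
  dirichlet mu S (potential_op t0 f) k = inner mu f k - B t f k.
Proof.
move=> Sk; have [_ _ domA sqA] := sqrtS.
set v := potential_op t0 f; have gv := generator_potential t0 f.
have Av : dom (generator P Z mu) v by exists (T t f - f : L2 mu).
have [Sv SSv] := (domA v).1 Av; split => //.
rewrite /dirichlet -(inner_sqrt_sym SSv Sk).
have [[_ AvL _] _] : is_generator_value P Z mu v (op (generator P Z mu) v) /\ True.
  by split=> //=; case: xgetP => [w _ //|/(_ (T t f - f : L2 mu))].
have -> : inner mu (op S (op S v)) k = inner mu (fun x => (-1) * op (generator P Z mu) v x + cst 0 x) k.
  have NL : (fun x => (-1) * op (generator P Z mu) v x + cst 0 x) \in Lfun mu 2%:E.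
    rewrite (_ : (fun x => _) = (-1) *: toL2 AvL + 0 :> (borel X -> R)); first exact: L2_mem.
    by [].
  apply: inner_ae; [exact: (Lfun2_measurable (dom_sqrt_Lfun2 SSv).2)|exact: (Lfun2_measurable NL)
    |exact: (Lfun2_measurable (L2_mem k))|].
  by apply: filterS (sqA v Av) => x; rewrite mulN1r addr0; apply.
rewrite (inner_linl AvL (Lfun_cst mu 0 2) (L2_mem k) (-1)).
rewrite (inner_generator k gv) (psdBl psdI) -B0 (semigroup_formT sgB f k (lexx 0) t0) add0r.
have -> : inner mu (cst 0) k = 0 by exact: (psd0l psdI).
by rewrite addr0; ring.
Qed.

(** Let v be the potential of k and x = <k - P_t k, k> = E(v, k). By convexity of t |-> <P_t k, k>,
    E(v, v) = int_0^t (<P_u k, k> - <P_(u+t) k, k>) du <= t x. Hence x^2 <= E(v, v) E(k, k) <= t x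
    E(k, k). *)
Lemma discrete_dirichlet_le t k : 0 <= t -> dom S k ->
  inner mu k k - B t k k <= t * dirichlet mu S k k.
Proof.
move=> t0 Sk; have [Sv Ek] := dirichlet_potential t0 k Sk.
have [_ Ev] := dirichlet_potential t0 k Sv.
set v := potential_op t0 k in Sv Ek Ev.
have [_ SkL] := dom_sqrt_Lfun2 Sk; have [_ SvL] := dom_sqrt_Lfun2 Sv.
have CS := psd_CauchySchwarz psdI (toL2 SvL) (toL2 SkL).
rewrite /= -/(dirichlet mu S v k) -/(dirichlet mu S v v) -/(dirichlet mu S k k) Ek Ev in CS.
have Evv : inner mu k v - B t k v <= t * (inner mu k k - B t k k).
  have [_ Bsym _ _ _] := sgB.
  rewrite (psd_sym psdI) (Bsym t k v t0) (semigroup_inner_potential t0 k k t0) inner_potential_op.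
  have cBt : continuous (fun u => B (u + t) k k).
    move=> u; apply: (@continuous_comp _ _ _ (fun u : R => u + t) (fun u => B u k k)); last exact: cB.
    by apply: cvgD; [exact: cvg_id|exact: cvg_cst].
  rewrite -(RintegralB_continuous 0 t (@cB k k) cBt) mulrC -[X in _ <= _ * X](subr0 t).
  rewrite -(Rintegral_itv_cst (inner mu k k - B t k k) t0); apply: le_Rintegral_continuous.
  - by move=> u; apply: cvgB; [exact: cB|exact: cBt].
  - by move=> u; exact: cvg_cst.
  - move=> u /andP[u0 _]; rewrite -(B0 k k).
    exact: (semigroup_form_gap_le sgB k u0 t0).
have X0 : 0 <= inner mu k k - B t k k.
  by have := psd_ge0 (psd_semigroup_form_gap sgB t0) k; rewrite /= B0.
have D0 : 0 <= dirichlet mu S k k by exact: inner_ge0.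
move: CS Evv X0 D0; move: (inner mu k k - B t k k) (inner mu k v - B t k v) (dirichlet mu S k k) => x y z CS yx.
rewrite le_eqVlt => /predU1P[<- z0|x0 z0]; first exact: mulr_ge0.
rewrite -(ler_pM2l x0) -expr2 (le_trans CS)//.
by apply: (@le_trans _ _ (t * x * z)); [exact: ler_wpM2r|rewrite mulrCA mulrA].
Qed.

Variable c : R.
Hypotheses (c0 : 0 <= c) (poincare_c : poincare mu S c).

Local Notation one_L2 := (one_L2 mu).

Lemma semigroup_op_one t : 0 <= t -> T t one_L2 = one_L2.
Proof.
move=> t0; apply/val_inj.
exact: (etrans (semigroup_opE symP one_L2 t0) (semigroup_cst P Z t 1)).
Qed.

Lemma semigroup_inner_one t f : 0 <= t -> B t f one_L2 = inner mu f one_L2.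
Proof.
move=> t0; rewrite -(B0 f one_L2) -[in RHS](semigroup_op_one t0).
by rewrite (semigroup_formTr sgB f one_L2 (lexx 0) t0) add0r.
Qed.

(** Apply the Poincare inequality to the centered potential v: |v|^2 <= c E(v, v) = c <f - P_t f,
    v>. Since |f - P_t f| <= |f|, this gives |v| <= c |f|, and the integral is <v, f>. *)
Lemma integral_semigroup_inner_le t f : 0 <= t -> inner mu f one_L2 = 0 ->
  \int[leb]_(s in `[0, t]) B s f f <= c * inner mu f f.
Proof.
move=> t0 f1.
(* Any element of the domain will do: it only serves to extract [dom S v] from
   [dirichlet_potential]. Density supplies one. *)
have [k Sk] : exists k : borel X -> R, dom S k.
  by have [[_ /(_ (cst 0) (Lfun_cst mu 0 2) 1 ltr01) [k Sk _] _] _ _ _] := sqrtS; exists k.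
have kL := (dom_sqrt_Lfun2 Sk).1.
have [Sv _] := @dirichlet_potential t t0 f (toL2 kL) Sk.
have [_ Ev] := dirichlet_potential t0 f Sv.
set v := potential_op t0 f in Sv Ev.
have v1 : inner mu v one_L2 = 0.
  rewrite inner_potential_op.
  rewrite (_ : \int[leb]_(s in `[0, t]) B s f one_L2 = \int[leb]_(s in `[0, t]) 0).
    by rewrite Rintegral_itv_cst// mul0r.
  by apply: eq_Rintegral => s /set_mem/=; rewrite in_itv/= => /andP[s0 _]; rewrite semigroup_inner_one.
have Pv := poincare_c Sv; rewrite variance_L2 v1 expr0n subr0 lee_fin Ev in Pv.
pose w : L2 mu := f - T t f.
have BT k' : inner mu (T t f) k' = B t f k'.
  by rewrite -(B0 (T t f) k') (semigroup_formT sgB f k' (lexx 0) t0) add0r.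
have wv : inner mu w v = inner mu f v - B t f v.
  by rewrite (psdBl psdI f (T t f) v) BT.
have ww : inner mu w w <= inner mu f f.
  have BTr : inner mu f (T t f) = B t f f by rewrite (psd_sym psdI) BT.
  rewrite (psdBl psdI) !(psdBr psdI) BTr !BT (semigroup_formTr sgB f f t0 t0).
  have tt : t <= t + t by rewrite lerDl.
  have := semigroup_form_nonincreasing sgB f t0 tt.
  have := semigroup_form_ge0 sgB f t0.
  by move: (B t f f) (B (t + t) f f) (inner mu f f) => x y z; lra.
have CS1 := psd_CauchySchwarz psdI w v.
have CS2 := psd_CauchySchwarz psdI v f.
rewrite inner_potential_op in CS2.
rewrite /= wv in CS1.
have vv0 := psd_ge0 psdI v; have ff0 := psd_ge0 psdI f; have ww0 := psd_ge0 psdI w.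
move: Pv CS1 CS2 ww vv0 ff0 ww0 => /=.
move: (inner mu v v) (inner mu f f) (inner mu w w) (inner mu f v - B t f v) (\int[leb]_(s in _) _).
move=> N F D Y J NY YD JN DF N0 F0 D0.
have NF : N <= c ^+ 2 * F.
  move: N0; rewrite le_eqVlt => /predU1P[<-|N0]; first by rewrite mulr_ge0// sqr_ge0.
  rewrite -(ler_pM2r N0) -expr2.
  apply: (@le_trans _ _ ((c * Y) ^+ 2)); first by rewrite ler_sqr ?nnegrE ?(ltW N0)// (le_trans (ltW N0)).
  rewrite exprMn -[leRHS]mulrA ler_wpM2l ?sqr_ge0// (le_trans YD)//.
  by apply: ler_wpM2r => //; exact: ltW.
rewrite leNgt; apply/negP => cJ.
have cF0 : 0 <= c * F by exact: mulr_ge0.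
have : (c * F) ^+ 2 < J ^+ 2 by rewrite ltr_pXn2r// nnegrE// ltW// (le_lt_trans cF0).
rewrite ltNge => /negP; apply; apply: (le_trans JN).
rewrite exprMn [F ^+ 2]expr2 mulrA; exact: ler_wpM2r.
Qed.

Lemma discrete_potential_le (delta : R) n f : 0 < delta -> inner mu f one_L2 = 0 ->
  delta * \sum_(k < n) B (k.+1%:R * delta) f f <= c * B 0 f f.
Proof.
move=> d0 f1; rewrite B0.
have nd : 0 <= n%:R * delta by rewrite mulr_ge0// ltW.
apply: le_trans (integral_semigroup_inner_le nd f1).
apply: (@lower_Riemann_sum_le R (fun s => B s f f) delta n (@cB f f) d0).
by move=> s t s0 st; exact: (semigroup_form_nonincreasing sgB).
Qed.

End dirichlet_form.

(** * Asymptotic variance *)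

Section stationary_variance.
Context (R : realType).
Local Notation leb := (@lebesgue_measure R).
Variables (b : R -> R) (K : R).
Hypotheses (cb : continuous b) (b0 : forall s, 0 <= s -> 0 <= b s).
Hypothesis bK : forall t, 0 <= t -> \int[leb]_(s in `[0, t]) b s <= K.

(** The integrated covariance, extended by 0 to negative times so as to be continuous on R. *)
Let Psi t := \int[leb]_(s in `[0, Num.max t 0]) b s.

Let max0 (t : R) : 0 <= Num.max t 0. Proof. by rewrite le_max lexx orbT. Qed.

Let maxE (t : R) : 0 <= t -> Num.max t 0 = t. Proof. by move=> /max_idPl. Qed.

Let cst_cont (c : R) : continuous (fun _ : R => c). Proof. by move=> x; exact: cvg_cst. Qed.

Let Psi_itv s t : 0 <= s -> s <= t -> Psi t - Psi s = \int[leb]_(u in `[s, t]) b u.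
Proof.
move=> s0 st; have t0 := le_trans s0 st.
by rewrite /Psi !maxE// (Rintegral_itv_cat cb s0 st) addrAC subrr add0r.
Qed.

Let Psi_nd s t : s <= t -> Psi s <= Psi t.
Proof.
move=> st; rewrite -subr_ge0.
have Pm u : Psi u = Psi (Num.max u 0) by rewrite /Psi (maxE (max0 u)).
rewrite (Pm t) (Pm s) Psi_itv//; last by rewrite ge_max !le_max st lexx !orbT.
apply: Rintegral_ge0 => u; rewrite /= in_itv/= => /andP[su _]; apply: b0.
exact: le_trans su.
Qed.

Let Psi_ge0 t : 0 <= Psi t.
Proof. by apply: Rintegral_ge0 => u; rewrite /= in_itv/= => /andP[u0 _]; exact: b0. Qed.

Let Psi_cont : continuous Psi.
Proof.
move=> t; pose M := Num.max t 0 + 1.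
have M0 : 0 < M by rewrite ltr_wpDl.
have [N N0 bN] : exists2 N, 0 < N & forall u, 0 <= u <= M -> `|b u| <= N.
  have := @continuous_compact _ _ b `[0, M]%classic (continuous_subspaceT cb) (@segment_compact R 0 M).
  move=> /compact_bounded[N [_ HN]].
  exists (Num.max N 0 + 1); first by rewrite ltr_wpDl.
  move=> u u01; apply: (HN (Num.max N 0 + 1)); first by rewrite (@le_lt_trans _ _ (Num.max N 0)) ?ltrDl// le_max lexx.
  by exists u => //=; rewrite in_itv.
apply/cvgrPdist_le => e e0.
have Pm u : Psi u = Psi (Num.max u 0) by rewrite /Psi (maxE (max0 u)).
have lip s u : 0 <= s -> s <= u -> u <= M -> `|Psi u - Psi s| <= N * (u - s).
  move=> s0 su uM; rewrite Psi_itv//; apply: ler_norm_Rintegral_continuous => // v /andP[sv vu].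
  by apply: bN; rewrite (le_trans s0 sv) (le_trans vu uM).
near=> s.
have ts : `|t - s| <= Num.min 1 (e / N).
  by near: s; apply: cvgr_dist_le; rewrite ?lt_min ?ltr01 ?divr_gt0//; exact: cvg_id.
move: ts; rewrite le_min => /andP[ts1 tse].
have sM : Num.max s 0 <= M.
  have := ler_dist_max0 s t => /le_trans /(_ ts1).
  by rewrite ler_norml /M => /andP[]; lra.
have tM : Num.max t 0 <= M by rewrite lerDl.
rewrite (Pm t) (Pm s).
have key : N * `|Num.max t 0 - Num.max s 0| <= e.
  rewrite -ler_pdivlMl// mulrC (le_trans _ tse)//; exact: ler_dist_max0.
have [st|/ltW st] := leP (Num.max s 0) (Num.max t 0).
  by apply: (le_trans (lip _ _ _ st _)) => //; move: key; rewrite ger0_norm ?subr_ge0.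
rewrite distrC; apply: (le_trans (lip _ _ _ st _)) => //.
by move: key; rewrite distrC ger0_norm ?subr_ge0.
Unshelve. all: by end_near. Qed.

Lemma integral_dist s t : 0 <= s <= t ->
  \int[leb]_(u in `[0, t]) b `|s - u| = Psi s + Psi (t - s).
Proof.
move=> /andP[s0 st]; have ts0 : 0 <= t - s by rewrite subr_ge0.
have mb : measurable_fun [set: R] b by exact: continuous_measurable_fun.
have cabs : continuous (fun u => b `|s - u|).
  move=> u; apply: (@continuous_comp _ _ _ (fun u => `|s - u|) b); last exact: cb.
  apply: (@continuous_comp _ _ _ (fun u => s - u) Num.norm); last exact: norm_continuous.
  by apply: cvgB; [exact: cvg_cst|exact: cvg_id].
rewrite (Rintegral_itv_cat cabs s0 st); congr (_ + _).
  transitivity (\int[leb]_(u in `[0, s]) b (s - u)).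
    apply: eq_Rintegral => u /set_mem/=; rewrite in_itv/= => /andP[_ us].
    by rewrite ger0_norm// subr_ge0.
  by rewrite (Rintegral_reflect 0 s s mb) subrr subr0 /Psi maxE.
transitivity (\int[leb]_(u in `[s, t]) b (u + (- s))).
  apply: eq_Rintegral => u /set_mem/=; rewrite in_itv/= => /andP[us _].
  by rewrite distrC ger0_norm// subr_ge0.
by rewrite (Rintegral_shift s t (- s) mb) subrr /Psi maxE.
Qed.

Lemma integral_integral_dist t : 0 <= t ->
  \int[leb]_(s in `[0, t]) \int[leb]_(u in `[0, t]) b `|s - u| =
  2 * \int[leb]_(s in `[0, t]) Psi s.
Proof.
move=> t0.
have mPsi : measurable_fun [set: R] Psi by exact: continuous_measurable_fun.
have crefl : continuous (fun s => Psi (t - s)).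
  move=> u; apply: (@continuous_comp _ _ _ (fun s => t - s) Psi); last exact: Psi_cont.
  by apply: cvgB; [exact: cvg_cst|exact: cvg_id].
transitivity (\int[leb]_(s in `[0, t]) (Psi s + Psi (t - s))).
  apply: eq_Rintegral => s /set_mem/=; rewrite in_itv/= => st; exact: integral_dist.
rewrite (RintegralD_continuous 0 t Psi_cont crefl).
by rewrite (Rintegral_reflect 0 t t mPsi) subrr subr0 -mulr2n mulr_natl.
Qed.

(** The double integral is 2 int_0^t Psi, and the Cesaro means of the nondecreasing bounded function
    Psi tend to its supremum. The limit is recorded only through the bounds at finite times, which
    is how it is used. *)
Lemma stationary_variance_cvg : exists2 L : R,
  (t^-1 * \int[leb]_(s in `[0, t]) \int[leb]_(u in `[0, t]) b `|s - u|) @[t --> +oo] --> L &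
  forall t, 0 <= t -> 2 * \int[leb]_(s in `[0, t]) b s <= L.
Proof.
pose A := range Psi.
have hsA : has_sup A by split; [exists (Psi 0); exists 0|exists K => _ [t _ <-]; exact: bK].
have PS t : Psi t <= sup A by apply: ub_le_sup; [exact: hsA.2|exists t].
exists (2 * sup A); last first.
  by move=> t t0; rewrite ler_pM2l//; have := PS t; rewrite /Psi maxE.
apply/cvgrPdist_le => e e0.
have e4 : 0 < e / 4 by rewrite divr_gt0.
(* Past T, Psi is within e / 4 of its supremum; the segment [0, T] costs at most T * sup A, below t
   e / 4 for large t. *)
have [_ [T0 _ <-] HT0] := sup_adherent e4 hsA.
pose T := Num.max T0 0.
have HT : sup A - e / 4 < Psi T by rewrite /T /Psi (maxE (max0 T0)).
have S0 : 0 <= sup A := le_trans (Psi_ge0 0) (PS 0).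
near=> t.
have t0 : 0 < t by near: t; exact: nbhs_pinfty_gt.
have tT : T <= t by near: t; apply: nbhs_pinfty_ge; exact: num_real.
have tb : 4 * T * sup A / e <= t by near: t; apply: nbhs_pinfty_ge; exact: num_real.
rewrite integral_integral_dist ?(ltW t0)//.
set J := Rintegral _ _ _.
have Jup : J <= sup A * t.
  rewrite -[X in _ * X](subr0 t) -(Rintegral_itv_cst _ (ltW t0)).
  by apply: le_Rintegral_continuous => // s _; exact: PS.
have Jlow : Psi T * (t - T) <= J.
  rewrite /J (Rintegral_itv_cat Psi_cont (max0 T0) tT) -[leLHS]add0r lerD//.
    by apply: Rintegral_ge0 => s _; exact: Psi_ge0.
  rewrite -(Rintegral_itv_cst _ tT); apply: le_Rintegral_continuous => // s /andP[Ts _].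
  exact: Psi_nd.
have T00 : 0 <= T := max0 T0.
have tb' : 4 * T * sup A <= t * e by rewrite -ler_pdivrMr.
have PT := PS T; have PT0 := Psi_ge0 T.
have Jt : 2 * sup A * t - e * t <= 2 * J by nra.
rewrite ger0_norm.
  by rewrite lerBlDr -lerBlDl ler_pdivlMl//; lra.
by rewrite subr_ge0 ler_pdivrMl//; lra.
Unshelve. all: by end_near. Qed.

End stationary_variance.

Lemma integral_mixture d d' (T : measurableType d) (Omega : measurableType d') (R : realType)
    (P : R.-pker T ~> Omega) (beta : probability T R) (F : Omega -> \bar R) :
  nonneg_measurable F ->
  (\int[mixture P beta]_w F w = \int[beta]_x \int[P x]_w F w)%E.
Proof.
pose I (F : Omega -> \bar R) := (\int[mixture P beta]_w F w)%E.
pose J (F : Omega -> \bar R) := (\int[beta]_x \int[P x]_w F w)%E.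
have il (m : {measure set Omega -> \bar R}) : integral_like (fun F : Omega -> \bar R => \int[m]_w F w)%E.
  apply: (@integral_like_integral1 _ Omega R _ Omega m setT (fun w (F : Omega -> \bar R) => F w) measurableT).
    by move=> w; exact: integral_like_eval.
  by move=> f [].
apply: (@integral_like_ext _ Omega R I J).
- exact: il.
- apply: (@integral_like_integral1 _ Omega R _ T beta setT
    (fun x (F : Omega -> \bar R) => \int[P x]_w F w)%E measurableT).
    by move=> x; exact: il.
  move=> f [mf f0]; apply: measurable_fun_integral_kernel => //.
  by move=> U mU; exact: measurable_kernel.
- move=> A mA; rewrite /I /J integral_indic// setIT.
  by apply: eq_integral => x _; rewrite integral_indic// setIT.
Qed.

(** * Covariances of the stationary process *)

Section time_integral_variance.
Context (R : realType) (X : completePseudoMetricType R).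
Context d (Omega : measurableType d).
Variables (P : R.-pker (borel X) ~> Omega) (Z : R -> Omega -> X).
Variable mu : probability (borel X) R.
Hypothesis hausdorffX : hausdorff_space X.
Hypothesis markovZ : cadlag_markov_process P Z.
Hypothesis symP : symmetric_semigroup P Z mu.
Local Notation semigroup := (semigroup P Z).
Local Notation B := (semigroup_inner P Z (mu := mu)).
Local Notation Q := (mixture P mu).
Local Notation one := (one_L2 mu).

Let sgB := semigroup_formP hausdorffX markovZ symP.

Lemma integral_stationary t (k : borel X -> R) : 0 <= t -> bounded_nonneg k ->
  (\int[Q]_w (k (Z t w))%:E = \int[mu]_x (k x)%:E)%E.
Proof.
move=> t0 [mk [C kC]].
have nk : nonneg_measurable (fun x => (k x)%:E : \bar R).
  by split; [exact/measurable_EFinP|move=> x; rewrite lee_fin; have /andP[] := kC x].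
rewrite integral_mixture ?(integral_semigroup markovZ symP t0 nk)//.
split; last by move=> w; rewrite lee_fin; have /andP[] := kC (Z t w).
by apply: (emeasurable_process_comp markovZ t0 (f := EFin \o k)); have [] := nk.
Qed.

Lemma integral_stationary2 s t (k : borel X -> R) : 0 <= s -> 0 <= t -> bounded_nonneg k ->
  (\int[Q]_w (k (Z s w) * k (Z (s + t) w))%:E = \int[mu]_x (k x * semigroup t k x)%:E)%E.
Proof.
move=> s0 t0 bk; have [mk [C kC]] := bk.
have [mPk [C' PkC]] := semigroup_bounded_nonneg markovZ t0 bk.
have k0 x : 0 <= k x by have /andP[] := kC x.
have Pk0 x : 0 <= semigroup t k x by have /andP[] := PkC x.
have bkk : bounded_nonneg (fun x => k x * semigroup t k x).
  split; first exact: measurable_funM.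
  exists (C * C') => x; have /andP[? ?] := kC x; have /andP[? ?] := PkC x.
  by rewrite mulr_ge0//= ler_pM.
have mkZ u : 0 <= u -> measurable_fun [set: Omega] (fun w => k (Z u w)).
  by move=> u0; exact: (measurable_process_comp markovZ u0 mk).
rewrite -(integral_stationary s0 bkk) !integral_mixture.
- apply: eq_integral => x _.
  apply: (markov_fun markovZ x s0 t0 (Y := fun w => k (Z s w))) => //.
  by apply: measurable_past_process => //; rewrite s0 lexx.
- split; last by move=> w; rewrite lee_fin mulr_ge0.
  apply/measurable_EFinP.
  by apply: (measurable_process_comp markovZ s0 (f := fun x => k x * semigroup t k x)); have [] := bkk.
- split; last by move=> w; rewrite lee_fin mulr_ge0.
  by apply/measurable_EFinP/measurable_funM; apply: mkZ => //; rewrite addr_ge0.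
Qed.

Variables (g : borel X -> R) (C : R).
Hypotheses (mg : measurable_fun [set: borel X] g) (gC : forall x, `|g x| <= C).

Definition bounded_L2 : L2 mu := toL2 (bounded_Lfun2 mu mg gC).

Local Notation gL := bounded_L2.

Hypothesis g0 : inner mu gL one = 0.

Lemma measurable_gZ t : 0 <= t -> measurable_fun [set: Omega] (fun w => g (Z t w)).
Proof. by move=> t0; exact: (measurable_process_comp markovZ t0 mg). Qed.

Definition gZ t (t0 : 0 <= t) : L2 Q := toL2 (bounded_Lfun2 Q (measurable_gZ t0) (fun w => gC (Z t w))).

Local Notation oneQ := (one_L2 Q).

Let one1 : inner mu one one = 1.
Proof. by rewrite /inner/= Rintegral_cst// mulr1 mul1r [X in fine X](probability_setT mu). Qed.

Let oneQ1 : inner Q oneQ oneQ = 1.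
Proof. by rewrite /inner/= Rintegral_cst// mulr1 mul1r [X in fine X](probability_setT Q). Qed.

(** The Markov property was extended to nonnegative functions, so covariances are computed for C +
    g; bilinearity and mu(g) = 0 then remove C. *)
Let gp : borel X -> R := fun x => C + g x.

Let bgp : bounded_nonneg gp.
Proof.
split; first by apply: measurable_funD => //; exact: measurable_cst.
exists (C + C) => x; rewrite /gp; have := gC x; rewrite ler_norml => /andP[? ?].
by apply/andP; split; lra.
Qed.

Let inner_gp_one : inner mu gp one = C.
Proof.
have -> : inner mu gp one = inner mu (C *: one + gL : L2 mu) one.
  by congr (inner mu _ one); apply/funext => x; rewrite /gp/= -[in LHS](mulr1 C).
by rewrite (psd_linl (psd_inner mu)) one1 mulr1 g0 addr0.
Qed.

Let psdQ := psd_inner Q.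

Lemma inner_gZ_one t (t0 : 0 <= t) : inner Q (gZ t0) oneQ = 0.
Proof.
have : inner Q (C *: oneQ + gZ t0 : L2 Q) oneQ = C.
  rewrite -[RHS]inner_gp_one /inner /Rintegral; congr fine.
  transitivity (\int[Q]_w (gp (Z t w))%:E)%E.
    by apply: eq_integral => w _; rewrite /gp/= mulr1 -[in RHS](mulr1 C).
  rewrite (integral_stationary t0 bgp); apply: eq_integral => x _; rewrite /= mulr1//.
by rewrite (psd_linl psdQ) oneQ1 mulr1; move: (inner _ _ _) => y; lra.
Qed.

Lemma inner_gZ s t (s0 : 0 <= s) (st0 : 0 <= s + t) : 0 <= t ->
  inner Q (gZ s0) (gZ st0) = B t gL gL.
Proof.
move=> t0.
have : inner Q (C *: oneQ + gZ s0 : L2 Q) (C *: oneQ + gZ st0 : L2 Q) =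
    B t (C *: one + gL) (C *: one + gL).
  have gpE : gp = (C *: one + gL : L2 mu).
    by apply/funext => x; rewrite /gp/= -[in LHS](mulr1 C).
  rewrite (semigroup_innerE _ _ _ _ t0) -gpE [RHS]inner_sym /inner /Rintegral; congr fine.
  rewrite -(integral_stationary2 s0 t0 bgp); apply: eq_integral => w _.
  by rewrite /gp/= -[in RHS](mulr1 C).
rewrite (psd_linl psdQ) !(psd_linr psdQ) oneQ1 (psd_sym psdQ oneQ) !inner_gZ_one.
have psdB := psd_semigroup_form sgB t0.
rewrite (psd_linl psdB) !(psd_linr psdB) (psd_sym psdB one).
rewrite !(semigroup_inner_one hausdorffX markovZ symP _ t0) one1 g0.
lra.
Qed.

End time_integral_variance.

Section bounded_integrals.
Context (R : realType).
Local Notation leb := (@lebesgue_measure R).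

Lemma bounded_integrable_itv (b : R -> R) (a c k : R) : measurable_fun [set: R] b ->
  (forall s, `|b s| <= k) -> leb.-integrable `[a, c] (EFin \o b).
Proof.
move=> mb bk; apply: measurable_bounded_integrable => //.
- by apply: compact_finite_measure; exact: segment_compact.
- exact: measurable_funTS.
- by exists k; split; rewrite ?num_real// => M kM s _; apply: (le_trans (bk s)); exact: ltW.
Qed.

Lemma ler_norm_Rintegral_bounded (b : R -> R) (a c k : R) : measurable_fun [set: R] b ->
  a <= c -> (forall s, `|b s| <= k) -> `|\int[leb]_(s in `[a, c]) b s| <= k * (c - a).
Proof.
move=> mb ac bk; have ib := bounded_integrable_itv a c mb bk.
rewrite -(Rintegral_itv_cst _ ac); apply: (le_trans (le_normr_Rintegral _ ib)) => //.
apply: le_Rintegral => //.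
- apply: (@bounded_integrable_itv _ a c k); first exact: measurableT_comp.
  by move=> s; rewrite normr_id.
- by apply: (@bounded_integrable_itv _ a c `|k|); first exact: measurable_cst.
Qed.

End bounded_integrals.

Section asymptotic_variance.
Context (R : realType) (X : completePseudoMetricType R).
Context d (Omega : measurableType d).
Variables (P : R.-pker (borel X) ~> Omega) (Z : R -> Omega -> X).
Variable mu : probability (borel X) R.
Hypothesis hausdorffX : hausdorff_space X.
Hypothesis markovZ : cadlag_markov_process P Z.
Hypothesis symP : symmetric_semigroup P Z mu.
Hypothesis contP : strongly_continuous_semigroup P Z mu.
Local Notation leb := (@lebesgue_measure R).
Local Notation B := (semigroup_inner P Z (mu := mu)).
Local Notation Q := (mixture P mu).
Local Notation one := (one_L2 mu).

Variables (g : borel X -> R) (C : R).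
Hypotheses (mg : measurable_fun [set: borel X] g) (gC : forall x, `|g x| <= C).
Local Notation gL := (bounded_L2 mu mg gC).

Let max0 (t : R) : 0 <= Num.max t 0. Proof. by rewrite le_max lexx orbT. Qed.

Let maxE (t : R) : 0 <= t -> Num.max t 0 = t. Proof. by move=> /max_idPl. Qed.

Let mg2 := measurable_process2 markovZ mg.

Lemma measurable_path w : measurable_fun [set: R] (fun s => g (Z (Num.max s 0) w)).
Proof.
apply: (measurableT_comp (g := fun s : measurableTypeR R => (s, w)) mg2).
by apply/measurable_fun_pair => //=; exact: measurable_cst.
Qed.

Lemma time_integralE t w :
  time_integral Z g t w = \int[leb]_(s in `[0, t]) g (Z (Num.max s 0) w).
Proof.
by apply: eq_Rintegral => s /set_mem/=; rewrite in_itv/= => /andP[s0 _]; rewrite maxE.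
Qed.

Lemma ler_norm_time_integral t w : 0 <= t -> `|time_integral Z g t w| <= C * t.
Proof.
move=> t0; rewrite time_integralE -[t in _ * t]subr0.
exact: ler_norm_Rintegral_bounded (measurable_path w) t0 _.
Qed.

(** Fubini's theorem against a bounded test variable. With h equal to 1, to the time integral itself
    and to g(Z_s), it yields in turn the mean, the variance and the covariances. *)
Lemma Rintegral_time_integral_mul t (h : Omega -> R) (H : R) (beta : probability (borel X) R) :
  0 <= t -> measurable_fun [set: Omega] h -> (forall w, `|h w| <= H) ->
  measurable_fun [set: Omega] (time_integral Z g t) /\
  inner (mixture P beta) (time_integral Z g t) h =
  \int[leb]_(s in `[0, t]) inner (mixture P beta) (fun w => g (Z (Num.max s 0) w)) h.
Proof.
move=> t0 mh hH.
have H0 : 0 <= H by apply: le_trans (hH point).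
have bnd (k : Omega -> R) (K : R) (mk : measurable_fun [set: Omega] k) (kK : forall w, `|k w| <= K) :
   (\int[leb]_(s in `[0%R, t]) \int[mixture P beta]_w `|g (Z (Num.max s 0) w) * k w|%:E < +oo)%E.
  have K0 : 0 <= K by apply: le_trans (kK point).
  have mF : measurable_fun [set: measurableTypeR R * Omega] (fun p => `|g (Z (Num.max p.1 0) p.2) * k p.2|%:E).
    apply/measurable_EFinP; apply: measurableT_comp => //; apply: measurable_funM => //.
    exact: (measurableT_comp mk).
  apply: (@le_lt_trans _ _ (\int[leb]_(s in `[0%R, t]) (C * K)%:E)%E).
    apply: ge0_le_integral => //.
    - by move=> s _; apply: integral_ge0 => w _; rewrite lee_fin.
    - apply: measurable_funTS.
      by have [|_ + _] := @ge0_Fubini_itv _ _ _ (mixture P beta) 0 t _ mF.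
    - move=> s _; rewrite -[leRHS](integral_cst_probability (mixture P beta)).
      apply: ge0_le_integral => //.
      + apply/measurable_EFinP; apply: measurableT_comp => //; apply: measurable_funM => //.
        exact: (measurable_gZ markovZ mg (max0 s)).
      + by move=> w _; rewrite lee_fin normrM ler_pM.
  by rewrite integral_cst//= [X in (_ * X)%E](lebesgue_measure_segment t0) -EFinM ltry.
have cst1 : forall w : Omega, `|cst 1 w : R| <= 1 by move=> w; rewrite /= normr1.
have [|_ mA _] := @Rintegral_Fubini_itv _ _ _ (mixture P beta) 0 t _ mg2.
  have := bnd (cst 1) 1 (measurable_cst _) cst1.
  by under eq_integral do (under eq_integral do rewrite mulr1).
have mA' : measurable_fun [set: Omega] (time_integral Z g t).
  by rewrite (_ : time_integral Z g t = (fun y => \int[leb]_(s in `[0, t]) g (Z (Num.max s 0) y)))//;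
    apply/funext => w; exact: time_integralE.
split => //.
have mF2 : measurable_fun [set: measurableTypeR R * Omega] (fun p => g (Z (Num.max p.1 0) p.2) * h p.2).
  by apply: measurable_funM => //; exact: (measurableT_comp mh).
have [|_ _ E] := @Rintegral_Fubini_itv _ _ _ (mixture P beta) 0 t _ mF2; first exact: (bnd h H mh hH).
rewrite /inner -E; apply: eq_Rintegral => w _.
rewrite time_integralE/= RintegralZr//.
exact: (bounded_integrable_itv 0 t (measurable_path w) (fun s => gC _)).
Qed.

Lemma measurable_time_integral t : 0 <= t -> measurable_fun [set: Omega] (time_integral Z g t).
Proof.
move=> t0; have [w|//] := @Rintegral_time_integral_mul t (cst 1) 1 mu t0 (measurable_cst _).
by rewrite normr1.
Qed.

Hypothesis g0 : inner mu gL one = 0.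

Lemma inner_stationary s u : 0 <= s -> 0 <= u ->
  inner Q (fun w => g (Z s w)) (fun w => g (Z u w)) = B `|s - u| gL gL.
Proof.
have wl v y : 0 <= v -> v <= y ->
    inner Q (fun w => g (Z v w)) (fun w => g (Z y w)) = B (y - v) gL gL.
  move=> v0 vy; have y0 : 0 <= v + (y - v) by rewrite subrKC (le_trans v0).
  have yv : 0 <= y - v by rewrite subr_ge0.
  have := inner_gZ hausdorffX markovZ symP g0 v0 y0 yv.
  by rewrite /= subrKC.
move=> s0 u0; have [su|/ltW us] := leP s u.
  by rewrite distrC ger0_norm ?subr_ge0// wl.
by rewrite ger0_norm ?subr_ge0// inner_sym wl.
Qed.

Lemma variance_time_integral t : 0 <= t ->
  ('V_Q[time_integral Z g t] =
    (\int[leb]_(s in `[0, t]) \int[leb]_(u in `[0, t]) B `|s - u| gL gL)%:E)%E.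
Proof.
move=> t0; have mA := measurable_time_integral t0.
have AC w : `|time_integral Z g t w| <= C * t by exact: ler_norm_time_integral.
have AL := bounded_Lfun2 Q mA AC.
rewrite (variance_L2 (toL2 AL)) /=.
have in01 s : s \in `[0, t]%classic -> Num.max s 0 = s.
  by move=> /set_mem/=; rewrite in_itv/= => /andP[s0 _]; rewrite maxE.
have -> : inner Q (time_integral Z g t) (cst 1) = 0.
  have [|w|_ ->] := @Rintegral_time_integral_mul t (cst 1) 1 mu t0; first exact: measurable_cst.
    by rewrite normr1.
  transitivity (\int[leb]_(s in `[0, t]) (0 : R)); last by rewrite Rintegral_itv_cst// mul0r.
  by apply: eq_Rintegral => s _; exact: (inner_gZ_one markovZ symP g0 (max0 s)).
rewrite expr0n subr0; congr EFin.
have [//|//|_ ->] := @Rintegral_time_integral_mul t (time_integral Z g t) (C * t) mu t0.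
apply: eq_Rintegral => s /in01 sE; have s0 := max0 s; rewrite sE in s0.
rewrite sE inner_sym.
have [//|w|_ ->] := @Rintegral_time_integral_mul t (fun w => g (Z s w)) C mu t0.
- exact: (measurable_gZ markovZ mg s0).
- exact: gC.
apply: eq_Rintegral => u /in01 uE; have u0 := max0 u; rewrite uE in u0.
by rewrite uE (inner_stationary u0 s0) distrC.
Qed.

(** [asymptotic_variance] is a [lim], which carries information only once convergence is known; the
    a priori bound K provides it. *)
Lemma asymptotic_variance_ge (K : R) :
  (forall t, 0 <= t -> \int[leb]_(s in `[0, t]) B s gL gL <= K) ->
  forall t, 0 <= t -> 2 * \int[leb]_(s in `[0, t]) B s gL gL <= asymptotic_variance P Z mu g.
Proof.
move=> BK.
have sgB := semigroup_formP hausdorffX markovZ symP.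
have cB := @continuous_semigroup_inner _ _ _ _ _ _ _ hausdorffX markovZ symP contP gL gL.
have B0 s : 0 <= s -> 0 <= B s gL gL by exact: (semigroup_form_ge0 sgB).
have [L cL LB] := stationary_variance_cvg cB B0 BK.
suff -> : asymptotic_variance P Z mu g = L by [].
apply/cvg_lim => //; apply: cvg_trans cL; apply: near_eq_cvg.
near=> t; rewrite variance_time_integral//.
Unshelve. all: by end_near. Qed.

End asymptotic_variance.

(** * Transportation-information inequalities *)

(** Truncating g at m changes it on a null set only and makes the bound hold pointwise. *)
Lemma inner_mul_le d (T : measurableType d) (R : realType) (mu : probability T R)
    (g h : T -> R) (C m : R) : measurable_fun [set: T] g -> (forall x, `|g x| <= C) ->
  {ae mu, forall x, g x <= m} -> h \in Lfun mu 2%:E ->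
  inner mu (fun x => g x * h x) h <= m * inner mu h h.
Proof.
move=> mg gC gm hL; have mh := Lfun2_measurable hL.
pose g' x := Num.min (g x) m.
have mg' : measurable_fun [set: T] g' by apply: measurable_minr => //; exact: measurable_cst.
have gC' x : `|g' x| <= C + `|m|.
  rewrite /g'; case: (leP (g x) m) => _; first by rewrite (le_trans (gC x))// lerDl.
  by rewrite lerDr (le_trans _ (gC x)).
have ghL := mul_bounded_Lfun2 mg gC hL; have ghL' := mul_bounded_Lfun2 mg' gC' hL.
have -> : inner mu (fun x => g x * h x) h = inner mu (fun x => g' x * h x) h.
  apply: inner_ae => //; [exact: measurable_funM|exact: measurable_funM|].
  by apply: filterS gm => x gx; rewrite /g'; move/min_idPl : gx => ->.
rewrite /inner -RintegralZl//; last exact: Lfun2_mul_integrable.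
apply: le_Rintegral => //.
- exact: (Lfun2_mul_integrable ghL').
- have := integrableZl measurableT m (Lfun2_mul_integrable hL hL).
  by under eq_fun do rewrite -EFinM.
- move=> x _; rewrite -mulrA -expr2 ler_wpM2r ?sqr_ge0//.
  by rewrite /g' ge_min lexx orbT.
Qed.

(** Used with the form of 1 - P_delta, which vanishes on constants: centering h leaves E_delta(h)
    unchanged. *)
Lemma psd_form_shift (R : realType) (V : lmodType R) (b : V -> V -> R) (o h : V) (a : R) :
  psd_form b -> (forall f, b f o = 0) -> b (h - a *: o) (h - a *: o) = b h h.
Proof.
move=> psdb bo; rewrite (psdBr psdb) (psdZr psdb) bo mulr0 subr0.
by rewrite (psdBl psdb) (psdZl psdb) (psd_sym psdb o) bo mulr0 subr0.
Qed.

Section discrete_transport.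
Context (R : realType) (X : completePseudoMetricType R).
Context d (Omega : measurableType d).
Variables (P : R.-pker (borel X) ~> Omega) (Z : R -> Omega -> X).
Variable mu : probability (borel X) R.
Hypothesis hausdorffX : hausdorff_space X.
Hypothesis markovZ : cadlag_markov_process P Z.
Hypothesis symP : symmetric_semigroup P Z mu.
Hypothesis contP : strongly_continuous_semigroup P Z mu.
Local Notation leb := (@lebesgue_measure R).
Local Notation B := (semigroup_inner P Z (mu := mu)).
Local Notation one := (one_L2 mu).

Let sgB := semigroup_formP hausdorffX markovZ symP.
Let psdI := psd_inner mu.
Let B0 f h : B 0 f h = inner mu f h := semigroup_inner0 hausdorffX markovZ f h.

Variable S : L2_operator (borel X) R.
Hypothesis sqrtS : is_sqrt_opp mu (generator P Z mu) S.
Variable c : R.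
Hypotheses (c0 : 0 <= c) (poincare_c : poincare mu S c).

Variables (g : borel X -> R) (C m Psi : R).
Hypotheses (mg : measurable_fun [set: borel X] g) (gC : forall x, `|g x| <= C).
Local Notation gL := (bounded_L2 mu mg gC).
Hypothesis g0 : inner mu gL one = 0.
Hypotheses (m0 : 0 <= m) (gm : {ae mu, forall x, g x <= m}).
Hypothesis BPsi : forall t, 0 <= t -> \int[leb]_(s in `[0, t]) B s gL gL <= Psi.

Definition discrete_energy (delta : R) (h : L2 mu) := delta^-1 * (inner mu h h - B delta h h).

Lemma one_one : inner mu one one = 1.
Proof. by rewrite /inner/= Rintegral_cst// mulr1 mul1r [X in fine X](probability_setT mu). Qed.

Lemma discrete_energy_ge0 delta h : 0 < delta -> 0 <= discrete_energy delta h.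
Proof.
move=> d0; rewrite mulr_ge0 ?invr_ge0 ?(ltW d0)//.
by have := psd_ge0 (psd_semigroup_form_gap sgB (ltW d0)) h; rewrite B0.
Qed.

(** Stated for h of any norm, since the Feynman-Kac estimate applies it to exp(lambda delta g / 2)
    f. The factor |h|^2 under the root comes from mu(h)^2 <= |h|^2. *)
Lemma discrete_transport delta (h : L2 mu) : 0 < delta ->
  inner mu (fun x => g x * h x) h <=
  2 * Num.sqrt (inner mu h h * (discrete_energy delta h * (Psi + delta * inner mu gL gL)))
  + (c + delta) * m * discrete_energy delta h.
Proof.
move=> d0; have d0' := ltW d0; have psdQ := psd_semigroup_form_gap sgB d0'.
pose a := inner mu h one; pose h0 : L2 mu := h - a *: one.
have h01 : inner mu h0 one = 0 by rewrite /h0 (psdBl psdI) (psdZl psdI) one_one mulr1 subrr.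
have Qone f : B 0 f one - B delta f one = 0.
  by rewrite (semigroup_inner_one hausdorffX markovZ symP f d0') B0 subrr.
have Eh0 : discrete_energy delta h0 = discrete_energy delta h.
  have := psd_form_shift h a psdQ Qone.
  by rewrite /discrete_energy -!B0 => ->.
have ghL f := mul_bounded_Lfun2 mg gC (L2_mem (mu := mu) f).
pose gh f := toL2 (ghL f).
have gone f : inner mu (gh f) one = inner mu gL f.
  by apply: eq_Rintegral => x _; rewrite /= mulr1.
have decomp : inner mu (gh h) h = 2 * (a * inner mu gL h0) + inner mu (gh h0) h0.
  have ghE : gh h = a *: gL + gh h0.
    apply/val_inj/funext => x.
    by change (g x * h x = a * g x + g x * (h x - a * 1)); ring.
  have hE : h = a *: one + h0 by rewrite /h0 subrKC.
  rewrite {1}ghE (psd_linl psdI) [in X in a * X + _]hE [in X in _ + X]hE !(psd_linr psdI).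
  rewrite -/h0 g0 !gone; ring.
have H1 := inner_mul_le mg gC gm (L2_mem h0).
have poinc := discrete_poincare sgB d0 c0 (fun n => discrete_potential_le hausdorffX markovZ symP contP sqrtS c0 poincare_c n d0 h01).
have green : inner mu gL h0 ^+ 2 <= discrete_energy delta h * (Psi + delta * inner mu gL gL).
  have := @discrete_green _ _ _ _ sgB delta d0 gL h0 Psi.
  rewrite !B0 -/(discrete_energy delta h0) Eh0; apply => n.
  have nd : 0 <= n%:R * delta by rewrite mulr_ge0.
  apply: le_trans (BPsi nd).
  have cB : continuous (fun s => B s gL gL).
    exact: (@continuous_semigroup_inner _ _ _ _ _ _ _ hausdorffX markovZ symP contP gL gL).
  apply: (@lower_Riemann_sum_le R (fun s => B s gL gL) delta n cB d0).
  by move=> s t s0 st; exact: (semigroup_form_nonincreasing sgB).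
have ah : a ^+ 2 <= inner mu h h.
  by have := psd_CauchySchwarz psdI h one; rewrite one_one mulr1.
rewrite -[inner mu (fun x => g x * h x) h]/(inner mu (gh h) h) decomp.
apply: lerD.
  rewrite ler_pM2l//; apply: (le_trans (ler_norm _)).
  rewrite -sqrtr_sqr ler_wsqrtr// exprMn ler_pM ?sqr_ge0//.
apply: (le_trans H1); rewrite -[_ * m]mulrC -mulrA ler_wpM2l//.
by move: poinc; rewrite B0 -/(discrete_energy delta h0) Eh0.
Qed.

End discrete_transport.

(** * Densities and their square roots *)

Section density.
Context d (T : measurableType d) (R : realType) (mu nu : probability T R).
Local Open Scope charge_scope.
Hypothesis numu : nu `<< mu.

Lemma densityE x : ('d (charge_of_finite_measure nu) '/d mu) x = (density mu nu x)%:E.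
Proof. by rewrite /density fineK// Radon_Nikodym_fin_num. Qed.

Lemma measurable_density : measurable_fun [set: T] (density mu nu).
Proof.
apply/measurable_EFinP; have -> : EFin \o density mu nu = 'd (charge_of_finite_measure nu) '/d mu.
  by apply/funext => x; rewrite densityE.
by have /integrableP[] := @Radon_Nikodym_integrable _ _ _ (charge_of_finite_measure nu) mu numu.
Qed.

(** The derivative is taken of nu as a charge, so its sign is known only almost everywhere, by
    comparison with the derivative of nu as a measure. *)
Lemma density_ge0 : {ae mu, forall x, 0 <= density mu nu x}.
Proof.
have := @ae_eq_Radon_Nikodym_SigmaFinite _ _ _ nu mu numu setT measurableT.
apply: filterS => x /(_ I); rewrite densityE => f_eq.
by rewrite -lee_fin -f_eq; exact: Radon_Nikodym_SigmaFinite.f_ge0.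
Qed.

Lemma integral_density (f : T -> R) (C : R) : measurable_fun [set: T] f -> (forall x, `|f x| <= C) ->
  (\int[nu]_x (f x)%:E = \int[mu]_x (f x * density mu nu x)%:E)%E.
Proof.
move=> mf fC; rewrite -(@Radon_Nikodym_change_of_variables _ _ _ nu mu numu) => //.
  by apply: eq_integral => x _; rewrite densityE EFinM.
exact: (Lfun2_integrable (bounded_Lfun2 nu mf fC)).
Qed.

Lemma measurable_sqrt_density : measurable_fun [set: T] (sqrt_density mu nu).
Proof. exact: (measurableT_comp (measurable_funTS (@continuous_measurable_fun _ _ (@sqrt_continuous R))) measurable_density). Qed.

Lemma integral_sqrt_density (f : T -> R) (C : R) : measurable_fun [set: T] f ->
  (forall x, `|f x| <= C) ->
  (\int[nu]_x (f x)%:E = \int[mu]_x (f x * sqrt_density mu nu x * sqrt_density mu nu x)%:E)%E.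
Proof.
move=> mf fC; rewrite (integral_density mf fC); apply: ae_eq_integral => //.
- by apply/measurable_EFinP/measurable_funM => //; exact: measurable_density.
- apply/measurable_EFinP/measurable_funM; last exact: measurable_sqrt_density.
  by apply: measurable_funM => //; exact: measurable_sqrt_density.
- apply: filterS density_ge0 => x b0 _ /=.
  by rewrite -mulrA -expr2 sqr_sqrtr.
Qed.

Lemma inner_sqrt_density : inner mu (sqrt_density mu nu) (sqrt_density mu nu) = 1.
Proof.
have := integral_sqrt_density (@measurable_cst _ _ T R setT 1) (fun x => lexx `|1|).
rewrite /= integral_cst_probability; under eq_integral do rewrite mul1r.
by rewrite /inner /Rintegral => <-.
Qed.

Lemma Lfun2_density : ('N[mu]_2%:E['d (charge_of_finite_measure nu) '/d mu] < +oo)%E ->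
  density mu nu \in Lfun mu 2%:E.
Proof.
move=> foo; apply/andP; split; apply/mem_set => /=; first exact: measurable_density.
rewrite /finite_norm; congr (_ < _)%E: foo; congr (Lnorm _ _ _).
by apply/funext => x; rewrite densityE.
Qed.

Lemma Lnorm2_density : density mu nu \in Lfun mu 2%:E ->
  'N[mu]_2%:E['d (charge_of_finite_measure nu) '/d mu]%E =
  (Num.sqrt (inner mu (density mu nu) (density mu nu)))%:E.
Proof.
move=> bL; rewrite -Lnorm2E//; congr (Lnorm _ _ _).
by apply/funext => x; rewrite densityE.
Qed.

End density.

Section essential_bound.
Context d (T : measurableType d) (R : realType) (mu : probability T R).
Variables (g : T -> R) (C : R).
Hypothesis gC : forall x, `|g x| <= C.
Local Notation m := (fine 'N[mu]_+oo[EFin \o (g^\+)%R]%E).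

(** Boundedness of g makes the essential supremum finite, so [fine] loses nothing. *)
Lemma ess_sup_funrpos : [/\ 0 <= m & {ae mu, forall x, g x <= m}].
Proof.
have NE : 'N[mu]_+oo[EFin \o (g^\+)%R]%E = ess_sup mu (abse \o (EFin \o (g^\+)%R)).
  by rewrite unlock [X in (0 < X)%E](probability_setT mu) lte01.
have N0 : (0 <= 'N[mu]_+oo[EFin \o (g^\+)%R])%E by exact: Lnorm_ge0.
have NC : ('N[mu]_+oo[EFin \o (g^\+)%R] <= C%:E)%E.
  rewrite NE; apply/ess_supP; apply: nearW => x /=.
  rewrite lee_fin ger0_norm ?funrpos_ge0// /funrpos ge_max.
  by rewrite (le_trans (ler_norm _) (gC x)) (le_trans _ (gC x)).
have Nfin : 'N[mu]_+oo[EFin \o (g^\+)%R]%E \is a fin_num.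
  by rewrite ge0_fin_numE// (le_lt_trans NC)// ltry.
split; first exact: fine_ge0.
have := ess_sup_ge mu (abse \o (EFin \o (g^\+)%R)); rewrite -NE.
apply: filterS => x /=; rewrite -lee_fin fineK//; apply: le_trans.
by rewrite lee_fin ger0_norm ?funrpos_ge0// /funrpos le_max lexx.
Qed.

End essential_bound.

Lemma le_of_linear_error (R : realType) (x b k : R) : 0 <= k ->
  (forall e : R, 0 < e <= 1 -> x <= b + e * k) -> x <= b.
Proof.
move=> k0 H; apply/ler_addgt0Pr => e e0.
have k1 : 0 < k + 1 by rewrite ltr_wpDl.
have e' : 0 < Num.min 1 (e / (k + 1)) by rewrite lt_min ltr01 divr_gt0.
apply: (le_trans (H (Num.min 1 (e / (k + 1))) _)); first by rewrite e'/= ge_min lexx.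
rewrite lerD2l; apply: (@le_trans _ _ (e / (k + 1) * (k + 1))); last by rewrite divfK// gt_eqF.
by rewrite ler_pM// ?(ltW e')// ?ge_min ?lexx ?orbT// lerDl.
Qed.

Lemma sqrtrD_le (R : realType) (a b : R) : 0 <= a -> 0 <= b ->
  Num.sqrt (a + b) <= Num.sqrt a + Num.sqrt b.
Proof.
move=> a0 b0; rewrite -(@ler_sqr _ (Num.sqrt (a + b))) ?nnegrE ?addr_ge0 ?sqrtr_ge0//.
rewrite sqrrD !sqr_sqrtr ?addr_ge0//.
by rewrite addrAC lerDl mulrn_wge0// mulr_ge0 ?sqrtr_ge0.
Qed.

Lemma transport_limit (R : realType) (x D Psi G c m : R) :
  0 <= D -> 0 <= Psi -> 0 <= G -> 0 <= c -> 0 <= m ->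
  (forall e : R, 0 < e -> x <= 2 * Num.sqrt (D * (Psi + e * G)) + (c + e) * m * D) ->
  x <= 2 * Num.sqrt (D * Psi) + c * m * D.
Proof.
move=> D0 Psi0 G0 c0 m0 H; have mD := mulr_ge0 m0 D0.
apply: (@le_of_linear_error _ _ _ (2 * Num.sqrt (D * G) + m * D)).
  by rewrite addr_ge0// mulr_ge0// sqrtr_ge0.
(* Taking delta = e^2 turns the error sqrt(delta D G) into one linear in e. *)
move=> e /andP[e0 e1]; have e2 : 0 < e ^+ 2 by rewrite exprn_gt0.
apply: (le_trans (H _ e2)).
have -> : D * (Psi + e ^+ 2 * G) = D * Psi + e ^+ 2 * (D * G) by ring.
have DG := mulr_ge0 D0 G0; have := @sqrtrD_le _ (D * Psi) (e ^+ 2 * (D * G)) (mulr_ge0 D0 Psi0) (mulr_ge0 (ltW e2) DG).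
rewrite (sqrtrM (D * G) (ltW e2)) sqrtr_sqr (ger0_norm (ltW e0)).
have : e ^+ 2 * (m * D) <= e * (m * D) by rewrite ler_wpM2r// expr2 ler_piMl// ltW.
set u := Num.sqrt _; set v := Num.sqrt _; set w := Num.sqrt _.
rewrite -(mulrA (c + _)) -(mulrA c); move: (m * D) mD => y y0 H1 H2.
lra.
Qed.

Section transport_information.
Context (R : realType) (X : completePseudoMetricType R).
Context d (Omega : measurableType d).
Variables (P : R.-pker (borel X) ~> Omega) (Z : R -> Omega -> X).
Variable mu : probability (borel X) R.
Hypothesis hausdorffX : hausdorff_space X.
Hypothesis markovZ : cadlag_markov_process P Z.
Hypothesis symP : symmetric_semigroup P Z mu.
Hypothesis contP : strongly_continuous_semigroup P Z mu.
Local Notation leb := (@lebesgue_measure R).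
Local Notation B := (semigroup_inner P Z (mu := mu)).
Local Notation one := (one_L2 mu).

Variable S : L2_operator (borel X) R.
Hypothesis sqrtS : is_sqrt_opp mu (generator P Z mu) S.
Variable c : R.
Hypotheses (c0 : 0 <= c) (poincare_c : poincare mu S c).

Variables (g : borel X -> R) (C m : R).
Hypotheses (mg : measurable_fun [set: borel X] g) (gC : forall x, `|g x| <= C).
Local Notation gL := (bounded_L2 mu mg gC).
Hypothesis g0 : inner mu gL one = 0.
Hypotheses (m0 : 0 <= m) (gm : {ae mu, forall x, g x <= m}).
Local Notation sigma2 := (asymptotic_variance P Z mu g).

(** The Poincare inequality gives the a priori bound c |g|^2, hence convergence of the variance; its
    limit then gives the sharper bound sigma^2 / 2. *)
Lemma green_le_half_asymptotic_variance t : 0 <= t ->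
  \int[leb]_(s in `[0, t]) B s gL gL <= sigma2 / 2.
Proof.
move=> t0; rewrite ler_pdivlMr// mulrC.
apply: (@asymptotic_variance_ge _ _ _ _ _ _ _ hausdorffX markovZ symP contP _ _ mg gC g0 (c * inner mu gL gL) _ t t0) => u u0.
exact: (integral_semigroup_inner_le hausdorffX markovZ symP contP sqrtS c0 poincare_c u0 g0).
Qed.

Lemma asymptotic_variance_ge0 : 0 <= sigma2.
Proof.
have := green_le_half_asymptotic_variance (lexx 0).
by rewrite set_itv1 Rintegral_set1 => H; rewrite -(pmulr_lge0 _ (_ : 0 < 2^-1))// invr_gt0.
Qed.

Lemma discrete_transport_sigma2 delta (h : L2 mu) : 0 < delta ->
  inner mu (fun x => g x * h x) h <=
  2 * Num.sqrt (inner mu h h * (discrete_energy P Z delta h * (sigma2 / 2 + delta * inner mu gL gL)))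
  + (c + delta) * m * discrete_energy P Z delta h.
Proof.
move=> d0.
exact: (discrete_transport hausdorffX markovZ symP contP sqrtS c0 poincare_c g0 m0 gm
  green_le_half_asymptotic_variance h d0).
Qed.

(** Replace E_delta by the larger E, then let delta tend to 0; the constant arises as 2 sqrt(D
    sigma^2 / 2) = sqrt(2 sigma^2 D). *)
Lemma dirichlet_transport (h : L2 mu) : dom S h -> inner mu h h = 1 ->
  inner mu (fun x => g x * h x) h <=
  Num.sqrt (2 * sigma2 * dirichlet mu S h h) + c * m * dirichlet mu S h h.
Proof.
move=> Sh h1; have s0 := asymptotic_variance_ge0.
have D0 : 0 <= dirichlet mu S h h by exact: inner_ge0.
set D := dirichlet mu S h h in D0 *.
have -> : Num.sqrt (2 * sigma2 * D) = 2 * Num.sqrt (D * (sigma2 / 2)).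
  rewrite -[X in X * Num.sqrt _](@ger0_norm _ 2)// -sqrtr_sqr -sqrtrM ?sqr_ge0//.
  by congr Num.sqrt; field.
apply: (@transport_limit _ _ _ _ (inner mu gL gL)) => //; [by rewrite divr_ge0|exact: inner_ge0|].
move=> e e0; apply: (le_trans (discrete_transport_sigma2 h e0)); rewrite h1 mul1r.
have DE : discrete_energy P Z e h <= D.
  rewrite /discrete_energy ler_pdivrMl//.
  exact: (discrete_dirichlet_le hausdorffX markovZ symP contP sqrtS (ltW e0) Sh).
have G0 := inner_ge0 mu gL.
apply: lerD; first by rewrite ler_pM2l// ler_wsqrtr// ler_wpM2r// addr_ge0 ?divr_ge0// mulr_ge0// ltW.
by rewrite ler_wpM2l// mulr_ge0// addr_ge0// ltW.
Qed.

Lemma transport_informationP : transport_information mu S g sigma2 (c * m).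
Proof.
move=> nu _; rewrite /information.
case: asboolP => [[numu Sh]|_]; last by rewrite leey.
have [hL _] := dom_sqrt_Lfun2 sqrtS Sh.
rewrite (integral_sqrt_density numu mg gC).
have ghL := mul_bounded_Lfun2 mg gC hL.
rewrite -[leLHS]fineK; last by apply: integrable_fin_num => //; exact: (Lfun2_mul_integrable ghL hL).
rewrite lee_fin.
exact: (@dirichlet_transport (toL2 hL) Sh (inner_sqrt_density numu)).
Qed.

End transport_information.

(** * Bernstein's inequality *)

Lemma mul2_sqrt_le (R : realType) (x y : R) : 0 <= x -> 0 <= y -> 2 * Num.sqrt (x * y) <= x + y.
Proof.
move=> x0 y0; have := sqr_ge0 (Num.sqrt x - Num.sqrt y).
by rewrite sqrrB !sqr_sqrtr// sqrtrM// -mulr_natl; lra.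
Qed.

(** The arithmetic-geometric mean inequality, giving E the weight 1 - lam m left over by the linear
    term. The coefficient of H is the supremum over E >= 0 of lam (sqrt(2 s E) + m E) - E. *)
Lemma Lambda_bound (R : realType) (lam s m E H y G : R) :
  0 <= lam -> 0 <= s -> lam * m < 1 -> 0 <= E -> 0 <= H -> 0 <= y <= s / 2 ->
  G <= 2 * Num.sqrt (H * (E * y)) + m * E ->
  lam * G <= E + lam ^+ 2 * s / (2 * (1 - lam * m)) * H.
Proof.
move=> l0 s0 lm E0 H0 /andP[y0 ys] HG.
have lm' : 0 < 1 - lam * m by rewrite subr_gt0.
have := ler_wpM2l l0 HG; rewrite mulrDr => /le_trans; apply.
have -> : lam * (2 * Num.sqrt (H * (E * y))) = 2 * Num.sqrt (((1 - lam * m) * E) * (lam ^+ 2 * y / (1 - lam * m) * H)).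
  rewrite (_ : (1 - lam * m) * E * _ = lam ^+ 2 * (H * (E * y))); last by field; rewrite gt_eqF.
  by rewrite (sqrtrM _ (sqr_ge0 lam)) sqrtr_sqr ger0_norm//; ring.
have y0' : 0 <= lam ^+ 2 * y / (1 - lam * m) * H.
  by rewrite mulr_ge0// divr_ge0 ?mulr_ge0 ?sqr_ge0// ltW.
have := mul2_sqrt_le (mulr_ge0 (ltW lm') E0) y0'.
have : lam ^+ 2 * y / (1 - lam * m) * H <= lam ^+ 2 * s / (2 * (1 - lam * m)) * H.
  rewrite ler_wpM2r// [leRHS](_ : _ = lam ^+ 2 * (s / 2) / (1 - lam * m)); last by field; rewrite gt_eqF.
  by rewrite ler_wpM2r ?invr_ge0 ?(ltW lm')// ler_wpM2l// sqr_ge0.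
set u := Num.sqrt _; set v := _ * H; set w := _ * H; lra.
Qed.

(** * Norm of the discrete Feynman-Kac operator *)

Section feynman_kac.
Context (R : realType) (X : completePseudoMetricType R).
Context d (Omega : measurableType d).
Variables (P : R.-pker (borel X) ~> Omega) (Z : R -> Omega -> X).
Variable mu : probability (borel X) R.
Hypothesis hausdorffX : hausdorff_space X.
Hypothesis markovZ : cadlag_markov_process P Z.
Hypothesis symP : symmetric_semigroup P Z mu.
Hypothesis contP : strongly_continuous_semigroup P Z mu.
Local Notation B := (semigroup_inner P Z (mu := mu)).
Local Notation T := (semigroup_op symP).
Local Notation one := (one_L2 mu).

Let sgB := semigroup_formP hausdorffX markovZ symP.
Let B0 f h : B 0 f h = inner mu f h := semigroup_inner0 hausdorffX markovZ f h.

Variable S : L2_operator (borel X) R.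
Hypothesis sqrtS : is_sqrt_opp mu (generator P Z mu) S.
Variable c : R.
Hypotheses (c0 : 0 <= c) (poincare_c : poincare mu S c).

Variables (g : borel X -> R) (C m : R).
Hypotheses (mg : measurable_fun [set: borel X] g) (gC : forall x, `|g x| <= C).
Local Notation gL := (bounded_L2 mu mg gC).
Hypothesis g0 : inner mu gL one = 0.
Hypotheses (m0 : 0 <= m) (gm : {ae mu, forall x, g x <= m}).
Local Notation sigma2 := (asymptotic_variance P Z mu g).

(** [s] and [m'] stand for sigma^2 and c m enlarged by the errors of order delta. *)
Variables (lambda delta s m' : R).
Hypotheses (lambda0 : 0 <= lambda) (delta0 : 0 < delta).
Hypotheses (s_ge : sigma2 + 2 * delta * inner mu gL gL <= s) (m'_ge : (c + delta) * m <= m').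
Hypothesis lambda_m' : lambda * m' < 1.

(** [Lambda] is the exponential growth rate, [K] bounds the multiplier exp(lambda delta g), and
    [kappa] will bound the form of one symmetrized step. *)
Let Lambda := lambda ^+ 2 * s / (2 * (1 - lambda * m')).
Let K := expR (delta * (lambda * C)).
Let kappa := 1 + delta * Lambda * K.

Let s0 : 0 <= s.
Proof.
apply: le_trans s_ge; rewrite addr_ge0 ?mulr_ge0 ?inner_ge0 ?(ltW delta0)//.
exact: (asymptotic_variance_ge0 hausdorffX markovZ symP contP sqrtS c0 poincare_c g0).
Qed.

Let Lambda0 : 0 <= Lambda.
Proof. by rewrite divr_ge0 ?mulr_ge0 ?sqr_ge0// subr_ge0 ltW. Qed.

Let K0 : 0 < K. Proof. exact: expR_gt0. Qed.

Let kappa1 : 1 <= kappa.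
Proof. by rewrite lerDl; exact: mulr_ge0 (mulr_ge0 (ltW delta0) Lambda0) (ltW K0). Qed.

Let a x := expR (delta * (lambda * g x) / 2).

Let lgC x : `|lambda * g x| <= lambda * C.
Proof. by rewrite normrM ger0_norm// ler_wpM2l. Qed.

Let ma : measurable_fun [set: borel X] a.
Proof. by apply: measurableT_comp => //; apply: measurable_funM => //; apply: measurable_funM => //; apply: measurable_funM. Qed.

Let aa x : a x * a x = expR (delta * (lambda * g x)).
Proof. by rewrite /a -expRD; congr expR; field. Qed.

Let aa_K x : a x * a x <= K.
Proof.
rewrite aa ler_expR ler_wpM2l ?(ltW delta0)//.
exact: le_trans (ler_norm _) (lgC x).
Qed.

Let aC x : `|a x| <= 1 + K.
Proof.
rewrite ger0_norm ?expR_ge0//; have := aa_K x; have : 0 <= a x by exact: expR_ge0.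
by move: (a x) K0 => y; nra.
Qed.

Let A (f : L2 mu) : L2 mu := toL2 (mul_bounded_Lfun2 ma aC (L2_mem f)).

Let A_sym (f h : L2 mu) : B 0 (A f) h = B 0 f (A h).
Proof. by rewrite !B0; apply: eq_Rintegral => x _ /=; ring. Qed.

Let inner_A_le (f : L2 mu) : inner mu (A f) (A f) <= K * inner mu f f.
Proof.
rewrite /inner -RintegralZl//; last exact: (Lfun2_mul_integrable (L2_mem f) (L2_mem f)).
apply: le_Rintegral => //.
- exact: (Lfun2_mul_integrable (L2_mem (A f)) (L2_mem (A f))).
- have := integrableZl measurableT K (Lfun2_mul_integrable (L2_mem f) (L2_mem f)).
  by under eq_fun do rewrite -EFinM.
- move=> x _; rewrite /= (_ : a x * f x * _ = (a x * a x) * (f x * f x)); last by ring.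
  by rewrite ler_wpM2r// -expr2 sqr_ge0.
Qed.

(** Uses exp(-x) >= 1 - x at x = delta lambda g, in the form (1 - x) a^2 <= 1. Written for A f, the
    estimate has no second-order remainder. *)
Let inner_A_ge (f : L2 mu) :
  inner mu (A f) (A f) - delta * (lambda * inner mu (fun x => g x * A f x) (A f)) <= inner mu f f.
Proof.
have [AfL fL] := (L2_mem (A f), L2_mem f).
have gAL := mul_bounded_Lfun2 mg gC AfL.
have i1 := Lfun2_mul_integrable AfL AfL; have i2 := Lfun2_mul_integrable gAL AfL.
have i3 : mu.-integrable [set: borel X] (fun x => (delta * lambda * (g x * A f x * A f x))%:E).
  have := integrableZl measurableT (delta * lambda) i2.
  by under eq_fun do rewrite -EFinM.
rewrite mulrA /inner -RintegralZl// -RintegralB//.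
apply: le_Rintegral => //.
- have := integrableB measurableT i1 i3.
  by congr (_.-integrable _ _); apply/funext => x.
- exact: (Lfun2_mul_integrable fL fL).
- move=> x _; rewrite /=.
  have := expR_ge1Dx (- (delta * (lambda * g x))).
  have := aa x; rewrite expRN => <- H.
  have a0 : 0 < a x := expR_gt0 _.
  have : (1 - delta * (lambda * g x)) * (a x * a x) * (f x * f x) <= f x * f x.
    rewrite ler_piMl -?expr2 ?sqr_ge0// -ler_pdivlMr; last by rewrite expr2 mulr_gt0.
    by rewrite div1r expr2.
  by apply: le_trans; rewrite le_eqVlt; apply/orP; left; apply/eqP; ring.
Qed.

(** For h = A f, <P_delta h, h> = |h|^2 - delta E_delta(h), and [Lambda_bound] gives -E_delta(h) <=
    -lambda mu(g h^2) + Lambda |h|^2. Then [inner_A_ge] absorbs the first-order term and |h|^2 <= K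
    |f|^2 bounds the rest. *)
Let A_le (f : L2 mu) : B delta (A f) (A f) <= kappa * B 0 f f.
Proof.
have d0 := ltW delta0; rewrite B0; set h := A f.
have H0 : 0 <= inner mu h h := inner_ge0 mu h.
have E0 : 0 <= discrete_energy P Z delta h := discrete_energy_ge0 hausdorffX markovZ symP h delta0.
have transport := discrete_transport_sigma2 hausdorffX markovZ symP contP sqrtS c0 poincare_c g0 m0 gm h delta0.
have ys : 0 <= sigma2 / 2 + delta * inner mu gL gL <= s / 2.
  have sg0 := asymptotic_variance_ge0 hausdorffX markovZ symP contP sqrtS c0 poincare_c g0.
  have := mulr_ge0 d0 (inner_ge0 mu gL); move: s_ge sg0.
  by move: sigma2 (inner mu gL gL) => x y ? ? ?; apply/andP; split; lra.
have := @Lambda_bound R lambda s m' (discrete_energy P Z delta h) (inner mu h h)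
  (sigma2 / 2 + delta * inner mu gL gL) (inner mu (fun x => g x * h x) h) lambda0 s0 lambda_m' E0 H0 ys.
rewrite -/Lambda => /(_ (le_trans transport _)) => HH.
have {}HH := HH (lerD (lexx _) (ler_wpM2r E0 m'_ge)).
have BE : B delta h h = inner mu h h - delta * discrete_energy P Z delta h.
  by rewrite /discrete_energy mulrA mulfV ?gt_eqF// mul1r subKr.
have I1 := inner_A_ge f; have I2 := inner_A_le f.
rewrite BE; rewrite -/h in I1 I2.
move: (inner mu h h) (inner mu f f) (inner mu _ h) (discrete_energy _ _ _ _) HH I1 I2 => x q G E HH I1 I2.
apply: (@le_trans _ _ (q + delta * Lambda * x)).
  by have := ler_wpM2l d0 HH; rewrite mulrDr mulrA; lra.
rewrite /kappa mulrDl mul1r lerD2l -[leRHS]mulrA ler_wpM2l// mulr_ge0//.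
Qed.

(** It has n transitions and n + 1 multipliers, one for each grid point theta + k delta with k <=
    n. *)
Definition feynman_kac_iter n : borel X -> R :=
  iter n (fun k y => expR (delta * (lambda * g y)) * semigroup P Z delta k y)
    (fun y => expR (delta * (lambda * g y))).

Let y n := twisted_iter T delta A (A one) n.

Let feynman_kac_iterE n : A (y n) = feynman_kac_iter n :> (borel X -> R).
Proof.
elim: n => [|n IH]; apply/funext => x; first by rewrite /= mulr1 aa.
rewrite /feynman_kac_iter iterS -/(feynman_kac_iter n) -IH -aa -mulrA.
by rewrite -(semigroup_opE symP _ (ltW delta0)).
Qed.

(** The n symmetric steps leave one factor A at each end; each costs sqrt K, whence the prefactor
    K. *)
Lemma feynman_kac_iter_le n :
  Num.sqrt (inner mu (feynman_kac_iter n) (feynman_kac_iter n)) <=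
  K * expR (n%:R * delta * (Lambda * K)).
Proof.
have yn := @twisted_iter_le _ _ _ _ sgB delta delta0 A kappa A_sym A_le (A one) n (le_trans ler01 kappa1).
rewrite !B0 in yn.
have kn : kappa ^+ n <= expR (n%:R * delta * (Lambda * K)).
  rewrite -mulrA expRM_natl lerXn2r ?nnegrE ?expR_ge0//; first exact: le_trans ler01 kappa1.
  by rewrite /kappa -mulrA; exact: expR_ge1Dx.
rewrite -[leRHS]ger0_norm ?mulr_ge0 ?expR_ge0// -sqrtr_sqr ler_wsqrtr//.
rewrite -feynman_kac_iterE; apply: (le_trans (inner_A_le _)).
have A1 := inner_A_le one; rewrite one_one mulr1 in A1.
rewrite exprMn expr2 -mulrA ler_wpM2l ?(ltW K0)//; apply: (le_trans yn).
rewrite mulrC ler_pM ?inner_ge0 ?sqr_ge0//.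
by rewrite lerXn2r ?nnegrE ?expR_ge0// exprn_ge0// (le_trans ler01).
Qed.

End feynman_kac.

(** * Jensen's inequality along a path *)

Section pathwise.
Context (R : realType).
Local Notation leb := (@lebesgue_measure R).
Variables (b : R -> R) (k delta : R).
Hypotheses (mb : measurable_fun [set: R] b) (bk : forall s, `|b s| <= k) (delta0 : 0 < delta).

Lemma expR_Rintegral_le :
  expR (delta^-1 * \int[leb]_(s in `[0, delta]) b s) <=
  delta^-1 * \int[leb]_(s in `[0, delta]) expR (b s).
Proof.
set m := delta^-1 * _.
have ib := bounded_integrable_itv 0 delta mb bk.
have mE : \int[leb]_(s in `[0, delta]) b s = delta * m by rewrite /m mulrA mulfV ?gt_eqF// mul1r.
rewrite ler_pdivlMl// mulrC.
have mexp : measurable_fun [set: R] (fun s => expR (b s)) by exact: measurableT_comp.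
(* The tangent line of exp at the mean m; integrating it over [0, delta] is Jensen's inequality. *)
have tangent (s : R) : expR m * (1 - m) + expR m * b s <= expR (b s).
  rewrite -mulrDr -[b s in leRHS](subrKC m) expRD ler_wpM2l ?expR_ge0//.
  by apply: le_trans (expR_ge1Dx _); lra.
have ic (l : R) : leb.-integrable `[0, delta] (EFin \o cst l).
  by apply: (@bounded_integrable_itv _ _ _ _ `|l|); first exact: measurable_cst.
have ieb : leb.-integrable `[0, delta] (EFin \o (fun s => expR m * b s)).
  apply: (@bounded_integrable_itv _ _ _ _ (expR m * k)); first exact: measurable_funM.
  by move=> s; rewrite normrM ger0_norm ?expR_ge0// ler_wpM2l ?expR_ge0.
have -> : expR m * delta = \int[leb]_(s in `[0, delta]) (expR m * (1 - m) + expR m * b s).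
  rewrite RintegralD//; last exact: ic.
  by rewrite (Rintegral_itv_cst _ (ltW delta0)) subr0 RintegralZl// mE; ring.
apply: le_Rintegral => //.
- apply: (@bounded_integrable_itv _ _ _ _ (`|expR m * (1 - m)| + expR m * k)).
    by apply: measurable_funD => //; exact: measurable_funM.
  move=> s; apply: (le_trans (ler_normD _ _)); rewrite lerD2l normrM ger0_norm ?expR_ge0//.
  by rewrite ler_wpM2l ?expR_ge0.
- apply: (@bounded_integrable_itv _ _ _ _ (expR k)) => //.
  move=> s; rewrite ger0_norm ?expR_ge0// ler_expR.
  exact: le_trans (ler_norm _) (bk s).
Qed.

Lemma Rintegral_itv_split n :
  \int[leb]_(s in `[0, n%:R * delta]) b s =
  \int[leb]_(s in `[0, delta]) (\sum_(j < n) b (s + j%:R * delta)).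
Proof.
have d0 := ltW delta0.
have msum j : measurable_fun [set: R] (fun s => \sum_(i < j) b (s + i%:R * delta)).
  apply: measurable_sum => i; apply: measurableT_comp => //.
  by apply: measurable_funD => //; exact: measurable_cst.
have sumk j s : `|\sum_(i < j) b (s + i%:R * delta)| <= \sum_(i < j) k.
  by apply: (le_trans (ler_norm_sum _ _ _)); exact: ler_sum.
elim: n => [|n IH].
  rewrite mul0r set_itv1 Rintegral_set1; under eq_Rintegral do rewrite big_ord0.
  by rewrite Rintegral_itv_cst// mul0r.
have nd : 0 <= n%:R * delta by rewrite mulr_ge0.
rewrite (integrable_Rintegral_itv_cat (c := n%:R * delta) (bounded_integrable_itv _ _ mb bk))//; last first.
  by rewrite ler_wpM2r// ler_nat.
have -> : n.+1%:R * delta = delta + n%:R * delta by rewrite -natr1; ring.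
have := Rintegral_shift 0 delta (n%:R * delta) mb; rewrite add0r => <-.
rewrite IH; under [in RHS]eq_Rintegral do rewrite big_ord_recr/=.
rewrite RintegralD//.
- exact: (bounded_integrable_itv _ _ (msum n) (sumk n)).
- apply: (@bounded_integrable_itv _ _ _ _ k) => //.
  by apply: measurableT_comp => //; apply: measurable_funD => //; exact: measurable_cst.
Qed.

End pathwise.

(* Cutting the integral into pieces of length [delta] makes it the average over
   [s] of the sums on the grids [s + delta * nat], to which Jensen's inequality
   applies. *)
Lemma expR_Rintegral_split_le (R : realType) (b : R -> R) (k delta : R) n :
  measurable_fun [set: R] b -> (forall s, `|b s| <= k) -> 0 < delta ->
  expR (\int[@lebesgue_measure R]_(s in `[0, n%:R * delta]) b s) <=
  delta^-1 * \int[@lebesgue_measure R]_(s in `[0, delta]) expR (delta * \sum_(j < n) b (s + j%:R * delta)).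
Proof.
move=> mb bk d0; rewrite (Rintegral_itv_split mb bk d0).
have msum : measurable_fun [set: R] (fun s => \sum_(i < n) b (s + i%:R * delta)).
  apply: measurable_sum => i; apply: measurableT_comp => //.
  by apply: measurable_funD => //; exact: measurable_cst.
have sumk s : `|\sum_(i < n) b (s + i%:R * delta)| <= \sum_(i < n) k.
  by apply: (le_trans (ler_norm_sum _ _ _)); exact: ler_sum.
have := @expR_Rintegral_le _ (fun s => delta * \sum_(i < n) b (s + i%:R * delta)) (delta * \sum_(i < n) k) delta.
rewrite RintegralZl//; last exact: (bounded_integrable_itv _ _ msum sumk).
rewrite mulrA mulVf ?gt_eqF// mul1r; apply => //; first exact: measurable_funM.
by move=> s; rewrite normrM gtr0_norm// ler_wpM2l// ltW.
Qed.

(** * Exponential moments of the time integral *)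

Section exponential_moment.
Context (R : realType) (X : completePseudoMetricType R).
Context d (Omega : measurableType d).
Variables (P : R.-pker (borel X) ~> Omega) (Z : R -> Omega -> X).
Variable mu : probability (borel X) R.
Hypothesis markovZ : cadlag_markov_process P Z.
Hypothesis symP : symmetric_semigroup P Z mu.
Local Notation leb := (@lebesgue_measure R).
Local Notation semigroup := (semigroup P Z).
Variable beta : probability (borel X) R.
Hypothesis betamu : beta `<< mu.
Hypothesis bL : density mu beta \in Lfun mu 2%:E.
Local Notation b := (density mu beta).
Local Notation norm_b := (Num.sqrt (inner mu b b)).

(** The Cauchy-Schwarz inequality brings in the norm of the density. As P_t is a contraction,
    starting the grid at a positive time costs nothing. *)
Lemma integral_semigroup_density t (f : borel X -> R) : 0 <= t -> bounded_nonneg f ->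
  (\int[beta]_x \int[P x]_w (f (Z t w))%:E <= (norm_b * Num.sqrt (inner mu f f))%:E)%E.
Proof.
move=> t0 bf; have [mPf [K PfK]] := semigroup_bounded_nonneg markovZ t0 bf.
have [mf [K' fK']] := bf.
have abs_le (h : borel X -> R) (L : R) : (forall x, 0 <= h x <= L) -> forall x, `|h x| <= L.
  by move=> hL x; have /andP[h0 h1] := hL x; rewrite ger0_norm.
have fL := bounded_Lfun2 mu mf (abs_le _ _ fK').
have PfL := bounded_Lfun2 mu mPf (abs_le _ _ PfK).
under eq_integral do rewrite -(semigroup_EFin markovZ _ t0 bf).
rewrite (integral_density betamu mPf (abs_le _ _ PfK)).
rewrite -[leLHS]fineK; last by apply: integrable_fin_num => //; exact: Lfun2_mul_integrable.
rewrite lee_fin -/(inner mu (semigroup t f) b) [leLHS]inner_sym.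
have := ler_norm_inner (toL2 bL) (toL2 PfL) => /(le_trans (ler_norm _))/le_trans; apply.
rewrite ler_wpM2l ?sqrtr_ge0// ler_wsqrtr//.
exact: (inner_semigroup_contraction markovZ symP t0 fL).
Qed.

Variables (g : borel X -> R) (C : R).
Hypotheses (mg : measurable_fun [set: borel X] g) (gC : forall x, `|g x| <= C).
Variables (lambda delta : R).
Hypotheses (lambda0 : 0 <= lambda) (delta0 : 0 < delta).

Local Notation W := (fun y => expR (delta * (lambda * g y))).
Local Notation U := (feynman_kac_iter P Z g lambda delta).

Let bounded_nonneg_W : bounded_nonneg W.
Proof.
split; first by apply: measurableT_comp => //; do 2 (apply: measurable_funM => //).
exists (expR (delta * (lambda * C))) => x; rewrite expR_ge0/= ler_expR.
by rewrite !ler_wpM2l ?(ltW delta0)// (le_trans (ler_norm _)).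
Qed.

Lemma bounded_nonneg_feynman_kac_iter n : bounded_nonneg (U n).
Proof.
elim: n => [|n IH]; first exact: bounded_nonneg_W.
have [mW [K WK]] := bounded_nonneg_W.
have [mP [L PL]] := semigroup_bounded_nonneg markovZ (ltW delta0) IH.
split; first exact: measurable_funM.
exists (K * L) => x; have /andP[W0 W1] := WK x; have /andP[P0 P1] := PL x.
by rewrite mulr_ge0//= ler_pM.
Qed.

Lemma integral_exp_sum theta n : 0 <= theta ->
  (\int[mixture P beta]_w (expR (delta * \sum_(k < n.+1) lambda * g (Z (theta + k%:R * delta) w)))%:E
   <= (norm_b * Num.sqrt (inner mu (U n) (U n)))%:E)%E.
Proof.
move=> th0; have nd k : 0 <= theta + k%:R * delta by rewrite addr_ge0// mulr_ge0// ltW.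
have [mW _] := bounded_nonneg_W.
rewrite integral_mixture; last first.
  split; last by move=> w; rewrite lee_fin expR_ge0.
  apply/measurable_EFinP; apply: measurableT_comp => //; apply: measurable_funM => //.
  apply: measurable_sum => k; apply: measurable_funM => //.
  exact: (measurable_process_comp markovZ (nd k) mg).
apply: le_trans (integral_semigroup_density th0 (bounded_nonneg_feynman_kac_iter n)).
rewrite le_eqVlt; apply/orP; left; apply/eqP; apply: eq_integral => x _.
(* The exponential of the sum has n + 1 factors; the last one plays the part of h. *)
have := markov_prod markovZ x n th0 (ltW delta0) bounded_nonneg_W bounded_nonneg_W.
move=> <-; apply: eq_integral => w _; congr EFin.
by rewrite mulr_sumr expR_sum big_ord_recr.
Qed.

(** The bound for a grid does not depend on its origin, so it survives the average over
    [0, delta]. *)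
Lemma exponential_moment n :
  (\int[mixture P beta]_w (expR (lambda * time_integral Z g (n.+1%:R * delta) w))%:E
   <= (norm_b * Num.sqrt (inner mu (U n) (U n)))%:E)%E.
Proof.
have d0 := ltW delta0.
have mg2 := measurable_process2 markovZ mg.
pose F (p : measurableTypeR R * Omega) : \bar R :=
  (expR (delta * \sum_(k < n.+1) lambda * g (Z (Num.max (p.1 + k%:R * delta) 0) p.2)))%:E.
have mF : measurable_fun [set: measurableTypeR R * Omega] F.
  apply/measurable_EFinP; apply: measurableT_comp => //; apply: measurable_funM => //.
  apply: measurable_sum => k; apply: measurable_funM => //.
  apply: (measurableT_comp (g := fun p : measurableTypeR R * Omega => (p.1 + k%:R * delta, p.2)) mg2).
  apply/measurable_fun_pair => //=; apply: measurable_funD => //; exact: measurable_cst.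
have F0 p : (0 <= F p)%E by rewrite lee_fin expR_ge0.
have [mF1 mF2 FE] := @ge0_Fubini_itv _ _ _ (mixture P beta) 0 delta F mF F0.
have pathwise w : ((expR (lambda * time_integral Z g (n.+1%:R * delta) w))%:E <=
    (delta^-1)%:E * \int[leb]_(s in `[0%R, delta]) F (s, w))%E.
  have mb := measurable_path markovZ mg w.
  have mlb : measurable_fun [set: R] (fun s => lambda * g (Z (Num.max s 0) w)) by exact: measurable_funM.
  have lbC s : `|lambda * g (Z (Num.max s 0) w)| <= lambda * C.
    by rewrite normrM ger0_norm// ler_wpM2l.
  have := expR_Rintegral_split_le n.+1 mlb lbC delta0.
  rewrite RintegralZl//; last exact: (bounded_integrable_itv 0 _ mb (fun s => gC _)).
  rewrite (time_integralE Z g (n.+1%:R * delta) w) => H.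
  have -> : (\int[leb]_(s in `[0%R, delta]) F (s, w) = (\int[leb]_(s in `[0%R, delta])
      expR (delta * \sum_(k < n.+1) lambda * g (Z (Num.max (s + k%:R * delta) 0) w)))%:E)%E.
    rewrite /Rintegral fineK//; apply: integrable_fin_num => //.
    apply: (@bounded_integrable_itv _ _ _ _ (expR (delta * \sum_(k < n.+1) lambda * C))).
      apply: measurableT_comp => //; apply: measurable_funM => //.
      apply: measurable_sum => k; apply: (measurableT_comp mlb).
      by apply: measurable_funD => //; exact: measurable_cst.
    move=> s; rewrite ger0_norm ?expR_ge0// ler_expR ler_wpM2l//.
    by apply: ler_sum => k _; exact: le_trans (ler_norm _) (lbC _).
  by rewrite -EFinM lee_fin.
apply: (@le_trans _ _ (\int[mixture P beta]_w ((delta^-1)%:E * \int[leb]_(s in `[0%R, delta]) F (s, w)))%E).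
  apply: ge0_le_integral => //.
  - apply/measurable_EFinP; apply: measurableT_comp => //; apply: measurable_funM => //.
    by apply: (measurable_time_integral mu markovZ mg gC); rewrite mulr_ge0.
  - exact: measurable_funeM.
rewrite ge0_integralZl//; last 2 first.
- by move=> w _; apply: integral_ge0.
- by rewrite lee_fin invr_ge0.
rewrite FE.
have -> : (norm_b * Num.sqrt (inner mu (U n) (U n)))%:E =
    ((delta^-1)%:E * \int[leb]_(s in `[0%R, delta]) (norm_b * Num.sqrt (inner mu (U n) (U n)))%:E)%E.
  rewrite integral_cst//= [X in (_ * (_ * X))%E](lebesgue_measure_segment d0) subr0 -!EFinM.
  by rewrite mulrCA mulVf ?mulr1// gt_eqF.
rewrite lee_wpmul2l ?lee_fin ?invr_ge0//.
apply: ge0_le_integral => //.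
- by move=> s _; apply: integral_ge0.
- by apply: measurable_funTS.
- move=> s; rewrite /= in_itv/= => /andP[s0 _].
  apply: le_trans (integral_exp_sum n s0).
  rewrite le_eqVlt; apply/orP; left; apply/eqP; apply: eq_integral => w _; congr (EFin (expR (_ * _))).
  by apply: eq_bigr => k _; rewrite (max_idPl _)// addr_ge0// mulr_ge0.
Qed.

End exponential_moment.

(** * Chernoff's bound in the limit of small delta *)

Section chernoff.
Context (R : realType) (X : completePseudoMetricType R).
Context d (Omega : measurableType d).
Variables (P : R.-pker (borel X) ~> Omega) (Z : R -> Omega -> X).
Variable mu : probability (borel X) R.
Hypothesis hausdorffX : hausdorff_space X.
Hypothesis markovZ : cadlag_markov_process P Z.
Hypothesis symP : symmetric_semigroup P Z mu.
Hypothesis contP : strongly_continuous_semigroup P Z mu.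
Local Notation one := (one_L2 mu).

Variable S : L2_operator (borel X) R.
Hypothesis sqrtS : is_sqrt_opp mu (generator P Z mu) S.
Variable c : R.
Hypotheses (c0 : 0 <= c) (poincare_c : poincare mu S c).

Variables (g : borel X -> R) (C m : R).
Hypotheses (mg : measurable_fun [set: borel X] g) (gC : forall x, `|g x| <= C).
Local Notation gL := (bounded_L2 mu mg gC).
Hypothesis g0 : inner mu gL one = 0.
Hypotheses (m0 : 0 <= m) (gm : {ae mu, forall x, g x <= m}).
Local Notation sigma2 := (asymptotic_variance P Z mu g).

Variables (t r : R).
Hypotheses (t0 : 0 < t) (r0 : 0 < r).

Definition deviation := [set w | r < t^-1 * time_integral Z g t w].

Lemma measurable_deviation : measurable deviation.
Proof.
have mA := measurable_time_integral mu markovZ mg gC (ltW t0).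
have mf : measurable_fun [set: Omega] (fun w => t^-1 * time_integral Z g t w) by exact: measurable_funM.
have := mf measurableT `]r, +oo[%classic (measurable_itv _); rewrite setTI.
by congr measurable; apply/seteqP; split => w /=; rewrite in_itv/= andbT.
Qed.

Variable beta : probability (borel X) R.
Local Notation p := (fine (mixture P beta deviation)).

Lemma deviationE : mixture P beta deviation = p%:E.
Proof. by rewrite fineK//; apply: fin_num_measure; exact: measurable_deviation. Qed.

Lemma markov_deviation lambda : 0 <= lambda ->
  ((p * expR (lambda * (r * t)))%:E <=
   \int[mixture P beta]_w (expR (lambda * time_integral Z g t w))%:E)%E.
Proof.
move=> l0; have mA := measurable_time_integral mu markovZ mg gC (ltW t0).
rewrite EFinM -deviationE muleC -[X in mixture P beta X]setIT -integral_indic//; last exact: measurable_deviation.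
rewrite -ge0_integralZl//; last by apply/measurable_EFinP; exact: measurable_indic measurable_deviation.
apply: ge0_le_integral => //.
- by apply: measurable_funeM; apply/measurable_EFinP/measurable_indic; exact: measurable_deviation.
- by apply/measurable_EFinP; apply: measurableT_comp => //; exact: measurable_funM.
- move=> w _; rewrite -EFinM lee_fin indicE.
  have [|_] := boolP (w \in deviation); last by rewrite mulr0 expR_ge0.
  move=> /set_mem /= /ltW; rewrite mulrC ler_pdivlMr// => H.
  by rewrite mulr1 ler_expR ler_wpM2l.
Qed.

Hypothesis betamu : beta `<< mu.
Hypothesis bL : density mu beta \in Lfun mu 2%:E.
Local Notation norm_b := (Num.sqrt (inner mu (density mu beta) (density mu beta))).

Let energy lambda delta := lambda ^+ 2 * (sigma2 + 2 * delta * inner mu gL gL) /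
  (2 * (1 - lambda * ((c + delta) * m))).
Let bound lambda delta := norm_b * (expR (delta * (lambda * C)) *
  expR (t * (energy lambda delta * expR (delta * (lambda * C))) - lambda * (r * t))).

(** [harmonic n] is 1 / (n + 1), so the mesh delta satisfies t = (n + 1) delta. *)
Let discrete_chernoff lambda n : 0 <= lambda -> lambda * ((c + t * harmonic n) * m) < 1 ->
  p <= bound lambda (t * harmonic n).
Proof.
move=> l0; set delta := t * harmonic n => lm.
have d0 : 0 < delta by rewrite mulr_gt0// invr_gt0.
have nt : n.+1%:R * delta = t by rewrite /delta mulrCA mulfV ?mulr1// pnatr_eq0.
have e0 : 0 <= energy lambda delta.
  have s0 := asymptotic_variance_ge0 hausdorffX markovZ symP contP sqrtS c0 poincare_c g0.
  apply: divr_ge0; last by rewrite mulr_ge0// subr_ge0 ltW.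
  by rewrite mulr_ge0 ?sqr_ge0// addr_ge0// mulr_ge0 ?inner_ge0// mulr_ge0// ltW.
have H1 := markov_deviation l0.
have H2 := exponential_moment markovZ symP betamu bL mg gC l0 d0 n.
have H3 := feynman_kac_iter_le hausdorffX markovZ symP contP sqrtS c0 poincare_c g0 m0 gm
  l0 d0 (lexx _) (lexx _) lm n.
rewrite -/(energy lambda delta) in H3.
rewrite nt in H2; have := le_trans H1 H2; rewrite lee_fin -ler_pdivlMr ?expR_gt0// => {H1 H2} H.
apply: (le_trans H); rewrite -expRN -mulrA /bound ler_wpM2l ?sqrtr_ge0//.
rewrite expRD mulrA ler_wpM2r ?expR_ge0//; apply: (le_trans H3).
(* Only n transitions separate the n + 1 grid points, so the growth lasts n delta <= t. *)
have nd : n%:R * delta <= t by rewrite -[leRHS]nt ler_wpM2r ?(ltW d0)// ler_nat.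
rewrite ler_wpM2l ?expR_ge0// ler_expR.
exact: (ler_wpM2r (mulr_ge0 e0 (expR_ge0 _)) nd).
Qed.

Lemma chernoff lambda : 0 <= lambda -> lambda * (c * m) < 1 ->
  p <= norm_b * expR (- (t * (lambda * r - lambda ^+ 2 * sigma2 / (2 * (1 - lambda * (c * m)))))).
Proof.
(* The discrete bound requires lambda (c + delta) m < 1, true only for small delta. If p exceeded
   the limit, some n would satisfy this condition with a bound below p. *)
move=> l0 lm; rewrite leNgt; apply/negP => lt.
have dcvg : (t * harmonic n : R) @[n --> \oo] --> (0 : R).
  by rewrite -[X in _ --> X](mulr0 t); apply: cvgM; [exact: cvg_cst|exact: cvg_harmonic].
have lmcvg : lambda * ((c + t * harmonic n) * m) @[n --> \oo] --> lambda * (c * m).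
  apply: cvgM; first exact: cvg_cst.
  apply: cvgM; last exact: cvg_cst.
  by rewrite -[X in _ --> X](addr0 c); apply: cvgD => //; exact: cvg_cst.
have Kcvg : expR (t * harmonic n * (lambda * C)) @[n --> \oo] --> (1 : R).
  rewrite -expR0; apply: (@continuous_cvg _ _ _ _ _ _ (@expR R)); first exact: continuous_expR.
  by rewrite -[X in _ --> X](mul0r (lambda * C)); apply: cvgM => //; exact: cvg_cst.
have ecvg : energy lambda (t * harmonic n) @[n --> \oo] -->
    lambda ^+ 2 * sigma2 / (2 * (1 - lambda * (c * m))).
  apply: cvgM.
    apply: cvgM; first exact: cvg_cst.
    rewrite -[X in _ --> X]addr0; apply: cvgD; first exact: cvg_cst.
    rewrite -[X in _ --> X](mul0r (inner mu gL gL)); apply: cvgM; last exact: cvg_cst.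
    by rewrite -[X in _ --> X](mulr0 2); apply: cvgM => //; exact: cvg_cst.
  apply: cvgV; first by rewrite mulf_neq0// subr_eq0 gt_eqF.
  by apply: cvgM; [exact: cvg_cst|apply: cvgB => //; exact: cvg_cst].
have bcvg : bound lambda (t * harmonic n) @[n --> \oo] -->
    norm_b * expR (- (t * (lambda * r - lambda ^+ 2 * sigma2 / (2 * (1 - lambda * (c * m)))))).
  apply: cvgM; first exact: cvg_cst.
  rewrite -[X in _ --> X]mul1r; apply: cvgM => //.
  rewrite [X in _ --> expR X](_ : _ = t * (lambda ^+ 2 * sigma2 / (2 * (1 - lambda * (c * m))) * 1) - lambda * (r * t)); last by ring.
  apply: (@continuous_cvg _ _ _ _ _ _ (@expR R)); first exact: continuous_expR.
  apply: cvgB; last exact: cvg_cst.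
  by apply: cvgM; [exact: cvg_cst|exact: cvgM].
have small := @cvgr_lt R nat \oo eventually_filter _ _ lmcvg _ lm; have below := @cvgr_lt R nat \oo eventually_filter _ _ bcvg _ lt.
have [n [/= sn bn]] : exists n, lambda * ((c + t * harmonic n) * m) < 1 /\ bound lambda (t * harmonic n) < p.
  have [n _ H] := filterI small below; exists n; exact: (H n (leqnn n)).
by have := discrete_chernoff l0 sn; rewrite leNgt bn.
Qed.

End chernoff.

(** * Optimization over lambda *)

Section bernstein_exponent.
Context (R : realType).
Variables (s M r : R).
Hypotheses (s0 : 0 <= s) (M0 : 0 <= M) (r0 : 0 < r).

Let Mr : 0 <= 2 * M * r. Proof. by rewrite !mulr_ge0// ltW. Qed.

Lemma bernstein_denominatorE :
  bernstein_denominator s M r = (Num.sqrt (s + 2 * M * r) + Num.sqrt s) ^+ 2.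
Proof.
rewrite /bernstein_denominator; case: eqVneq => // s_neq0.
rewrite -[X in X * _](sqr_sqrtr s0) -exprMn mulrDr mulr1 -sqrtrM//.
by rewrite mulrDr mulr1 mulrCA mulfV// mulr1.
Qed.

Lemma bernstein_denominator_ge0 : 0 <= bernstein_denominator s M r.
Proof. by rewrite bernstein_denominatorE sqr_ge0. Qed.

(** (x + y)^2 <= 2 (x^2 + y^2), the squares of the two roots adding up to 2 (s + M r). *)
Lemma bernstein_denominator_le : bernstein_denominator s M r <= 4 * (s + M * r).
Proof.
rewrite bernstein_denominatorE.
have := sqr_ge0 (Num.sqrt (s + 2 * M * r) - Num.sqrt s).
have := sqr_sqrtr (addr_ge0 s0 Mr); have := sqr_sqrtr s0.
by move: (Num.sqrt s) (Num.sqrt _) => x y; nra.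
Qed.

Lemma bernstein_denominator_eq0 :
  (bernstein_denominator s M r == 0) = (s + M * r == 0).
Proof.
apply/idP/idP => [|sM]; last first.
  by rewrite eq_le bernstein_denominator_ge0 andbT (le_trans bernstein_denominator_le)// (eqP sM) mulr0.
rewrite bernstein_denominatorE sqrf_eq0 paddr_eq0 ?sqrtr_ge0// !sqrtr_eq0.
move=> /andP[H1 H2]; rewrite paddr_eq0 ?(mulr_ge0 M0 (ltW r0))//.
by rewrite !eq_le H2 s0 (mulr_ge0 M0 (ltW r0))/= andbT; move: Mr H1 s0; nra.
Qed.

Variables (t p nb : R).
Hypotheses (t0 : 0 < t) (p0 : 0 <= p) (nb0 : 0 <= nb).
Hypothesis chernoff_p : forall lambda, 0 <= lambda -> lambda * M < 1 ->
  p <= nb * expR (- (t * (lambda * r - lambda ^+ 2 * s / (2 * (1 - lambda * M))))).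

(* With [q = sqrt (1 + 2 M r / s)], the optimal choice is
   [lambda = 2 r / (s q (q + 1))], for which [1 - lambda M = 1 / q]. *)
Let chernoff_optimal_pos : 0 < s ->
  p <= nb * expR (- (2 * t * r ^+ 2 / bernstein_denominator s M r)).
Proof.
move=> s_gt0; rewrite /bernstein_denominator gt_eqF//.
have Ms : 0 <= 2 * M * r / s by rewrite divr_ge0.
have := sqr_sqrtr (addr_ge0 ler01 Ms).
have : 1 <= Num.sqrt (1 + 2 * M * r / s) by rewrite -[leLHS]sqrtr1 ler_wsqrtr// lerDl.
move: (Num.sqrt _) => q q1 qE.
have q0 : 0 < q by apply: lt_le_trans q1.
have q10 : 0 < q + 1 by rewrite addr_gt0.
have ME : M = s * (q ^+ 2 - 1) / (2 * r).
  by rewrite qE; field; rewrite !gt_eqF.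
have lE : 1 - 2 * r / (s * q * (q + 1)) * M = q^-1.
  by rewrite ME; field; rewrite !gt_eqF.
have := chernoff_p (lambda := 2 * r / (s * q * (q + 1))).
rewrite lE [X in expR X](_ : _ = - (2 * t * r ^+ 2 / (s * (q + 1) ^+ 2))); last first.
  by field; rewrite !gt_eqF.
apply; first by rewrite divr_ge0 ?mulr_ge0// ltW.
by rewrite -subr_gt0 lE invr_gt0.
Qed.

(** For s = 0 the exponent is linear in lambda and the best value 1 / M is excluded; it is
    approached by (1 - e) / M. *)
Let chernoff_optimal0 : s = 0 -> 0 < M ->
  p <= nb * expR (- (2 * t * r ^+ 2 / bernstein_denominator s M r)).
Proof.
move=> s_eq0 M_gt0; rewrite bernstein_denominatorE s_eq0 sqrtr0 addr0 add0r sqr_sqrtr//.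
have -> : 2 * t * r ^+ 2 / (2 * M * r) = t * r / M by field; rewrite !gt_eqF.
rewrite expRN ler_pdivlMr ?expR_gt0//.
set x := t * r / M; have x0 : 0 <= x by rewrite divr_ge0 ?mulr_ge0 ?ltW.
have px : 0 <= p * expR x by rewrite mulr_ge0 ?expR_ge0.
apply: (@le_of_linear_error _ _ _ (p * expR x * x)); first exact: mulr_ge0.
move=> e /andP[e0 e1].
have := chernoff_p (lambda := (1 - e) / M).
rewrite divfK ?gt_eqF// s_eq0 mulr0 mul0r subr0.
have -> : t * ((1 - e) / M * r) = x - e * x by rewrite /x; field; rewrite gt_eqF.
rewrite opprB divr_ge0 ?subr_ge0 ?(ltW M_gt0)// => /(_ isT).
rewrite ltrBlDr ltrDl e0 => /(_ isT) H.
have H1 : p * expR x <= nb * expR (e * x).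
  by move: H; rewrite expRD expRN mulrA ler_pdivlMr ?expR_gt0.
have H2 : p * expR x * (1 - e * x) <= p * expR x * expR (- (e * x)).
  by rewrite ler_wpM2l// expR_ge1Dx.
have H3 : p * expR x * expR (- (e * x)) <= nb by rewrite expRN ler_pdivrMr ?expR_gt0.
have := le_trans H2 H3; rewrite mulrBr mulr1 lerBlDr => /le_trans; apply.
by rewrite lerD2l mulrCA.
Qed.

Lemma chernoff_optimal : bernstein_denominator s M r != 0 ->
  p <= nb * expR (- (2 * t * r ^+ 2 / bernstein_denominator s M r)).
Proof.
move=> D0; move: s0; rewrite le_eqVlt => /predU1P[/esym s_eq0|]; last exact: chernoff_optimal_pos.
apply: chernoff_optimal0 => //; rewrite lt_neqAle M0 andbT.
apply: contra_neq D0 => M_eq0; apply/eqP.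
by rewrite bernstein_denominator_eq0 s_eq0 -M_eq0 mul0r addr0.
Qed.

Lemma chernoff_degenerate : bernstein_denominator s M r = 0 -> p = 0.
Proof.
move=> /eqP; rewrite bernstein_denominator_eq0 paddr_eq0 ?(mulr_ge0 M0 (ltW r0))//.
rewrite mulf_eq0 (gt_eqF r0) orbF => /andP[/eqP s_eq0 /eqP M_eq0].
apply/eqP; rewrite eq_le p0 andbT leNgt; apply/negP => p_gt0.
(* Here every lambda >= 0 is allowed. This one makes the exponent -(nb / p + 1), and exp x >= 1 + x
   then gives nb + 2 p <= nb. *)
have l0 : 0 <= (nb / p + 1) / (t * r).
  by rewrite divr_ge0 ?addr_ge0 ?divr_ge0 ?mulr_ge0 ?(ltW t0) ?(ltW r0).
have := chernoff_p l0.
rewrite M_eq0 !mulr0 s_eq0 mulr0 mul0r subr0.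
have -> : t * ((nb / p + 1) / (t * r) * r) = nb / p + 1 by field; rewrite !gt_eqF.
rewrite ltr01 => /(_ isT).
rewrite expRN ler_pdivlMr ?expR_gt0// => H.
have := ler_wpM2l p0 (expR_ge1Dx (nb / p + 1)) => /le_trans/(_ H).
by rewrite !mulrDr mulr1 mulrCA mulfV ?gt_eqF// mulr1; lra.
Qed.

End bernstein_exponent.

Section exponents.
Context (R : realType).
Implicit Types (a b : R).
Local Open Scope ereal_scope.

Lemma expeR_div a b : b != 0%R -> expeR (- (a%:E / b%:E)) = (expR (- (a / b)))%:E.
Proof. by move=> b0; rewrite inver (negbTE b0) -EFinM. Qed.

Lemma expeR_div0 a : (0 < a)%R -> expeR (- (a%:E / 0%:E)) = 0.
Proof. by move=> a0; rewrite inver eqxx gt0_muley ?lte_fin. Qed.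

End exponents.

Lemma bernstein_bounds_le (R : realType) (s M t r : R) (norm : \bar R) :
  0 <= s -> 0 <= M -> 0 < t -> 0 < r -> (0 <= norm)%E ->
  (norm * expeR (- ((2 * t * r ^+ 2)%:E / (bernstein_denominator s M r)%:E)) <=
   norm * expeR (- ((t * r ^+ 2)%:E / (2 * (s + M * r))%:E)))%E.
Proof.
move=> s0 M0 t0 r0 n0; rewrite lee_wpmul2l//.
have [D0|D0] := eqVneq (bernstein_denominator s M r) 0.
  by rewrite D0 expeR_div0 ?expeR_ge0// !mulr_gt0// exprn_gt0.
have sM : s + M * r != 0 by rewrite -bernstein_denominator_eq0.
have D_gt0 : 0 < bernstein_denominator s M r.
  by rewrite lt_neqAle eq_sym D0 bernstein_denominator_ge0.
have sM_gt0 : 0 < s + M * r.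
  by rewrite lt_neqAle eq_sym sM addr_ge0// mulr_ge0// ltW.
rewrite !expeR_div//; last by rewrite mulf_neq0.
rewrite lee_fin ler_expR lerN2 ler_pdivlMr// mulrAC ler_pdivrMr; last by rewrite mulr_gt0.
have := bernstein_denominator_le s0 M0 r0.
have := mulr_gt0 t0 (exprn_gt0 2 r0).
by rewrite -(mulrA 2 t); move: (t * _) (bernstein_denominator _ _ _) => x y x0 H; nra.
Qed.

(** The derivative of mu with respect to itself is 1 only almost everywhere. It is needed to start
    the process from mu in the degenerate case. *)
Lemma Lfun2_density_self d (T : measurableType d) (R : realType) (mu : probability T R) :
  density mu mu \in Lfun mu 2%:E.
Proof.
have mumu : mu `<< mu by [].
have mb := measurable_density mumu.
have b1 : ae_eq mu setT (EFin \o density mu mu) (cst 1%E).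
  apply: integral_ae_eq => //.
  - rewrite (_ : EFin \o _ = Radon_Nikodym (charge_of_finite_measure mu) mu); last first.
      by apply/funext => x; rewrite densityE.
    exact: (@Radon_Nikodym_integrable _ _ _ (charge_of_finite_measure mu) mu).
  - move=> E _ mE; rewrite integral_cst// mul1e.
    have := @Radon_Nikodym_integral _ _ _ (charge_of_finite_measure mu) mu E mumu mE.
    by move=> /= ->; apply: eq_integral => x _; rewrite densityE.
apply: (Lfun2P mb); rewrite (@ae_eq_integral _ _ _ mu setT (cst 1%E))//.
- by rewrite integral_cst_probability ltry.
- by apply/measurable_EFinP/measurable_funX.
- by apply: filterS b1 => x /(_ I) /= [->] _; rewrite expr1n.
Qed.

(** Extends the degenerate case from mu to all beta << mu, including those whose density is not
    square integrable. *)
Lemma dominates_mixture d d' (T : measurableType d) (Omega : measurableType d') (R : realType)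
    (P : R.-pker T ~> Omega) (mu beta : probability T R) (A : set Omega) :
  beta `<< mu -> measurable A -> mixture P mu A = 0%E -> mixture P beta A = 0%E.
Proof.
move=> betamu mA mu0.
have P01 x : (0 <= P x A <= 1)%E.
  have := @le_measure _ _ _ (P x) A setT (mem_set mA) (mem_set measurableT) (@subsetT _ A).
  by rewrite measure_ge0/= [X in (_ <= X)%E -> _]prob_kernel.
have Pfin x : P x A = (fine (P x A))%:E.
  by have /andP[P0 P1] := P01 x; rewrite fineK// ge0_fin_numE// (le_lt_trans P1)// ltry.
have mPA : measurable_fun setT (fun x => fine (P x A)).
  apply/measurable_EFinP; rewrite (_ : EFin \o _ = fun x => P x A); first exact: measurable_kernel.
  by apply/funext => x; rewrite [RHS]Pfin.
have PA1 x : `|fine (P x A)| <= 1.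
  have := P01 x; rewrite Pfin !lee_fin/= => /andP[P0 P1].
  by rewrite ger0_norm.
have P0 : ae_eq mu setT (fun x => P x A) (cst 0%E).
  apply/(ae_eq_integral_abs mu measurableT); first exact: measurable_kernel.
  rewrite -[RHS]mu0; apply: eq_integral => x _.
  by rewrite gee0_abs.
rewrite /mixture; under eq_integral do rewrite Pfin.
rewrite (integral_density betamu mPA PA1).
rewrite (@ae_eq_integral _ _ _ mu setT (cst 0%E)) ?integral0//.
  by apply/measurable_EFinP/measurable_funM => //; exact: measurable_density.
by apply: filterS P0 => x /(_ I) /= -> _; rewrite mul0r.
Qed.

Section bernstein.
Local Open Scope charge_scope.
Context (R : realType) (X : completePseudoMetricType R).
Context d (Omega : measurableType d).
Variables (P : R.-pker (borel X) ~> Omega) (Z : R -> Omega -> X).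
Variable mu : probability (borel X) R.
Hypothesis hausdorffX : hausdorff_space X.
Hypothesis markovZ : cadlag_markov_process P Z.
Hypothesis symP : symmetric_semigroup P Z mu.
Hypothesis contP : strongly_continuous_semigroup P Z mu.

Variable S : L2_operator (borel X) R.
Hypothesis sqrtS : is_sqrt_opp mu (generator P Z mu) S.
Variable c : R.
Hypotheses (c0 : 0 <= c) (poincare_c : poincare mu S c).

Variables (g : borel X -> R) (C m : R).
Hypotheses (mg : measurable_fun [set: borel X] g) (gC : forall x, `|g x| <= C).
Hypothesis g0 : inner mu (bounded_L2 mu mg gC) (one_L2 mu) = 0.
Hypotheses (m0 : 0 <= m) (gm : {ae mu, forall x, g x <= m}).

Lemma bernsteinP : bernstein P Z mu g (asymptotic_variance P Z mu g) (c * m).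
Proof.
move=> beta betamu t r t0 r0.
have s0 := asymptotic_variance_ge0 hausdorffX markovZ symP contP sqrtS c0 poincare_c g0.
have M0 := mulr_ge0 c0 m0.
have norm0 : (0 <= 'N[mu]_2%:E['d (charge_of_finite_measure beta) '/d mu])%E by exact: Lnorm_ge0.
split; last exact: bernstein_bounds_le.
have mA := measurable_deviation mu markovZ mg gC r t0.
have p0 (b : probability (borel X) R) : 0 <= fine (mixture P b (deviation Z g t r)) by exact: fine_ge0.
have key b bmu bL := @chernoff _ _ _ _ _ _ _ hausdorffX markovZ symP contP S sqrtS c c0 poincare_c
  g C m mg gC g0 m0 gm t r t0 b bmu bL.
have [D0|D0] := eqVneq (bernstein_denominator (asymptotic_variance P Z mu g) (c * m) r) 0.
  (* Here s = M = 0 and the first bound is 0 even when the norm is +oo, so the event must be null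
     for every beta; nullity under mu is transferred by absolute continuity. *)
  have := chernoff_degenerate s0 M0 r0 t0 (p0 mu) (sqrtr_ge0 _)
    (key mu (fun _ h => h) (Lfun2_density_self mu)) D0.
  move=> pmu0; rewrite [leLHS](_ : _ = 0%E); first by rewrite mule_ge0// expeR_ge0.
  apply: (dominates_mixture betamu mA).
  by rewrite (deviationE mu markovZ mg gC r t0 mu) pmu0.
rewrite expeR_div//.
(* A density outside L^2 makes the bound +oo, as the exponential is now positive. *)
have [->|] := eqVneq 'N[mu]_2%:E['d (charge_of_finite_measure beta) '/d mu]%E +oo%E.
  by rewrite gt0_mulye ?leey// lte_fin expR_gt0.
rewrite -ltey => /(Lfun2_density betamu) bL.
rewrite (Lnorm2_density betamu bL) -EFinM.
rewrite -[X in mixture P beta X]/(deviation Z g t r) (deviationE mu markovZ mg gC r t0 beta) lee_fin.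
exact: (chernoff_optimal s0 M0 r0 t0 (p0 beta) (key beta betamu bL) D0).
Qed.

End bernstein.

Theorem proposition2p5 (R : realType)
  (* a Polish space, its Borel sigma-field, and the reference measure *)
  (X : completePseudoMetricType R)
  (hausdorffX : hausdorff_space X)
  (separableX : exists2 D : set X, countable D & dense D)
  (mu : probability (borel X) R)
  (* the Markov process *)
  (d : measure_display) (Omega : measurableType d)
  (P : R.-pker (borel X) ~> Omega) (Z : R -> Omega -> X)
  (markovZ : cadlag_markov_process P Z)
  (symP : symmetric_semigroup P Z mu)
  (contP : strongly_continuous_semigroup P Z mu)
  (* the square root of minus the generator *)
  (S : L2_operator (borel X) R)
  (sqrtS : is_sqrt_opp mu (generator P Z mu) S)
  (* the Poincare inequality *)
  (cP : R) (poincare_cP : best_poincare_constant mu S cP)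
  (g : borel X -> R)
  (mg : measurable_fun setT g)
  (bg : exists C : R, forall x, `|g x| <= C)
  (g0 : \int[mu]_x g x = 0) :
  let sigma2 := asymptotic_variance P Z mu g in
  let M := cP * fine ('N[mu]_+oo[EFin \o (g^\+)%R])%E in
  transport_information mu S g sigma2 M /\
  (transport_information mu S g sigma2 M <-> bernstein P Z mu g sigma2 M).
Proof.
move=> sigma2 M; have [C gC] := bg; have [c0 poincare_c _] := poincare_cP.
have g01 : inner mu (bounded_L2 mu mg gC) (one_L2 mu) = 0.
  by rewrite -[RHS]g0; apply: eq_Rintegral => x _; rewrite /= mulr1.
have [m0 gm] := ess_sup_funrpos mu gC.
have TI : transport_information mu S g sigma2 M.
  exact: (transport_informationP hausdorffX markovZ symP contP sqrtS c0 poincare_c g01 m0 gm).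
(* Both sides of the equivalence are true: Bernstein's inequality, too, is derived from the Poincare
   inequality. *)
split=> //; split=> // _.
exact: (bernsteinP hausdorffX markovZ symP contP sqrtS c0 poincare_c g01 m0 gm).
Qed.
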